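(* The map $N$ sending $r\in B^\infty_\epsilon$ to $\tau_r\mathbf{n}_r=\mathbf{n}_r\circ(\mathrm{I}+r)\in\mathscr{C}^\infty(\Gamma,\mathbb{R}^3)$ is $\mathscr{C}^\infty$-Gâteaux differentiable, and its first derivative at $r_0\in B^\infty_\epsilon$ is given for $\xi\in\mathscr{C}^\infty_b(\mathbb{R}^3,\mathbb{R}^3)$ by $$\frac{\partial N}{\partial r}[r_0,\xi]=-\big[\tau_{r_0}\nabla_{\Gamma_{r_0}}\tau_{r_0}^{-1}\xi\big]N(r_0).$$
   Context: Deformations. $\Omega\subset\mathbb{R}^3$ is a bounded domain with smooth ($\mathscr{C}^\infty$), simply connected closed boundary surface $\Gamma$, outer unit normal $\mathbf{n}$. $\mathscr{C}^\infty_b(\mathbb{R}^3,\mathbb{R}^3)$ is the Fréchet space of smooth maps with all derivatives bounded, with seminorms $\|r\|_k=\sup_{0\le p\le k}\sup_x|r^{(p)}(x)|$; $d_\infty$ is the induced metric and $B^\infty_\epsilon=\{r: d_\infty(0,r)<\epsilon\}$, with $\epsilon$ small enough that for all $r\in B^\infty_\epsilon$ the map $\mathrm{I}+r$ is a diffeomorphism of $\Gamma$ onto a smooth closed surface $\Gamma_r=(\mathrm{I}+r)\Gamma$, with outer unit normal $\mathbf{n}_r$ (outward from the deformed domain $\Omega_r$ bounded by $\Gamma_r$). For $u_r$ (scalar or vector valued) defined on $\Gamma_r$, $(\tau_ru_r)(x)=u_r(x+r(x))$, $x\in\Gamma$; $\tau_r^{-1}$ is the inverse; in $\tau_r^{-1}\xi$,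 $\xi$ denotes the restriction of $\xi$ to $\Gamma$. Tangential gradient: $\nabla_{\Gamma_r}u=\nabla\tilde u|_{\Gamma_r}-(\nabla\tilde u|_{\Gamma_r}\cdot\mathbf{n}_r)\mathbf{n}_r$ for any extension $\tilde u$ of a scalar function $u$; for a vector function $\mathbf{u}$, $[\nabla_{\Gamma_r}\mathbf{u}]$ is the matrix whose $i$-th column is the tangential gradient of the $i$-th component of $\mathbf{u}$ ($\tau_r$ is applied entrywise). Gâteaux differentiability. For Fréchet spaces $\mathcal{X},\mathcal{Y}$ and $U\subset\mathcal{X}$, $f:U\to\mathcal{Y}$ is Gâteaux differentiable at $r_0$ if $\frac{\partial f}{\partial r}[r_0,\xi]=\lim_{t\to0}(f(r_0+t\xi)-f(r_0))/t$ exists for all $\xi\in\mathcal{X}$ and is linear and continuous in $\xi$; it is $\mathscr{C}^1$ if this holds at every $r_0\in U$ and $(r_0,\xi)\mapsto\frac{\partial f}{\partial r}[r_0,\xi]$ is continuous; $\mathscr{C}^{m+1}$ if it is $\mathscr{C}^m$ and $r\mapsto\frac{\partial^m f}{\partial r^m}[r,\xi_1,\dots,\xi_m]$ is $\mathscr{C}^1$ for all $\xi_i$; $\mathscr{C}^\infty$ if $\mathscr{C}^m$ for all $m$. *)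

(* Defs.v *)
From HB Require Import structures.
From mathcomp Require Import all_boot all_order all_algebra.
From mathcomp Require Import all_classical all_reals all_analysis.
Import Order.TTheory GRing.Theory Num.Theory.
Import numFieldNormedType.Exports.

Set Implicit Arguments.
Unset Strict Implicit.
Unset Printing Implicit Defensive.

Local Open Scope classical_set_scope.
Local Open Scope ring_scope.

(* Gateaux calculus. A space is a linear subspace [gs_mem] of an ambient      *)
(* module with a nondecreasing sequence of seminorms; its topology is the one *)
(* generated by these seminorms. Both spaces defined below are of this kind.  *)

Record graded_space (R : realType) := GradedSpace {
  gs_sort :> lmodType R;
  gs_mem : set gs_sort;
  gs_norm : nat -> gs_sort -> R }.

Definition gs_prod (R : realType) (X Y : graded_space R) : graded_space R :=
  @GradedSpace R (X * Y)%type
    [set p | gs_mem p.1 /\ gs_mem p.2]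
    (fun k p => gs_norm k p.1 + gs_norm k p.2).

Section Gateaux.
Variables (R : realType) (X Y : graded_space R).

Definition gs_continuous (Z : graded_space R) (A : set Z) (g : Z -> Y) : Prop :=
  forall z0, A z0 -> forall (k : nat) (e : R), 0 < e ->
  exists (j : nat) (d : R), 0 < d /\
    forall z, A z -> gs_norm j (z - z0) < d -> gs_norm k (g z - g z0) < e.

Definition is_gderiv (f : X -> Y) (r0 xi : X) (l : Y) : Prop :=
  gs_mem l /\
  forall k, gs_norm k (h^-1 *: (f (r0 + h *: xi) - f r0) - l)
              @[h --> (0 : R)^'] --> (0 : R).

Definition gderiv (f : X -> Y) (r0 xi : X) : Y :=
  xget 0 [set l | is_gderiv f r0 xi l].

Definition gateaux_differentiable (f : X -> Y) (r0 : X) : Prop :=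
  [/\ forall xi, gs_mem xi -> exists l, is_gderiv f r0 xi l,
      forall (a : R) xi eta, gs_mem xi -> gs_mem eta ->
        gderiv f r0 (a *: xi + eta) = a *: gderiv f r0 xi + gderiv f r0 eta
    & gs_continuous (@gs_mem R X) (gderiv f r0)].

(* [f] is only meaningful on [U], which is meant to be open in [X]: values of *)
(* [f] off [U] then do not affect the limit in [is_gderiv].                   *)
Definition gateaux_C1 (U : set X) (f : X -> Y) : Prop :=
  [/\ forall r, U r -> gs_mem (f r),
      forall r, U r -> gateaux_differentiable f r
    & @gs_continuous (gs_prod X X) [set p | U p.1 /\ gs_mem p.2]
        (fun p => gderiv f p.1 p.2)].

(* The map r |-> d^m f / dr^m [r, xi_1, ..., xi_m] for s = [xi_1; ...; xi_m]. *)
Definition gderiv_iter (f : X -> Y) (s : seq X) : X -> Y :=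
  foldl (fun g xi r => gderiv g r xi) f s.

(* [gateaux_CS U f m] is the class C^(m+1). *)
Fixpoint gateaux_CS (U : set X) (f : X -> Y) (m : nat) : Prop :=
  if m is m'.+1 then
    gateaux_CS U f m' /\
    forall s : seq X, size s = m -> (forall xi, xi \in s -> gs_mem xi) ->
      gateaux_C1 U (gderiv_iter f s)
  else gateaux_C1 U f.

Definition gateaux_smooth (U : set X) (f : X -> Y) : Prop :=
  forall m, gateaux_CS U f m.

End Gateaux.

Section Euclidean.
Variable R : realType.

Definition dot (u v : 'cV[R]_3) : R := \sum_i u i 0 * v i 0.

(* The library norm on matrices is the sup norm. *)
Definition enorm (u : 'cV[R]_3) : R := Num.sqrt (dot u u).

End Euclidean.

Section Smooth.
Variables (R : realType) (F : normedModType R).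
Local Notation E := 'cV[R]_3.

Definition iterD (vs : seq E) (f : E -> F) : E -> F :=
  foldr (fun v g x => 'D_v g x) f vs.

(* Meaningful for [U] open. *)
Definition smooth_on (U : set E) (f : E -> F) : Prop :=
  forall vs x, U x -> differentiable (iterD vs f) x.

Definition local_extension (S : set E) (u : S -> F) (y : S) (v : E -> F) :=
  exists U : set E, [/\ open U, U (val y), smooth_on U v
    & forall z : S, U (val z) -> v (val z) = u z].

Definition smooth_fun (S : set E) (u : S -> F) : Prop :=
  forall y : S, exists v, local_extension u y v.

End Smooth.

Section Surfaces.
Variable R : realType.
Local Notation E := 'cV[R]_3.

Definition boundary (A : set E) : set E := closure A `\` interior A.

(* Embedded surface: near each of its points, a local diffeomorphism of R^3   *)
(* flattens it to the plane where the last coordinate vanishes.               *)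
Definition smooth_surface (S : set E) : Prop :=
  forall y, S y -> exists (U V : set E) (Psi Phi : E -> E),
    [/\ open U /\ U y, open V, smooth_on U Psi, smooth_on V Phi
      & [/\ forall x, U x -> V (Psi x) /\ Phi (Psi x) = x,
            forall z, V z -> U (Phi z) /\ Psi (Phi z) = z
          & forall x, U x -> (S x <-> Psi x ord_max 0 = 0)]].

Definition smooth_closed_surface (S : set E) : Prop :=
  compact S /\ smooth_surface S.

Definition simply_connected (S : set E) : Prop :=
  (forall x y, S x -> S y -> exists g : R -> E,
     [/\ {within `[0, 1], continuous g}, forall t, t \in `[0, 1] -> S (g t),
         g 0 = x & g 1 = y]) /\
  (forall g : R -> E,
     {within `[0, 1], continuous g} -> (forall t, t \in `[0, 1] -> S (g t)) ->
     g 0 = g 1 ->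
     exists H : R * R -> E,
     [/\ {within `[0, 1] `*` `[0, 1], continuous H},
         forall s t, s \in `[0, 1] -> t \in `[0, 1] -> S (H (s, t)),
         forall t, t \in `[0, 1] -> H (0, t) = g t /\ H (1, t) = g 0
       & forall s, s \in `[0, 1] -> H (s, 0) = g 0 /\ H (s, 1) = g 0]).

Definition bounded_domain (Om : set E) : Prop :=
  [/\ open Om, connected Om, Om !=set0 & bounded_set Om].

(* The bounded domain with boundary [S]; there is at most one when [S] is a   *)
(* connected smooth closed surface.                                           *)
Definition enclosed_domain (S : set E) : set E :=
  xget set0 [set Om | bounded_domain Om /\ boundary Om = S].

Definition tangent_vector (S : set E) (y v : E) : Prop :=
  exists g : R -> E,
    [/\ g 0 = y, \forall t \near (0 : R), S (g t) & is_derive (0 : R) 1 g v].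

Definition is_outer_unit_normal (S : set E) (y n : E) : Prop :=
  [/\ enorm n = 1,
      forall v, tangent_vector S y v -> dot n v = 0
    & \forall t \near (0 : R)^'+, enclosed_domain S (y - t *: n) /\
        ~ closure (enclosed_domain S) (y + t *: n)].

Definition outer_normal (S : set E) (y : S) : E :=
  xget 0 [set n | is_outer_unit_normal S (val y) n].

Definition gradient (f : E -> R) (x : E) : E :=
  \col_i 'D_(delta_mx i 0) f x.

Definition tgrad (S : set E) (u : S -> R) (y : S) : E :=
  let g := gradient (xget (cst 0) [set v | local_extension u y v]) (val y) in
  let n := outer_normal y in
  g - dot g n *: n.

Definition tgradv (S : set E) (u : S -> E) (y : S) : 'M[R]_3 :=
  \matrix_(j, i) tgrad (fun z => u z i 0) y j 0.

Definition diffeo (S T : set E) (g : E -> E) : Prop :=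
  [/\ set_bij S T g, smooth_fun (fun x : S => g (val x))
    & exists h : E -> E, (forall x, S x -> h (g x) = x) /\
        smooth_fun (fun y : T => h (val y))].

End Surfaces.

Section Spaces.
Variable R : realType.
Local Notation E := 'cV[R]_3.

(* The values whose supremum is ||r||_k: |r^(p)(x)| is the norm of the p-th   *)
(* derivative as a p-linear map, (v_1, ..., v_p) |-> D_(v_1) ... D_(v_p) r x. *)
Definition cb_values (k : nat) (r : E -> E) : set R :=
  [set a | exists (vs : seq E) (x : E),
     [/\ (size vs <= k)%N, forall v, v \in vs -> enorm v <= 1
       & a = enorm (iterD vs r x)]].

(* C^oo_b(R^3, R^3) *)
Definition Cb : graded_space R :=
  @GradedSpace R (E -> E)
    [set r | smooth_on setT r /\ forall k, has_ubound (cb_values k r)]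
    (fun k r => sup (cb_values k r)).

Definition d_infty (r r' : Cb) : R :=
  limn (series (fun k : nat =>
    2^-1 ^+ k * (gs_norm k (r - r') / (1 + gs_norm k (r - r'))))).

Definition B_infty (eps : R) : set Cb :=
  [set r | gs_mem r /\ d_infty 0 r < eps].

(* [tderiv i u] has as components the i-th components of the tangential       *)
(* gradients of the components of [u].                                        *)
Definition tderiv (S : set E) (i : 'I_3) (u : S -> E) : S -> E :=
  fun y => (row i (tgradv u y))^T.

Definition csurf_values (S : set E) (k : nat) (u : S -> E) : set R :=
  [set a | exists (s : seq 'I_3) (y : S),
     (size s <= k)%N /\ a = enorm (foldr (@tderiv S) u s y)].

(* C^oo(S, R^3) with the seminorms given by the sup over [S] of the iterated  *)
(* tangential derivatives of order at most k. The sup is finite on smooth     *)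
(* functions when [S] is compact.                                             *)
Definition Csurf (S : set E) : graded_space R :=
  @GradedSpace R (S -> E) [set u | smooth_fun u]
    (fun k u => sup (csurf_values k u)).

End Spaces.

Section Deformation.
Variables (R : realType) (S : set 'cV[R]_3).
Local Notation E := 'cV[R]_3.

Definition deformed (r : E -> E) : set E := (fun x => x + r x) @` S.

Lemma deform_subproof (r : E -> E) (x : S) :
  val x + r (val x) \in deformed r.
Proof. by apply/mem_set; exists (val x) => //; exact: set_valP. Qed.

Definition deform (r : E -> E) (x : S) : deformed r :=
  exist _ (val x + r (val x)) (deform_subproof r x).

Lemma undeform_subproof (r : E -> E) (y : deformed r) :
  exists x : S, val x + r (val x) = val y.
Proof.
have [x Sx xy] := set_valP y.
by exists (exist _ x (mem_set Sx)).
Qed.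

(* Inverse of [deform r] when the latter is injective. *)
Definition undeform (r : E -> E) (y : deformed r) : S :=
  projT1 (cid (undeform_subproof y)).

Definition tau (T : Type) (r : E -> E) (u : deformed r -> T) : S -> T :=
  fun x => u (deform r x).

Definition tau_inv (T : Type) (r : E -> E) (v : S -> T) : deformed r -> T :=
  fun y => v (undeform y).

Definition Nmap (r : Cb R) : Csurf S :=
  tau (@outer_normal R (deformed r)).

Definition admissible (eps : R) : Prop :=
  forall r, @B_infty R eps r ->
    smooth_closed_surface (deformed r) /\
    diffeo S (deformed r) (fun x => x + r x).

End Deformation.

(* Main.v *)
From HB Require Import structures.
Require Import Defs.
From mathcomp Require Import all_boot all_order all_algebra.
From mathcomp Require Import all_classical all_reals all_analysis.
From mathcomp Require Import ring lra.
Import Order.TTheory GRing.Theory Num.Theory.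
Import numFieldNormedType.Exports.

Set Implicit Arguments.
Unset Strict Implicit.
Unset Printing Implicit Defensive.

Local Open Scope classical_set_scope.
Local Open Scope ring_scope.

(** If [r] is in the ball and [|D_v r (x)| >= 1] for some point [x] and unit
    vector [v], then, rigid motions preserving the ball, a scaled and rotated
    copy [r'] of [r] satisfies [D_v r' (y) = - v] for a tangent vector [v] at
    a point [y] of [Gamma], and [I + r'] is not a diffeomorphism of [Gamma].
    Hence admissibility forces every [r] in the ball to be a strict contraction
    of R^3, and [I + r] is a homeomorphism of R^3 with a Lipschitz inverse. The
    image of [Om] is the only bounded domain with boundary [Gamma_r]: two such
    domains that are disjoint lie on the two sides of [Gamma_r], so that their
    union with [Gamma_r] is bounded, open and closed. With [M] the inverse of
    [I + D r], the normal is then [N r = M^T n / |M^T n|].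

    Up to a positive factor [M^T n] is polynomial in [D r], so the components of
    [N] belong to the algebra of maps of [r] generated by the smooth functions
    on [Gamma], the entries of [D r], inverses and square roots. Each element of
    this algebra has a Gateaux derivative in the same algebra, whence smoothness
    of all orders. The formula for the derivative follows because both sides are
    orthogonal to [N r] and have the same inner products with the vectors
    [(I + D r) v], [v] tangent to [Gamma]. *)

(* Otherwise iterD would be the lemma of ssrnat. *)
Local Notation iterD := Defs.iterD.

(** * Euclidean geometry and smooth functions of three variables *)

(** The outer normal, the enclosed domain, the extension inside [tgrad] and the value of [gderiv]
    are all defined by choice, so nothing can be computed before existence and uniqueness are known.
    For the enclosed domain no separation theorem is needed: [Om] is given, and its image is a
    candidate. Admissibility speaks only of the restriction of [r] to Gamma, whereas the two sides
    of the deformed surface concern [I + r] off Gamma as well; since the seminorms take suprema over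
    all of R^3 and all unit directions, a rigid motion can bring any point and direction to a
    tangent vector of Gamma, and this carries the information to the whole space.

    Only first derivatives are ever computed: for a fixed direction [xi] the derivative is again in
    the algebra, the entries of [D xi] entering as fixed smooth functions on Gamma. This membership
    says nothing about varying [xi], so the joint continuity in [(r, xi)] required by class C^1 is
    carried along as a separate clause of the induction. *)

Section DotProduct.
Variable R : realType.
Local Notation E := 'cV[R]_3.
Implicit Types (u v w : E) (a : R).

Lemma dotC u v : dot u v = dot v u.
Proof. by apply: eq_bigr => i _; rewrite mulrC. Qed.

Lemma dotDl u v w : dot (u + v) w = dot u w + dot v w.
Proof.
by rewrite /dot -big_split; apply: eq_bigr => i _; rewrite mxE mulrDl.
Qed.

Lemma dotZl a u v : dot (a *: u) v = a * dot u v.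
Proof. by rewrite /dot mulr_sumr; apply: eq_bigr => i _; rewrite mxE mulrA. Qed.

Lemma dotNl u v : dot (- u) v = - dot u v.
Proof. by rewrite -scaleN1r dotZl mulN1r. Qed.

Lemma dotDr u v w : dot u (v + w) = dot u v + dot u w.
Proof. by rewrite dotC dotDl !(dotC u). Qed.

Lemma dotZr a u v : dot u (a *: v) = a * dot u v.
Proof. by rewrite dotC dotZl dotC. Qed.

Lemma dotNr u v : dot u (- v) = - dot u v.
Proof. by rewrite dotC dotNl dotC. Qed.

Lemma dotBl u v w : dot (u - v) w = dot u w - dot v w.
Proof. by rewrite dotDl dotNl. Qed.

Lemma dotBr u v w : dot u (v - w) = dot u v - dot u w.
Proof. by rewrite dotDr dotNr. Qed.

Lemma dot0l v : dot 0 v = 0.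
Proof. by rewrite -(scale0r v) dotZl mul0r. Qed.

Lemma dot0r v : dot v 0 = 0.
Proof. by rewrite dotC dot0l. Qed.

Lemma dot_mulmx (A : 'M[R]_3) u v : dot (A *m u) v = dot u (A^T *m v).
Proof.
rewrite /dot; under eq_bigr do rewrite mxE mulr_suml.
rewrite exchange_big; apply: eq_bigr => i _; rewrite mxE mulr_sumr.
by apply: eq_bigr => j _; rewrite mxE; ring.
Qed.

Lemma dot_mulmxr (A : 'M[R]_3) u v : dot u (A *m v) = dot (A^T *m u) v.
Proof. by rewrite dot_mulmx trmxK. Qed.

Lemma dot_delta u (i : 'I_3) : dot u (delta_mx i 0) = u i 0.
Proof.
rewrite /dot (bigD1 i) //= mxE !eqxx mulr1 big1 ?addr0 // => j ji.
by rewrite mxE (negPf ji) mulr0.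
Qed.

Lemma dot_ge0 u : 0 <= dot u u.
Proof. by apply: sumr_ge0 => i _; rewrite -expr2 sqr_ge0. Qed.

Lemma dot_eq0 u : (dot u u == 0) = (u == 0).
Proof.
apply/eqP/eqP => [/psumr_eq0P u0|->]; last by rewrite dot0l.
apply/matrixP => i j; rewrite ord1 mxE; apply/eqP; rewrite -sqrf_eq0 expr2.
by apply/eqP/u0 => // k _; rewrite -expr2 sqr_ge0.
Qed.

Lemma dot_eqP u v : (forall w, dot u w = dot v w) -> u = v.
Proof.
by move=> uv; apply/matrixP => i j; rewrite ord1 -!dot_delta uv.
Qed.

Lemma sqr_enorm u : enorm u ^+ 2 = dot u u.
Proof. by rewrite sqr_sqrtr ?dot_ge0. Qed.

Lemma enorm_ge0 u : 0 <= enorm u.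
Proof. exact: sqrtr_ge0. Qed.

Lemma enorm_eq0 u : (enorm u == 0) = (u == 0).
Proof. by rewrite -dot_eq0 -sqr_enorm sqrf_eq0. Qed.

Lemma enorm0 : enorm (0 : E) = 0.
Proof. by apply/eqP; rewrite enorm_eq0. Qed.

Lemma enorm_gt0 u : (0 < enorm u) = (u != 0).
Proof. by rewrite lt_neqAle enorm_ge0 andbT eq_sym enorm_eq0. Qed.

Lemma enormZ a u : enorm (a *: u) = `|a| * enorm u.
Proof.
by rewrite /enorm dotZl dotZr mulrA -expr2 sqrtrM ?sqr_ge0 // sqrtr_sqr.
Qed.

Lemma enormN u : enorm (- u) = enorm u.
Proof. by rewrite -scaleN1r enormZ normrN1 mul1r. Qed.

Lemma enormC u v : enorm (u - v) = enorm (v - u).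
Proof. by rewrite -enormN opprB. Qed.

Lemma enorm1_dot u : enorm u = 1 -> dot u u = 1.
Proof. by rewrite -sqr_enorm => ->; rewrite expr1n. Qed.

Lemma dot_enorm1 u : dot u u = 1 -> enorm u = 1.
Proof. by rewrite /enorm => ->; rewrite sqrtr1. Qed.

Lemma dot_le u v : dot u v <= enorm u * enorm v.
Proof.
have [->|u0] := eqVneq u 0; first by rewrite dot0l enorm0 mul0r.
have [->|v0] := eqVneq v 0; first by rewrite dot0r enorm0 mulr0.
move: u0 v0; rewrite -!enorm_gt0 => u0 v0.
have := dot_ge0 (enorm v *: u - enorm u *: v).
rewrite dotBl !dotBr !dotZl !dotZr (dotC v u) -!sqr_enorm.
set a := enorm u in u0 *; set b := enorm v in v0 *; set d := dot u v => H.
have : 0 <= 2 * (a * b) * (a * b - d) by lra.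
by rewrite pmulr_rge0 ?subr_ge0 // !mulr_gt0.
Qed.

Lemma enormD u v : enorm (u + v) <= enorm u + enorm v.
Proof.
rewrite -(@ler_pXn2r _ 2) ?nnegrE ?addr_ge0 ?enorm_ge0 //.
rewrite sqr_enorm dotDl !dotDr (dotC v u) -!sqr_enorm.
have := dot_le u v; lra.
Qed.

Lemma enorm_sum (I : Type) (s : seq I) (f : I -> E) :
  enorm (\sum_(i <- s) f i) <= \sum_(i <- s) enorm (f i).
Proof.
elim/big_ind2 : _ => [|u a v b ua vb|//]; first by rewrite enorm0.
by rewrite (le_trans (enormD _ _)) ?lerD.
Qed.

Lemma coord_le_enorm u i : `|u i 0| <= enorm u.
Proof.
rewrite -sqrtr_sqr ler_wsqrtr // /dot (bigD1 i) //= -expr2 lerDl.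
by apply: sumr_ge0 => j _; rewrite -expr2 sqr_ge0.
Qed.

Lemma enorm_le_coord u a : (forall i, `|u i 0| <= a) -> enorm u <= 3 * a.
Proof.
move=> ua; rewrite [u]matrix_sum_delta (le_trans (enorm_sum _ _)) //.
under eq_bigr do rewrite big_ord1.
rewrite !big_ord_recl big_ord0 !enormZ.
have d1 (i : 'I_3) : enorm (delta_mx i 0 : E) = 1.
  by apply: dot_enorm1; rewrite dot_delta mxE !eqxx.
rewrite !d1 !mulr1.
have := ua ord0; have := ua (lift ord0 ord0); have := ua (lift ord0 (lift ord0 ord0)).
lra.
Qed.

Lemma norm_le_enorm u : `|u| <= enorm u.
Proof.
rewrite {1}/Num.norm /= mx_normrE bigmax_le ?enorm_ge0 // => -[i j] _.
by rewrite ord1 coord_le_enorm.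
Qed.

Lemma coord_le_norm u i : `|u i 0| <= `|u|.
Proof. by rewrite {2}/Num.norm /= mx_normrE; apply: (le_bigmax _ _ (i, 0)). Qed.

Lemma enorm_le_norm u : enorm u <= 3 * `|u|.
Proof. by apply: enorm_le_coord => i; exact: coord_le_norm. Qed.

Lemma orth_proj (n g : E) : enorm n = 1 ->
  (forall v, dot n v = 0 -> dot g v = 0) -> g = dot g n *: n.
Proof.
move=> /enorm1_dot n1 ng; apply: dot_eqP => w.
have := ng (w - dot n w *: n); rewrite dotBr dotZr n1 mulr1 subrr => /(_ erefl).
by rewrite dotBr dotZr dotZl mulrC => /eqP; rewrite subr_eq0 => /eqP.
Qed.

(** Orthogonal symmetry across the plane orthogonal to [w]. For [w = 0] it is the identity, so that
    [reflection (u - v)] exchanges unit vectors even when they are equal. *)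
Definition reflection (w : E) : 'M[R]_3 :=
  1%:M - (2 / dot w w) *: (w *m w^T).

Lemma reflectionE w v : reflection w *m v = v - (2 / dot w w * dot w v) *: w.
Proof.
rewrite mulmxBl mul1mx -scalemxAl -mulmxA -scalerA; congr (_ - _ *: _).
have -> : w^T *m v = (dot w v)%:M.
  apply/matrixP => i j; rewrite !ord1 !mxE eqxx mulr1n.
  by apply: eq_bigr => k _; rewrite mxE.
by rewrite mul_mx_scalar.
Qed.

Lemma reflection_dot w u v :
  dot (reflection w *m u) (reflection w *m v) = dot u v.
Proof.
rewrite !reflectionE; have [->|w0] := eqVneq w 0; first by rewrite !scaler0 !subr0.
rewrite dotBl !dotBr !dotZl !dotZr (dotC u w).
by field; rewrite dot_eq0.
Qed.

Lemma reflection_sub u v : enorm u = 1 -> enorm v = 1 ->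
  reflection (u - v) *m u = v.
Proof.
move=> u1 v1; rewrite reflectionE.
have [->|uv] := eqVneq u v; first by rewrite subrr scaler0 subr0.
have := uv; rewrite -subr_eq0 -dot_eq0 => w0.
suff -> : 2 / dot (u - v) (u - v) * dot (u - v) u = 1.
  by rewrite scale1r opprB addrC subrK.
apply: (mulIf w0); rewrite mulrAC mulfVK //.
rewrite !(dotBl, dotBr) !enorm1_dot // (dotC v u); ring.
Qed.

Lemma reflection_enorm w u : enorm (reflection w *m u) = enorm u.
Proof. by rewrite /enorm reflection_dot. Qed.

End DotProduct.

(** * Differentials and directional derivatives *)

Section Differentials.
Variables (R : realType).
Local Notation E := 'cV[R]_3.

Lemma differentiable_epsP (V W : normedModType R) (f : V -> W) (x : V)
    (L : {linear V -> W}) : continuous L ->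
  (forall e, 0 < e ->
     \forall h \near (0 : V), `|f (h + x) - f x - L h| <= e * `|h|) ->
  differentiable f x /\ 'd f x = L :> (V -> W).
Proof.
move=> Lc Le; have fL : f \o shift x = cst (f x) + L +o_ 0 id.
  apply: eqaddoE; apply/eqaddoP => e e0; have := Le _ e0.
  by apply: filterS => h /=; rewrite opprD addrA.
have dL := diff_unique Lc fL; split => //.
by apply/diff_locallyP; rewrite dL; split.
Qed.

Lemma differentiable_eps (V W : normedModType R) (f : V -> W) (x : V) :
  differentiable f x -> forall e, 0 < e ->
  \forall h \near (0 : V), `|f (h + x) - f x - 'd f x h| <= e * `|h|.
Proof.
move=> /diff_locally fL e e0; have /eqaddoP := fL; move/(_ e e0).
by apply: filterS => h /=; rewrite opprD addrA.
Qed.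

Lemma near_eq_differentiable (V W : normedModType R) (f g : V -> W) (x : V) :
  (\forall y \near x, f y = g y) -> differentiable f x -> differentiable g x.
Proof.
move=> fg df; have fgx := nbhs_singleton fg.
have := differentiable_epsP (diff_continuous df) (f := g) (x := x).
case=> // e /(differentiable_eps df).
have /nbhs0P : \forall y \near x, f y = g y by [].
by apply: filterS2 => h; rewrite addrC => <-; rewrite fgx.
Qed.

Lemma derive_comp (U V W : normedModType R) (f : U -> V) (g : V -> W) x v :
  differentiable f x -> differentiable g (f x) ->
  'D_v (fun z => g (f z)) x = 'D_('D_v f x) g (f x).
Proof.
move=> df dg; rewrite !deriveE //; last exact: differentiable_comp.
by have -> := diff_comp df dg.
Qed.

Lemma is_derive_comp_curve (V W : normedModType R) (c : R -> V) (f : V -> W) (v : V) (t : R) :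
  is_derive t 1 c v -> differentiable f (c t) ->
  is_derive t 1 (fun t => f (c t)) ('D_v f (c t)).
Proof.
move=> [/derivable1_diffP dc <-] df; apply: DeriveDef.
  exact/derivable1_diffP/differentiable_comp.
exact: derive_comp.
Qed.

Lemma differentiable_entry (V : normedModType R) m n (f : V -> 'M[R]_(m, n)) x i j :
  differentiable f x -> differentiable (fun z => f z i j) x.
Proof. by move=> df; apply: (differentiable_comp df (differentiable_coord _ _ _)). Qed.

Lemma differentiable_cV (V : normedModType R) (f : V -> E) x :
  (forall i, differentiable (fun z => f z i 0) x) -> differentiable f x.
Proof.
move=> df.
have -> : f = \sum_(i < 3) (fun z => f z i 0 *: (delta_mx i 0 : E)).
  apply/funext => z; rewrite fct_sumE [LHS]matrix_sum_delta.
  by apply: eq_bigr => i _; rewrite big_ord1.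
by apply: differentiable_sum => i; exact: differentiableZl.
Qed.

Lemma derive_entry (V : normedModType R) m n (f : V -> 'M[R]_(m, n)) x v i j :
  derivable f x v -> 'D_v f x i j = 'D_v (fun z => f z i j) x.
Proof. by move=> df; rewrite derive_mx // mxE. Qed.

Lemma derive_sum_delta (W : normedModType R) (f : E -> W) x v :
  differentiable f x -> 'D_v f x = \sum_i v i 0 *: 'D_(delta_mx i 0) f x.
Proof.
move=> df; rewrite deriveE // {1}[v]matrix_sum_delta linear_sum.
by apply: eq_bigr => i _; rewrite big_ord1 linearZ deriveE.
Qed.

Lemma derive_gradient (f : E -> R) x v : differentiable f x ->
  'D_v f x = dot (gradient f x) v.
Proof.
move=> df; rewrite derive_sum_delta //; apply: eq_bigr => i _.
by rewrite mxE mulrC.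
Qed.

Definition jac (f : E -> E) x : 'M[R]_3 :=
  \matrix_(i, j) 'D_(delta_mx j 0) (fun z => f z i 0) x.

Lemma derive_jac (f : E -> E) x v : differentiable f x ->
  'D_v f x = jac f x *m v.
Proof.
move=> df; apply/matrixP => i j; rewrite ord1 derive_entry; last exact: diff_derivable.
rewrite derive_sum_delta; last exact: differentiable_entry.
by rewrite mxE; apply: eq_bigr => k _; rewrite mxE mulrC.
Qed.

Lemma open_near (T : topologicalType) (U : set T) (x : T) (P : T -> Prop) :
  open U -> U x -> (forall y, U y -> P y) -> \forall y \near x, P y.
Proof.
by move=> oU Ux UP; have := open_nbhs_nbhs (conj oU Ux); apply: filterS.
Qed.

End Differentials.

(** * Closure properties of smooth functions *)

Section SmoothFunctions.
Variable R : realType.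
Local Notation E := 'cV[R]_3.

(** Smoothness concerns all iterated derivatives, but for a class stable under one directional
    derivative, up to equality on [U], it is enough to differentiate once. No formula for higher
    derivatives of products or compositions is needed. *)
Lemma smooth_on_class (F : normedModType R) (U : set E) (P : (E -> F) -> Prop) :
  open U -> (forall g x, P g -> U x -> differentiable g x) ->
  (forall g v, P g -> exists2 g', P g' & forall x, U x -> 'D_v g x = g' x) ->
  forall f, P f -> smooth_on U f.
Proof.
move=> oU dP DP f Pf vs.
suff [g Pg gE] : exists2 g, P g & forall x, U x -> iterD vs f x = g x.
  move=> x Ux; apply: near_eq_differentiable (dP _ _ Pg Ux).
  by apply: (open_near oU Ux) => y Uy; rewrite gE.
elim: vs => [|v vs [g Pg gE]]; first by exists f.
have [g' Pg' g'E] := DP g v Pg; exists g' => // x Ux.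
rewrite -g'E //=; apply: near_eq_derive.
by apply: (open_near oU Ux) => y Uy; rewrite gE.
Qed.

Lemma iterD_catl (F : normedModType R) vs ws (f : E -> F) :
  iterD (vs ++ ws) f = iterD vs (iterD ws f).
Proof. by rewrite /iterD foldr_cat. Qed.

Lemma smooth_on_derive (F : normedModType R) (U : set E) (f : E -> F) v :
  smooth_on U f -> smooth_on U (fun x => 'D_v f x).
Proof.
move=> sf vs x Ux; have := sf (rcons vs v) x Ux.
by rewrite -cats1 iterD_catl.
Qed.

Lemma smooth_on_diff (F : normedModType R) (U : set E) (f : E -> F) x :
  smooth_on U f -> U x -> differentiable f x.
Proof. by move=> sf; exact: sf [::] x. Qed.

Lemma smooth_on_sub (F : normedModType R) (U V : set E) (f : E -> F) :
  V `<=` U -> smooth_on U f -> smooth_on V f.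
Proof. by move=> VU sf vs x /VU; exact: sf. Qed.

Lemma iterD_eq (F : normedModType R) (U : set E) (f g : E -> F) vs : open U ->
  (forall x, U x -> f x = g x) -> forall x, U x -> iterD vs f x = iterD vs g x.
Proof.
move=> oU fg; elim: vs => [|v vs IH] //= x Ux.
by apply: near_eq_derive; apply: (open_near oU Ux).
Qed.

Lemma smooth_on_eq (F : normedModType R) (U : set E) (f g : E -> F) : open U ->
  (forall x, U x -> f x = g x) -> smooth_on U f -> smooth_on U g.
Proof.
move=> oU fg sf vs x Ux; apply: near_eq_differentiable (sf vs x Ux).
by apply: (open_near oU Ux); exact: iterD_eq.
Qed.

Lemma iterD_entry (U : set E) (f : E -> E) i vs x : open U -> smooth_on U f ->
  U x -> iterD vs f x i 0 = iterD vs (fun z => f z i 0) x.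
Proof.
move=> oU sf; elim: vs x => [|v vs IH] //= x Ux.
rewrite derive_entry; last exact/diff_derivable/sf.
by apply: near_eq_derive; apply: (open_near oU Ux).
Qed.

Lemma smooth_on_entry (U : set E) (f : E -> E) i : open U -> smooth_on U f ->
  smooth_on U (fun z => f z i 0).
Proof.
move=> oU sf vs x Ux; have := differentiable_entry i 0 (sf vs x Ux).
apply: near_eq_differentiable; apply: (open_near oU Ux) => y Uy.
exact: (iterD_entry _ _ oU).
Qed.

Lemma smooth_on_cV (U : set E) (f : E -> E) : open U ->
  (forall i, smooth_on U (fun z => f z i 0)) -> smooth_on U f.
Proof.
move=> oU sf; pose P (g : E -> E) := forall i, smooth_on U (fun z => g z i 0).
have dP g x : P g -> U x -> differentiable g x.
  by move=> Pg Ux; apply: differentiable_cV => i; exact: smooth_on_diff (Pg i) Ux.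
apply: (smooth_on_class oU (P := P)) => // g v Pg.
exists (fun x => 'D_v g x) => // i.
apply: (smooth_on_eq oU _ (smooth_on_derive v (Pg i))) => x Ux.
by rewrite derive_entry //; exact/diff_derivable/dP.
Qed.

Lemma smooth_on_cst (F : normedModType R) (U : set E) (a : F) : open U ->
  smooth_on U (fun=> a).
Proof.
move=> oU; apply: (smooth_on_class oU (P := fun f => exists b, f = fun=> b));
  last by exists a.
  by move=> g x [b ->] _; exact: differentiable_cst.
move=> g v [b ->]; exists (fun=> 0) => [|x _]; first by exists 0.
exact: derive_cst.
Qed.

(** A class that contains its own derivatives: differentiating [g (h x)] gives a sum of products of
    derivatives of the components of [h] with derivatives of [g] at [h x], again of this form.
    Composition is stated through the components of [h], to which the induction applies. *)
Inductive smooth_closure (U : set E) : (E -> R) -> Prop :=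
| SmoothBase f of smooth_on U f : smooth_closure U f
| SmoothAdd f g of smooth_closure U f & smooth_closure U g :
    smooth_closure U (fun x => f x + g x)
| SmoothMul f g of smooth_closure U f & smooth_closure U g :
    smooth_closure U (fun x => f x * g x)
| SmoothInv f of smooth_closure U f & (forall x, U x -> f x != 0) :
    smooth_closure U (fun x => (f x)^-1)
| SmoothSqrt f of smooth_closure U f & (forall x, U x -> 0 < f x) :
    smooth_closure U (fun x => Num.sqrt (f x))
| SmoothComp V g h of open V & smooth_on V g & (forall x, U x -> V (h x)) &
    (forall i, smooth_closure U (fun x => h x i 0)) :
    smooth_closure U (fun x => g (h x)).

Lemma smooth_closure_sum (U : set E) (I : Type) (s : seq I) (f : I -> E -> R) :
  open U -> (forall i, smooth_closure U (f i)) ->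
  smooth_closure U (fun x => \sum_(i <- s) f i x).
Proof.
move=> oU sf; rewrite -(_ : \sum_(i <- s) f i = fun x => \sum_(i <- s) f i x).
  elim/big_ind : _ => //; first exact/SmoothBase/smooth_on_cst.
  by move=> g h sg sh; exact: SmoothAdd.
by apply/funext => x; rewrite fct_sumE.
Qed.

Lemma smooth_closure_diff (U : set E) f x : smooth_closure U f -> U x ->
  differentiable f x.
Proof.
move=> sf Ux; elim: sf => {f}.
- by move=> f sf; exact: smooth_on_diff sf Ux.
- by move=> f g _ df _ dg; exact: differentiableD.
- by move=> f g _ df _ dg; exact: differentiableM.
- by move=> f _ df f0; apply: differentiableV => //; exact: f0.
- move=> f _ df f0; apply: (differentiable_comp df).
  by apply/derivable1_diffP; have [] := is_derive1_sqrt (f0 x Ux).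
- move=> V g h oV sg hV _ dh.
  apply: (differentiable_comp (differentiable_cV dh)).
  exact/(smooth_on_diff sg)/hV.
Qed.

Lemma smooth_closure_on (U : set E) f : open U ->
  smooth_closure U f -> smooth_on U f.
Proof.
move=> oU; move: f; apply: (smooth_on_class oU).
  by move=> g x; exact: smooth_closure_diff.
have D := smooth_closure_diff; move=> g v.
have DD f x : smooth_closure U f -> U x -> derivable f x v.
  by move=> sf Ux; exact/diff_derivable/(D _ _ _ sf Ux).
elim=> {g}.
- move=> f sf; exists (fun x => 'D_v f x) => //.
  exact/SmoothBase/smooth_on_derive.
- move=> f g sf [f' sf' f'E] sg [g' sg' g'E].
  exists (fun x => f' x + g' x); first exact: SmoothAdd.
  move=> x Ux; rewrite deriveD ?f'E ?g'E //; exact: DD.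
- move=> f g sf [f' sf' f'E] sg [g' sg' g'E].
  exists (fun x => f x * g' x + g x * f' x); first by apply: SmoothAdd; exact: SmoothMul.
  move=> x Ux; rewrite (@deriveM _ _ f g) ?f'E ?g'E //; exact: DD.
- move=> f sf [f' sf' f'E] f0.
  exists (fun x => -1 * ((f x)^-1 * (f x)^-1 * f' x)).
    apply: SmoothMul; first exact/SmoothBase/smooth_on_cst.
    by do !apply: SmoothMul => //; exact: SmoothInv.
  move=> x Ux; rewrite (@deriveV _ _ f) ?f0 ?f'E //; last exact: DD.
  by rewrite -[_ *: _]/(_ * _) -exprVn expr2; ring.
- move=> f sf [f' sf' f'E] f0.
  exists (fun x => f' x * (2 * Num.sqrt (f x))^-1).
    apply: SmoothMul => //; apply: SmoothInv.
      by apply: SmoothMul; [exact/SmoothBase/smooth_on_cst|exact: SmoothSqrt].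
    by move=> x Ux; rewrite mulf_neq0 // gt_eqF // sqrtr_gt0 f0.
  move=> x Ux; have [ds sE] := is_derive1_sqrt (f0 x Ux).
  have ds' : differentiable Num.sqrt (f x) by apply/derivable1_diffP.
  rewrite derive_comp //; last exact: D Ux.
  rewrite f'E // -sE -[RHS]/(f' x *: 'D_1 Num.sqrt (f x)).
  by rewrite !deriveE // -linearZ /= [_ *: 1]mulr1.
- move=> V g h oV sg hV sh IH.
  have [h' Ph'] : {h' : 'I_3 -> E -> R & forall i, smooth_closure U (h' i) /\
      forall x, U x -> 'D_v (fun x => h x i 0) x = h' i x}.
    apply: (@choice _ _ (fun i h' => smooth_closure U h' /\
      forall x, U x -> 'D_v (fun x => h x i 0) x = h' x)) => i.
    by have [h' ? ?] := IH i; exists h'.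
  exists (fun x => \sum_i h' i x * 'D_(delta_mx i 0) g (h x)).
    apply: smooth_closure_sum => // i; apply: SmoothMul; first by case: (Ph' i).
    exact: (SmoothComp oV (smooth_on_derive _ sg)).
  move=> x Ux; have dh : differentiable h x.
    by apply: differentiable_cV => i; exact: D Ux.
  have dg := smooth_on_diff sg (hV x Ux).
  rewrite derive_comp // derive_sum_delta //; apply: eq_bigr => i _.
  rewrite -(Ph' i).2 // derive_entry //; exact/diff_derivable.
Qed.

End SmoothFunctions.

(** * Bounded smooth deformations *)

Section LinearMaps.
Variable R : realType.
Local Notation E := 'cV[R]_3.

Lemma differentiable_mulmx (P : 'M[R]_3) (x : E) : differentiable (mulmx P) x.
Proof.
apply: differentiable_cV => i.
have -> : (fun z : E => (P *m z) i 0) = \sum_(j < 3) (P i j \*o (fun z : E => z j 0)).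
  by apply/funext => z; rewrite fct_sumE mxE.
apply: differentiable_sum => j.
apply: (differentiableZ (f := fun z : E => z j 0)).
exact: differentiable_coord.
Qed.

Lemma derive_mulmx (P : 'M[R]_3) (x v : E) : 'D_v (mulmx P) x = P *m v.
Proof.
rewrite deriveE; last exact: differentiable_mulmx.
rewrite (@diff_lin _ _ _ (mulmx P)) // => y.
exact/differentiable_continuous/differentiable_mulmx.
Qed.

End LinearMaps.

Section BoundedSmooth.
Variable R : realType.
Local Notation E := 'cV[R]_3.
Local Notation Cb := (Cb R).
Implicit Types r s : Cb.

Lemma Cb_smooth r : gs_mem r -> smooth_on setT (r : E -> E).
Proof. by case. Qed.

Lemma Cb_diff r vs x : gs_mem r -> differentiable (iterD vs (r : E -> E)) x.
Proof. by move=> /Cb_smooth sr; exact: sr. Qed.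

Lemma iterD_linear a (f g : E -> E) vs x :
  smooth_on setT f -> smooth_on setT g ->
  iterD vs (fun x => a *: f x + g x) x = a *: iterD vs f x + iterD vs g x.
Proof.
move=> sf sg; elim: vs x => [|v vs IH] //= x.
have -> : iterD vs (fun x => a *: f x + g x) = a *: iterD vs f + iterD vs g.
  by apply/funext => y; rewrite IH.
have df := diff_derivable (v := v) (sf vs x I).
have dg := diff_derivable (v := v) (sg vs x I).
by rewrite (deriveD (derivableZ df) dg) (deriveZ _ df).
Qed.

Lemma le_Cb_norm r k vs x : gs_mem r -> (size vs <= k)%N ->
  (forall v, v \in vs -> enorm v <= 1) ->
  enorm (iterD vs (r : E -> E) x) <= gs_norm k r.
Proof.
move=> [_ rb] vk v1; apply: (ub_le_sup (rb k)).
by exists vs, x.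
Qed.

Lemma Cb_norm_le k r a : (forall vs x, (size vs <= k)%N ->
  (forall v, v \in vs -> enorm v <= 1) -> enorm (iterD vs (r : E -> E) x) <= a) ->
  gs_norm k r <= a.
Proof.
move=> ra; apply: ge_sup; last by move=> _ [vs [x [vk v1 ->]]]; exact: ra.
by exists (enorm (r 0)), [::], 0.
Qed.

Lemma Cb_norm_ge0 k r : gs_mem r -> 0 <= gs_norm k r.
Proof.
by move=> rm; apply: le_trans (le_Cb_norm (vs := [::]) 0 rm _ _) => //; exact: enorm_ge0.
Qed.

Lemma Cb_mem_lin a r s : gs_mem r -> gs_mem s -> gs_mem (a *: r + s : Cb).
Proof.
move=> rm sm; have [sr ss] := (Cb_smooth rm, Cb_smooth sm).
have E1 vs x : iterD vs ((a *: r + s : Cb) : E -> E) x =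
    a *: iterD vs (r : E -> E) x + iterD vs (s : E -> E) x.
  by rewrite -iterD_linear.
split=> [vs x _|k].
  have -> : iterD vs ((a *: r + s : Cb) : E -> E) =
     a *: iterD vs (r : E -> E) + iterD vs (s : E -> E).
    by apply/funext => y; rewrite E1.
  by apply: differentiableD; [apply: differentiableZ; exact: sr|exact: ss].
exists (`|a| * gs_norm k r + gs_norm k s) => _ [vs [x [vk v1 ->]]].
rewrite E1 (le_trans (enormD _ _)) // enormZ lerD ?ler_wpM2l ?le_Cb_norm //.
Qed.

Lemma Cb_norm_lin k a r s : gs_mem r -> gs_mem s ->
  gs_norm k (a *: r + s : Cb) <= `|a| * gs_norm k r + gs_norm k s.
Proof.
move=> rm sm; apply: Cb_norm_le => vs x vk v1.
rewrite -[iterD _ _ _]/(iterD vs (fun x => a *: r x + s x) x).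
rewrite (@iterD_linear a r s) //; try exact: Cb_smooth.
by rewrite (le_trans (enormD _ _)) // enormZ lerD ?ler_wpM2l ?le_Cb_norm.
Qed.

Lemma Cb_mem0 : gs_mem (0 : Cb).
Proof.
have E0 vs x : iterD vs (0 : E -> E) x = 0.
  elim: vs x => [|v vs IH] x //=; rewrite (_ : iterD vs _ = cst 0) ?derive_cst //.
  exact/funext.
split=> [vs x _|k]; last by exists 0 => _ [vs [x [_ _ ->]]]; rewrite E0 enorm0.
rewrite (_ : iterD vs _ = cst 0); first exact: differentiable_cst.
exact/funext.
Qed.

Lemma Cb_memZ a r : gs_mem r -> gs_mem (a *: r : Cb).
Proof. by move=> rm; rewrite -[a *: r]addr0; apply: Cb_mem_lin => //; exact: Cb_mem0. Qed.

Lemma Cb_memD r s : gs_mem r -> gs_mem s -> gs_mem (r + s : Cb).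
Proof. by move=> rm sm; rewrite -[r]scale1r; apply: Cb_mem_lin. Qed.

Lemma Cb_memB r s : gs_mem r -> gs_mem s -> gs_mem (r - s : Cb).
Proof. by move=> rm sm; rewrite -scaleN1r addrC; apply: Cb_mem_lin. Qed.

Lemma Cb_norm0 k : gs_norm k (0 : Cb) = 0.
Proof.
apply/eqP; rewrite eq_le Cb_norm_ge0 ?andbT; last exact: Cb_mem0.
apply: Cb_norm_le => vs x _ _; rewrite (_ : iterD vs _ x = 0) ?enorm0 //.
elim: vs x => [|v vs IH] x //=; rewrite (_ : iterD vs _ = cst 0) ?derive_cst //.
exact/funext.
Qed.

Lemma Cb_normZ k a r : gs_mem r -> gs_norm k (a *: r : Cb) <= `|a| * gs_norm k r.
Proof.
move=> rm; rewrite -[a *: r]addr0 (le_trans (Cb_norm_lin _ _ rm Cb_mem0)) //.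
by rewrite Cb_norm0 addr0.
Qed.

Lemma Cb_normN k r : gs_mem r -> gs_norm k (- r : Cb) = gs_norm k r.
Proof.
move=> rm; have le s : gs_mem s -> gs_norm k (- s : Cb) <= gs_norm k s.
  by move=> sm; rewrite -scaleN1r (le_trans (Cb_normZ _ _ sm)) // normrN1 mul1r.
have rm' : gs_mem (- r : Cb) by rewrite -scaleN1r; exact: Cb_memZ.
by apply/eqP; rewrite eq_le le //; have := le _ rm'; rewrite opprK.
Qed.

Lemma Cb_normD k r s : gs_mem r -> gs_mem s ->
  gs_norm k (r + s : Cb) <= gs_norm k r + gs_norm k s.
Proof.
move=> rm sm; have := Cb_norm_lin k 1 rm sm.
by rewrite scale1r normr1 mul1r.
Qed.

Lemma Cb_norm_mono r j k : gs_mem r -> (j <= k)%N -> gs_norm j r <= gs_norm k r.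
Proof.
move=> rm jk; apply: Cb_norm_le => vs x vj v1.
by apply: le_Cb_norm => //; exact: leq_trans jk.
Qed.

(** * The metric [d_infty] and its balls *)

Section Distance.

Let q (a : R) := a / (1 + a).

Let q_bd (a : R) : 0 <= a -> 0 <= q a <= 1.
Proof.
move=> a0; rewrite /q divr_ge0 ?addr_ge0 //= ler_pdivrMr; last lra.
lra.
Qed.

Let q_mono (a b : R) : 0 <= a -> a <= b -> q a <= q b.
Proof.
move=> a0 ab; rewrite /q ler_pdivrMr; last lra.
by rewrite mulrAC ler_pdivlMr; [nra|lra].
Qed.

Let q_sub (a b : R) : 0 <= a -> 0 <= b -> q (a + b) <= q a + b.
Proof.
move=> a0 b0; rewrite -subr_ge0.
have -> : q a + b - q (a + b) =
   b * ((1 + a) * (1 + a + b) - 1) / ((1 + a) * (1 + a + b)).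
  by rewrite /q; field; apply/andP; split; apply: lt0r_neq0; lra.
by rewrite divr_ge0 ?mulr_ge0 //; nra.
Qed.

Let q_scale (c a : R) : 1 <= c -> 0 <= a -> q (c * a) <= c * q a.
Proof.
move=> c1 a0; rewrite /q mulrA ler_pdivrMr; last nra.
rewrite mulrAC ler_pdivlMr; last lra.
rewrite -subr_ge0.
have -> : c * a * (1 + c * a) - c * a * (1 + a) = c * a * a * (c - 1) by ring.
by rewrite !mulr_ge0 ?subr_ge0 //; lra.
Qed.

(** With [m = (e - d) / 12], the error series of [B_infty_open] sums to [2 m / (1 - 3/4) = 8 m],
    which stays below the margin [12 m]. *)
Let margin_lt (d e : R) : d < e -> d + 8 * ((e - d) / 12) < e.
Proof. by move=> ?; lra. Qed.

Let term r k := 2^-1 ^+ k * q (gs_norm k r).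

Let term_ge0 r k : gs_mem r -> 0 <= term r k.
Proof.
move=> rm; rewrite mulr_ge0 ?exprn_ge0 //.
by have /andP[] := q_bd (Cb_norm_ge0 k rm).
Qed.

Let term_cvg r : gs_mem r -> cvgn (series (term r)).
Proof.
move=> rm; apply: (@series_le_cvg _ _ (geometric 1 2^-1)).
- by move=> k; exact: term_ge0.
- by move=> k; rewrite /geometric /= mul1r exprn_ge0.
- move=> k; rewrite /geometric /= mul1r ger_pMr ?exprn_gt0 //.
  by have /andP[] := q_bd (Cb_norm_ge0 k rm).
- apply: is_cvg_geometric_series; rewrite ger0_norm //; lra.
Qed.

Let d_inftyE r : gs_mem r -> d_infty 0 r = limn (series (term r)).
Proof.
move=> rm; rewrite /d_infty; congr (limn (series _)).
by apply/funext => k; rewrite sub0r Cb_normN.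
Qed.

Lemma d_infty_le r s : gs_mem r -> gs_mem s ->
  (forall k, gs_norm k r <= gs_norm k s) -> d_infty 0 r <= d_infty 0 s.
Proof.
move=> rm sm rs; rewrite !d_inftyE //; apply: lim_series_le; try exact: term_cvg.
by move=> k; rewrite ler_wpM2l ?exprn_ge0 // q_mono // Cb_norm_ge0.
Qed.

(** Serves to enlarge a deformation by some factor [c > 1] without leaving the ball. *)
Lemma d_infty_scale c r : gs_mem r -> 1 <= c ->
  d_infty 0 (c *: r : Cb) <= c * d_infty 0 r.
Proof.
move=> rm c1; have c0 : 0 <= c by lra.
have crm : gs_mem (c *: r : Cb) by exact: Cb_memZ.
rewrite !d_inftyE // -[c * _]/(c *: _) -lim_seriesZ; last exact: term_cvg.
apply: lim_series_le; first exact: term_cvg.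
  by apply: is_cvg_seriesZ; exact: term_cvg.
move=> k; rewrite -[(c *: _) k]/(c * term r k) /term [leRHS]mulrCA.
rewrite ler_wpM2l ?exprn_ge0 //.
rewrite (le_trans _ (q_scale c1 (Cb_norm_ge0 k rm))) // q_mono ?Cb_norm_ge0 //.
by rewrite (le_trans (Cb_normZ _ _ rm)) // ger0_norm.
Qed.

(** The weights are split as [(1/2)^k = (2/3)^k (3/4)^k]. Beyond [K] the factor [(2/3)^k] is below
    [m], whatever [s] is; up to [K] the seminorm of order [K] bounds all the others and [q] has
    slope at most 1. In both cases the error is at most [2 m (3/4)^k], which is summable. *)
Lemma B_infty_open eps r : B_infty eps r ->
  exists K e, 0 < e /\ forall s, gs_mem s -> gs_norm K s < e ->
  B_infty eps (r + s : Cb).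
Proof.
move=> [rm dr]; pose m := (eps - d_infty 0 r) / 12.
have m0 : 0 < m by rewrite divr_gt0 // subr_gt0.
have [K Km] : exists K, (2 / 3 : R) ^+ K < m.
  have h : `|2 / 3 : R| < 1 by rewrite ger0_norm; lra.
  have := cvg_expr h; move/cvgrPdist_lt => /(_ m m0) [K _ /(_ K (leqnn _))] /=.
  by rewrite sub0r normrN ger0_norm ?exprn_ge0 //; exists K.
exists K, m; split; first exact: m0.
move=> s sm sK; have rsm := Cb_memD rm sm; split; first exact: rsm.
have geo : cvgn (series (geometric (m + m) (3 / 4 : R))).
  by apply: is_cvg_geometric_series; rewrite ger0_norm; lra.
have geoE : limn (series (geometric (m + m) (3 / 4 : R))) = (m + m) * (1 - 3 / 4)^-1.
  apply: cvg_lim; first exact: Rhausdorff.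
  by apply: cvg_geometric_series; rewrite ger0_norm; lra.
suff H : d_infty 0 (r + s : Cb) <= d_infty 0 r + limn (series (geometric (m + m) (3 / 4 : R))).
  rewrite geoE in H; apply: (le_lt_trans H).
  have -> : (m + m) * (1 - 3 / 4)^-1 = 8 * m by field.
  exact: margin_lt.
rewrite (d_inftyE rm) (d_inftyE rsm) -(lim_seriesD (term_cvg rm) geo).
apply: lim_series_le; first exact: term_cvg.
  by apply: is_cvg_seriesD => //; exact: term_cvg.
move=> k; rewrite -[(_ + _) k]/(term r k + (m + m) * (3 / 4) ^+ k).
have rk := Cb_norm_ge0 k rm; have sk := Cb_norm_ge0 k sm.
have t0 : (0 : R) <= 2^-1 ^+ k by rewrite exprn_ge0.
have h34 : (2^-1 : R) ^+ k <= (3 / 4) ^+ k by apply: lerXn2r; rewrite ?nnegrE; lra.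
have [kK|Kk] := leqP k K.
  apply: (@le_trans _ _ (2^-1 ^+ k * (q (gs_norm k r) + gs_norm k s))).
    rewrite ler_wpM2l //; apply: le_trans (q_sub rk sk).
    by rewrite q_mono ?Cb_norm_ge0 ?Cb_normD.
  rewrite mulrDr lerD2l mulrC ler_pM //.
  by rewrite (le_trans (Cb_norm_mono sm kK)) // (le_trans (ltW sK)) // lerDl ltW.
apply: (@le_trans _ _ (2^-1 ^+ k)).
  by rewrite ler_piMr //; have /andP[] := q_bd (Cb_norm_ge0 k rsm).
rewrite (@le_trans _ _ ((m + m) * (3 / 4) ^+ k)) //; last by rewrite lerDr term_ge0.
rewrite (_ : (2^-1 : R) = 2 / 3 * (3 / 4)); last by field.
rewrite exprMn; apply: ler_wpM2r; first by rewrite exprn_ge0 // divr_ge0.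
rewrite (@le_trans _ _ m) //; last by rewrite lerDl ltW.
apply: le_trans (ltW Km); apply: ler_wiXn2l; rewrite ?(ltnW Kk) //; lra.
Qed.

End Distance.

Lemma B_infty0 eps : 0 < eps -> B_infty eps (0 : Cb).
Proof.
move=> e0; split; first exact: Cb_mem0.
rewrite /d_infty (_ : series _ = cst 0) ?lim_cst //.
apply/funext => n; rewrite /series; apply: big1 => k _.
by rewrite subrr Cb_norm0 mul0r mulr0.
Qed.

(** When [P] and [Q] are orthogonal, this is [r] seen after the rigid motion that takes [y0] to
    [x0], with its values rotated and scaled by [a]. *)
Definition Cb_isometry (r : Cb) (P Q : 'M[R]_3) a (y0 x0 : E) : Cb :=
  fun y => a *: (P *m r (Q *m (y - y0) + x0)).

Lemma iterD_isometry r (P Q : 'M[R]_3) a (y0 x0 : E) vs x : gs_mem r ->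
  iterD vs (Cb_isometry r P Q a y0 x0 : E -> E) x =
    a *: (P *m iterD [seq Q *m v | v <- vs] (r : E -> E) (Q *m (x - y0) + x0)) /\
  differentiable (iterD vs (Cb_isometry r P Q a y0 x0 : E -> E)) x.
Proof.
move=> rm; have dQ z : differentiable (fun y : E => Q *m (y - y0) + x0) z /\
    forall v, 'D_v (fun y : E => Q *m (y - y0) + x0) z = Q *m v.
  have d1 : differentiable (fun y : E => y - y0) z.
    exact: (differentiableB (f := id) (g := cst y0)).
  have d2 := differentiable_comp d1 (differentiable_mulmx Q (z - y0)).
  split; first exact: (differentiableD (g := cst x0)).
  move=> v; rewrite (deriveD (f := mulmx Q \o (fun y => y - y0)) (g := cst x0)) //.
    rewrite derive_cst addr0 (derive_comp (f := fun y : E => y - y0)) //.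
      rewrite derive_mulmx (deriveB (f := id) (g := cst y0)) //.
      by rewrite derive_id derive_cst subr0.
    exact: differentiable_mulmx.
  exact: diff_derivable.
have dP (f : E -> E) (z v : E) : differentiable f z ->
    differentiable (fun y => a *: (P *m f y)) z /\
    'D_v (fun y => a *: (P *m f y)) z = a *: (P *m 'D_v f z).
  move=> df; have d1 := differentiable_comp df (differentiable_mulmx P (f z)).
  split; first exact: (differentiableZ (f := mulmx P \o f)).
  rewrite (deriveZ (f := mulmx P \o f)); last exact: diff_derivable.
  by rewrite (derive_comp (f := f)) ?derive_mulmx //; exact: differentiable_mulmx.
have D ws z : differentiable (fun y => iterD [seq Q *m v | v <- ws] (r : E -> E)
    (Q *m (y - y0) + x0)) z.
  by apply: (differentiable_comp (dQ z).1); exact: Cb_diff.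
have r'E ws : iterD ws (Cb_isometry r P Q a y0 x0 : E -> E) =
    fun z => a *: (P *m iterD [seq Q *m v | v <- ws] (r : E -> E) (Q *m (z - y0) + x0)).
  apply/funext; elim: ws => [|v ws IH] z //=.
  have -> := funext IH.
  rewrite (dP _ _ _ (D ws z)).2 derive_comp ?(dQ z).2 //; first by case: (dQ z).
  exact: Cb_diff.
by rewrite r'E; split=> //; exact: (dP _ _ 0 (D vs x)).1.
Qed.

(** The derivatives of the copy in directions [v] are those of [r] at another point in the
    directions [Q *m v], up to an isometry and the factor [a]. Hence no seminorm grows, and
    [d_infty] is monotone in the seminorms. *)
Lemma B_infty_isometry eps r (P Q : 'M[R]_3) a (y0 x0 : E) :
  (forall u : E, enorm (P *m u) = enorm u) ->
  (forall u : E, enorm (Q *m u) = enorm u) ->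
  `|a| <= 1 -> B_infty eps r -> B_infty eps (Cb_isometry r P Q a y0 x0).
Proof.
move=> Pe Qe a1 [rm dr]; set r' := Cb_isometry _ _ _ _ _ _.
have le k vs x : (size vs <= k)%N -> (forall v, v \in vs -> enorm v <= 1) ->
    enorm (iterD vs (r' : E -> E) x) <= gs_norm k r.
  move=> vk v1; rewrite (iterD_isometry _ _ _ _ _ _ _ rm).1.
  rewrite enormZ Pe (le_trans (ler_piMl _ a1)) ?enorm_ge0 //.
  apply: le_Cb_norm; rewrite ?size_map // => _ /mapP[v vvs ->].
  by rewrite Qe; exact: v1.
have r'm : gs_mem r'.
  split=> [vs x _|k]; first exact: (iterD_isometry _ _ _ _ _ _ _ rm).2.
  by exists (gs_norm k r) => _ [vs [x [vk v1 ->]]]; exact: le.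
split; first exact: r'm.
apply: le_lt_trans dr; apply: d_infty_le => // k.
by apply: Cb_norm_le => vs x vk v1; exact: le.
Qed.

End BoundedSmooth.

(** * The two sides of a closed surface *)

Section Connectedness.
Variable R : realType.
Local Notation E := 'cV[R]_3.

(** [C] meets [A] and the closure of [A] in the same set, which is therefore both open and closed in
    [C]. *)
Lemma connected_boundary (T : topologicalType) (A C : set T) :
  open A -> connected C -> C `&` (closure A `\` A) = set0 ->
  A `&` C !=set0 -> C `<=` A.
Proof.
move=> oA cC CA [x [Ax Cx]].
have -> : C = C `&` A.
  apply/esym/cC; [by exists x|by exists A|].
  exists (closure A); first exact: closed_closure.
  rewrite eqEsubset; split=> y [Cy Ay]; split=> //; first exact: subset_closure.
  by apply: contrapT => nAy; rewrite -[False]/(@set0 T y) -CA.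
exact: subIsetr.
Qed.

Lemma connected_of_paths (T : topologicalType) (A : set T) :
  (forall x y, A x -> A y -> exists g : R -> T,
     [/\ {within `[0, 1], continuous g}, forall t, t \in `[0, 1] -> A (g t),
         g 0 = x & g 1 = y]) -> connected A.
Proof.
move=> pA; have [->|/set0P[x Ax]] := eqVneq A set0; first exact: connected0.
have H y : exists g : R -> T, A y ->
    [/\ {within `[0, 1], continuous g}, forall t, t \in `[0, 1] -> A (g t),
         g 0 = x & g 1 = y].
  have [Ay|nAy] := pselect (A y); last by exists (fun=> x).
  by have [g Pg] := pA x y Ax Ay; exists g.
have [g Pg] := choice H.
have in0 : (0 : R) \in `[0, 1] by rewrite in_itv /= lexx ler01.
have in1 : (1 : R) \in `[0, 1] by rewrite in_itv /= lexx ler01.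
have -> : A = \bigcup_(y in A) (g y @` `[0, 1]).
  rewrite eqEsubset; split=> [y Ay|y [z Az [t t01 <-]]].
    by exists y => //; exists 1 => //; have [] := Pg y Ay.
  by have [_ + _ _] := Pg z Az; apply.
apply: bigcup_connected.
  by exists x => y Ay; exists 0 => //; have [] := Pg y Ay.
move=> y Ay; apply: connected_continuous_connected; first exact: segment_connected.
by have [] := Pg y Ay.
Qed.

Lemma segment_continuous (a b : E) : continuous (fun t : R => (1 - t) *: a + t *: b).
Proof.
move=> t; apply: cvgD; apply: cvgZr_tmp; last exact: cvg_id.
by apply: cvgB; [exact: cvg_cst|exact: cvg_id].
Qed.

Lemma convex_connected (A : set E) :
  (forall x y t, A x -> A y -> t \in `[0, 1] -> A ((1 - t) *: x + t *: y)) ->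
  connected A.
Proof.
move=> cA; apply: connected_of_paths => x y Ax Ay.
exists (fun t => (1 - t) *: x + t *: y); split.
- exact/continuous_subspaceT/segment_continuous.
- by move=> t t01; exact: cA.
- by rewrite subr0 scale1r scale0r addr0.
- by rewrite subrr scale1r scale0r add0r.
Qed.

(** R^3 is connected and unbounded. All arguments about the two sides of a surface end in a
    contradiction with this fact. *)
Lemma bounded_clopen (A : set E) : bounded_set A -> open A -> closed A -> A = set0.
Proof.
move=> bA oA cA; have [//|/set0P[x Ax]] := eqVneq A set0; exfalso.
have AT : A = setT.
  have cT : connected [set: E] by exact: convex_connected.
  by apply: cT; [exists x|exists A; rewrite ?setTI|exists A; rewrite ?setTI].
have [M [_ MA]] := bA; have N0 := normr_ge0 M; have MN := ler_norm M.
set N := `|M| in N0 MN; have /MA : M < N + 1 by lra.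
move=> /(_ ((N + 2) *: delta_mx 0 0)); rewrite AT => /(_ I).
apply/negP; rewrite -ltNge; have := coord_le_norm ((N + 2) *: delta_mx 0 0 : E) 0.
by apply: lt_le_trans; rewrite !mxE !eqxx mulr1 ger0_norm; lra.
Qed.

Lemma bounded_closure (A : set E) : bounded_set A -> bounded_set (closure A).
Proof.
move=> [M [Mr MA]]; exists M; split => // N MN x clx.
suff : [set x : E | `|x| <= N] x by [].
have cB : closed [set x : E | `|x| <= N].
  exact: (closed_comp (fun x _ => @norm_continuous _ _ x) (@closed_le _ N)).
have AN : A `<=` [set x | `|x| <= N] by exact: MA.
by have := closure_subset AN clx; rewrite -((closure_id _).1 cB).
Qed.

End Connectedness.

(** * Local equations of an embedded surface *)

Section LocalEquation.
Variable R : realType.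
Local Notation E := 'cV[R]_3.

(** The last clause retains the curves provided by a flattening chart, so that vectors orthogonal to
    the gradient are velocities of curves in [S] without recourse to the implicit function
    theorem. *)
Definition local_equation (S U : set E) (phi : E -> R) :=
  [/\ open U, smooth_on U phi, forall x, U x -> (S x <-> phi x = 0),
      forall x, U x -> gradient phi x != 0
    & forall x v, U x -> S x -> dot (gradient phi x) v = 0 -> tangent_vector S x v].

(** A positive product means the same nonzero sign: each of the sides [phi > 0] and [phi < 0] of [U]
    is connected. The product form treats both sides at once. *)
Definition two_sided (U : set E) (phi : E -> R) := forall x1 x2,
  U x1 -> U x2 -> 0 < phi x1 * phi x2 -> exists C : set E,
    [/\ connected C, C x1, C x2 & forall x, C x -> U x /\ 0 < phi x1 * phi x].

Lemma is_derive_line (W : normedModType R) (f : E -> W) x v : differentiable f x ->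
  is_derive (0 : R) 1 (fun t : R => f (x + t *: v)) ('D_v f x).
Proof.
move=> df; rewrite (_ : (fun t => _) = fun t => f (t *: v + x)); last first.
  by apply/funext => t; rewrite addrC.
apply: DeriveDef; first by apply: (derivable1P f x v).1; exact: diff_derivable.
rewrite /derive; set g1 := (X in X @ _); set g2 := (X in _ = lim (X @ _)).
suff -> : g1 = g2 by [].
by apply/funext => h; rewrite /g1 /g2 /= addr0 scale0r add0r [_%:A]mulr1.
Qed.

Lemma near_line (V : set E) x w : open V -> V x ->
  \forall t \near (0 : R), V (x + t *: w).
Proof.
move=> oV Vx; have c : {for 0, continuous (fun t : R => x + t *: w)}.
  apply/differentiable_continuous/derivable1_diffP.
  by have [] := @is_derive_line _ id x w (@ex_diff _ _ _ _ _ _ _ (is_diff_id x)).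
by apply: c; rewrite scale0r addr0; apply: open_nbhs_nbhs.
Qed.

Lemma open_preimI (T U : topologicalType) (A : set T) (B : set U) (f : T -> U) :
  open A -> open B -> (forall x, A x -> {for x, continuous f}) ->
  open (A `&` f @^-1` B).
Proof.
move=> oA oB cf; rewrite openE => x [Ax Bx]; apply: filterI.
  exact: open_nbhs_nbhs.
by apply: cf => //; apply: open_nbhs_nbhs.
Qed.

(** [phi] is the last coordinate of a flattening chart. The domain is cut down to the preimage of a
    ball, because the two halves of a ball are convex and their images under the inverse chart are
    the connected sides. *)
Lemma surface_local_equation S y : smooth_surface S -> S y ->
  exists U phi, [/\ U y, local_equation S U phi & two_sided U phi].
Proof.
move=> sS Sy; have [U [V [Psi [Phi]]]] := sS y Sy.
move=> [[oU Uy] oV sPsi sPhi [PsiU PhiV SU]].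
have [d /= d0 dV] := (nbhs_ballP _ _).1 (open_nbhs_nbhs (conj oV (PsiU y Uy).1)).
pose B := ball (Psi y) d; pose U' := U `&` Psi @^-1` B.
have oB : open B by exact: ball_open.
have dPsi x : U x -> differentiable Psi x by exact: smooth_on_diff.
have dPhi z : V z -> differentiable Phi z by exact: smooth_on_diff.
have oU' : open U'.
  by apply: open_preimI => // x Ux; exact/differentiable_continuous/dPsi.
have DPhiPsi x v : U x -> 'D_('D_v Psi x) Phi (Psi x) = v.
  move=> Ux; rewrite -[RHS](derive_id x v) -(derive_comp (f := Psi)); last 2 first.
  - exact: dPsi.
  - exact/dPhi/(PsiU x Ux).1.
  by apply: near_eq_derive; apply: (open_near oU Ux) => z /PsiU[].
have DPsiPhi x w : U x -> 'D_('D_w Phi (Psi x)) Psi x = w.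
  move=> Ux; have [Vx PhiPsi] := PsiU x Ux.
  rewrite -{1}PhiPsi -[RHS](derive_id (Psi x) w) -(derive_comp (f := Phi)); last 2 first.
  - exact: dPhi.
  - by rewrite PhiPsi; exact: dPsi.
  by apply: near_eq_derive; apply: (open_near oV Vx) => z /PhiV[].
pose phi x := Psi x ord_max 0.
have Dphi x v : U x -> dot (gradient phi x) v = 'D_v Psi x ord_max 0.
  move=> Ux; rewrite -derive_gradient; last exact/differentiable_entry/dPsi.
  by rewrite derive_entry //; exact/diff_derivable/dPsi.
exists U', phi; split.
- by split => //; exact: ballxx.
- split=> //.
  + apply: (@smooth_on_sub _ _ U) => [|]; first exact: subIsetl.
    exact: smooth_on_entry.
  + by move=> x [Ux _]; exact: SU.
  + move=> x [Ux _]; apply/eqP => g0.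
    (* The derivative of the chart sends this vector to the last basis vector, whose last coordinate
       is 1. *)
    have := Dphi x ('D_(delta_mx ord_max 0) Phi (Psi x)) Ux.
    by rewrite g0 dot0l DPsiPhi // mxE !eqxx => /esym/eqP; rewrite oner_eq0.
  + move=> x v [Ux _] Sx; rewrite Dphi //; set w := 'D_v Psi x => w0.
    (* Since [w] has last coordinate 0, the line stays in the plane that the inverse chart maps into
       [S]. *)
    exists (fun t => Phi (Psi x + t *: w)); split.
    * by rewrite scale0r addr0 (PsiU x Ux).2.
    * apply: filterS (near_line w oV (PsiU x Ux).1) => t Vt.
      have [Ut PsiPhi] := PhiV _ Vt.
      apply/SU => //; rewrite PsiPhi mxE [(t *: w) _ _]mxE w0 mulr0 addr0.
      by apply/SU.
    * rewrite -[X in is_derive _ _ _ X](DPhiPsi x v Ux).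
      by apply: is_derive_line; apply: dPhi; exact: (PsiU x Ux).1.
- move=> x1 x2 [U1 B1] [U2 B2] p12.
  pose D := [set z | B z /\ 0 < phi x1 * z ord_max 0].
  have p11 : 0 < phi x1 * phi x1.
    rewrite -expr2 lt_def sqr_ge0 andbT sqrf_eq0.
    by apply/eqP => p1; rewrite p1 mul0r ltxx in p12.
  exists (Phi @` D); split.
  + apply: connected_continuous_connected.
      apply: convex_connected => a b t [Ba pa] [Bb pb]; rewrite in_itv /= => /andP[t0 t1].
      split.
        move: Ba Bb; rewrite /B -ball_normE /= => Ba Bb.
        have -> : Psi y - ((1 - t) *: a + t *: b) =
            (1 - t) *: (Psi y - a) + t *: (Psi y - b).
          rewrite !scalerBr addrACA -scalerDl subrK scale1r opprD //.
        rewrite (le_lt_trans (ler_normD _ _)) // !normrZ !ger0_norm ?subr_ge0 //.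
        have [->|t1'] := eqVneq t 1; first by rewrite subrr mul0r add0r mul1r.
        have : 0 < 1 - t by rewrite subr_gt0 lt_neqAle t1' t1.
        nra.
      rewrite mxE [((1 - t) *: a) _ _]mxE [(t *: b) _ _]mxE mulrDr !(mulrCA (phi x1)).
      have [->|t1'] := eqVneq t 1; first by rewrite subrr mul0r add0r mul1r.
      have : 0 < 1 - t by rewrite subr_gt0 lt_neqAle t1' t1.
      nra.
    apply: continuous_in_subspaceT => z; rewrite inE => -[Bz _].
    by apply/differentiable_continuous/dPhi/dV.
  + by exists (Psi x1); [split|rewrite (PsiU x1 U1).2].
  + by exists (Psi x2); [split|rewrite (PsiU x2 U2).2].
  + move=> _ [z [Bz pz] <-]; have [Uz PsiPhi] := PhiV z (dV z Bz).
    by rewrite /phi /U' /= PsiPhi.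
Qed.

Lemma slope_sign (f : R -> R) d : is_derive (0 : R) 1 f d -> f 0 = 0 -> 0 < d ->
  \forall t \near (0 : R)^', 0 < t^-1 * f t.
Proof.
move=> [df fE] f0 d0.
have : (fun h => h^-1 *: (f (h *: 1 + 0) - f 0)) @ (0 : R)^' --> d.
  by rewrite -fE; exact: df.
move=> /cvgr_gt /(_ 0 d0); apply: filterS => t.
by rewrite f0 subr0 addr0 [t *: 1]mulr1.
Qed.

End LocalEquation.

(** * A bounded domain lies on one side of its boundary *)

Section Sides.
Variable R : realType.
Local Notation E := 'cV[R]_3.
Implicit Types (S U Om : set E) (phi : E -> R).

Lemma boundary_open Om : open Om -> boundary Om = closure Om `\` Om.
Proof. by move=> oOm; rewrite /boundary ((interior_id Om).1 oOm). Qed.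

Lemma closure_boundary Om : open Om -> closure Om = Om `|` boundary Om.
Proof.
move=> oOm; rewrite boundary_open // eqEsubset; split=> x.
  by move=> cx; have [|] := pselect (Om x); [left|right].
by case=> [/subset_closure|[]].
Qed.

Lemma gradientN phi x : differentiable phi x ->
  gradient (fun z => - phi z) x = - gradient phi x.
Proof.
move=> dp; apply/matrixP => i j; rewrite !mxE.
by rewrite (deriveN (f := phi)) //; exact: diff_derivable.
Qed.

Lemma local_equationN S U phi :
  local_equation S U phi -> local_equation S U (fun x => - phi x).
Proof.
move=> [oU sp SU g0 tv]; have dp x : U x -> differentiable phi x.
  exact: smooth_on_diff.
split=> //.
- apply: (smooth_on_eq oU (f := fun x => -1 * phi x)).
    by move=> x _; rewrite mulN1r.
  apply: smooth_closure_on => //; apply: SmoothMul; last exact: SmoothBase.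
  exact/SmoothBase/smooth_on_cst.
- move=> x Ux; rewrite SU //; split=> [->|/eqP]; first by rewrite oppr0.
  by rewrite oppr_eq0 => /eqP.
- by move=> x Ux; rewrite gradientN ?oppr_eq0; auto.
- move=> x v Ux Sx; rewrite gradientN; auto.
  by rewrite dotNl => /eqP; rewrite oppr_eq0 => /eqP; exact: tv.
Qed.

Lemma two_sidedN U phi : two_sided U phi -> two_sided U (fun x => - phi x).
Proof.
move=> ts x1 x2 U1 U2; rewrite mulrNN => p12.
have [C [cC C1 C2 HC]] := ts x1 x2 U1 U2 p12.
by exists C; split => // x Cx; rewrite mulrNN; exact: HC.
Qed.

Lemma near_punctured (P : R -> Prop) : (\forall t \near (0 : R)^', P t) ->
  exists2 e, 0 < e & P e /\ P (- e).
Proof.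
move=> [e /= e0 He]; have e2 : 0 < e / 2 by rewrite divr_gt0.
exists (e / 2) => //; split; apply: He; rewrite /= ?oppr_eq0 ?gt_eqF // sub0r.
  by rewrite normrN gtr0_norm //; lra.
by rewrite opprK gtr0_norm //; lra.
Qed.

(** Along the gradient at [x], [phi] has positive slope, so small steps forwards and backwards end
    on opposite sides. *)
Lemma both_signs S U phi W x : local_equation S U phi -> U x -> S x ->
  open W -> W x ->
  (exists z, [/\ W z, U z & 0 < phi z]) /\ (exists z, [/\ W z, U z & phi z < 0]).
Proof.
move=> [oU sp SU g0 _] Ux Sx oW Wx; set g := gradient phi x.
have dp : differentiable phi x by exact: smooth_on_diff sp Ux.
have := is_derive_line g dp; rewrite derive_gradient // -/g => D.
have gg : 0 < dot g g by rewrite lt_def dot_ge0 andbT dot_eq0 g0.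
have f0 : phi (x + 0 *: g) = 0 by rewrite scale0r addr0; apply/SU.
have N1 := slope_sign D f0 gg.
have N2 : \forall t \near (0 : R)^', U (x + t *: g).
  by apply: cvg_within; apply: near_line.
have N3 : \forall t \near (0 : R)^', W (x + t *: g).
  by apply: cvg_within; apply: near_line.
have [e e0 [[P1 [P2 P3]] [Q1 [Q2 Q3]]]] :=
  near_punctured (filterI N1 (filterI N2 N3)).
split.
  by exists (x + e *: g); split=> //; rewrite pmulr_rgt0 ?invr_gt0 in P1.
exists (x + - e *: g); split=> //.
by move: Q1; rewrite invrN mulNr -mulrN pmulr_rgt0 ?invr_gt0 // oppr_gt0.
Qed.

(** A side of [U] does not meet the boundary of [Om]; as it is connected, [Om] contains all of it as
    soon as it contains one of its points. *)
Lemma side_subset S U phi Om x1 : open Om -> boundary Om = S ->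
  local_equation S U phi -> two_sided U phi -> U x1 -> Om x1 ->
  forall x, U x -> 0 < phi x1 * phi x -> Om x.
Proof.
move=> oOm bS [oU _ SU _ _] ts U1 Om1 x Ux p1x.
have [C [cC C1 Cx HC]] := ts x1 x U1 Ux p1x.
apply: (connected_boundary oOm cC) Cx; last by exists x1.
rewrite -boundary_open // bS -subset0 => z [Cz Sz].
have [Uz] := HC z Cz; have /SU -> // := Sz.
by rewrite mulr0 ltxx.
Qed.

(** Near a boundary point [Om] contains at least one side, so the question is whether it can contain
    both. The set [B] collects the boundary points where it does, and [nB] shows that there are
    none. The sign of [phi] is then adjusted so that [Om] is the negative side. *)
Lemma domain_side Om y : bounded_domain Om -> smooth_surface (boundary Om) ->
  connected (boundary Om) -> boundary Om y ->
  exists U phi, [/\ U y, local_equation (boundary Om) U phi, two_sided U phi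
    & forall x, U x -> (Om x <-> phi x < 0)].
Proof.
move=> [oOm _ Om0 bOm] sS; set S := boundary Om in sS * => cS Sy.
have SOm x : S x -> ~ Om x by rewrite /S boundary_open // => -[].
pose A := Om `|` S; pose B := S `&` A°.
have clA : closed A by rewrite /A /S -closure_boundary //; exact: closed_closure.
(* If one point of the boundary had the domain on both sides, then, the    *)
(* boundary being connected, the bounded set A would be open and closed.   *)
have nB : ~ exists z, B z.
  move=> Bne; suff SA : S `<=` A°.
    have oA : open A.
      rewrite openE => z [Omz|/SA //].
      by apply: filterS (open_nbhs_nbhs (conj oOm Omz)) => w; left.
    have bA : bounded_set A.
      by rewrite /A /S -closure_boundary //; exact: bounded_closure.
    have [z Omz] := Om0; have : A z by left.
    by rewrite (bounded_clopen bA oA clA).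
  suff <- : B = S by exact: subIsetr.
  apply: cS => //; first by exists A° => //; exact: open_interior.
  (* [B] is closed in [S]: near a limit point [z] there is a point [w] of [B], around which both
     signs of [phi] occur in [Om], so that [Om] contains both sides near [z]. *)
  exists (closure B); first exact: closed_closure.
  rewrite eqEsubset; split=> [z Bz|z [Sz clz]].
    by split; [case: Bz|exact: subset_closure].
  split=> //; have [U [phi [Uz le ts]]] := surface_local_equation sS Sz.
  have [oU _ SU _ _] := le.
  have [w [[Sw Aw] Uw]] := clz U (open_nbhs_nbhs (conj oU Uz)).
  have [[p [Ap Up pp]] [q [Aq Uq pq]]] := both_signs le Uw Sw (@open_interior _ A) Aw.
  have Om1 v : A° v -> U v -> phi v != 0 -> Om v.
    move=> /interior_subset[//|Sv] Uv; have /SU -> // := Sv.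
    by rewrite eqxx.
  have Omp := Om1 p Ap Up (lt0r_neq0 pp).
  have Omq := Om1 q Aq Uq (ltr0_neq0 pq).
  apply: filterS (open_nbhs_nbhs (conj oU Uz)) => v Uv.
  have [pv|pv|pv] := ltgtP (phi v) 0.
  - by left; apply: (side_subset oOm erefl le ts Uq Omq Uv); rewrite nmulr_rgt0.
  - by left; apply: (side_subset oOm erefl le ts Up Omp Uv); rewrite pmulr_rgt0.
  - by right; apply/SU.
have [U [phi [Uy le ts]]] := surface_local_equation sS Sy.
have [oU _ SU _ _] := le.
have [p [Omp Up]] : exists p, Om p /\ U p.
  have [cy _] : (closure Om `\` Om) y by rewrite -boundary_open.
  by have [p [? ?]] := cy U (open_nbhs_nbhs (conj oU Uy)); exists p.
have key psi : local_equation S U psi -> two_sided U psi -> psi p < 0 ->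
    forall x, U x -> (Om x <-> psi x < 0).
  move=> le' ts' p0 x Ux; split=> [Omx|x0]; last first.
    by apply: (side_subset oOm erefl le' ts' Up Omp Ux); rewrite nmulr_rgt0.
  have [//|px|px] := ltgtP (psi x) 0; exfalso; last first.
    by case: le' => _ _ SU' _ _; apply: (SOm x) => //; apply/SU'.
  apply: nB; exists y; split=> //.
  apply: filterS (open_nbhs_nbhs (conj oU Uy)) => v Uv.
  have [pv|pv|pv] := ltgtP (psi v) 0.
  - by left; apply: (side_subset oOm erefl le' ts' Up Omp Uv); rewrite nmulr_rgt0.
  - by left; apply: (side_subset oOm erefl le' ts' Ux Omx Uv); rewrite pmulr_rgt0.
  - by right; case: le' => _ _ SU' _ _; apply/SU'.
have [p0|p0|p0] := ltgtP (phi p) 0.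
- by exists U, phi; split=> //; exact: key.
- exists U, (fun x => - phi x); split=> //.
  + exact: local_equationN.
  + exact: two_sidedN.
  + apply: key; [exact: local_equationN|exact: two_sidedN|by rewrite oppr_lt0].
- by exfalso; apply: (SOm p) => //; apply/SU.
Qed.

Lemma bounded_domain_unique Om Om' : bounded_domain Om -> bounded_domain Om' ->
  smooth_surface (boundary Om) -> connected (boundary Om) ->
  boundary Om' = boundary Om -> Om' = Om.
Proof.
move=> dOm dOm' sS cS bb; have [oOm cOm Om0 bOm] := dOm.
have [oOm' cOm' Om0' bOm'] := dOm'.
have disj (A A' : set E) : open A -> open A' -> connected A' -> boundary A' = boundary A ->
    A `&` A' !=set0 -> A' `<=` A.
  move=> oA oA' cA' AA' AIA'; apply: (connected_boundary oA cA') => //.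
  by rewrite -boundary_open // -AA' boundary_open // -subset0 => z [? []].
have [[z [Oz O'z]]|dj] := pselect (Om `&` Om' !=set0).
  rewrite eqEsubset; split; apply: disj => //; first by exists z.
  by exists z.
exfalso; pose A := Om `|` Om' `|` boundary Om.
have clA : A = closure Om `|` closure Om'.
  by rewrite !closure_boundary // bb /A setUACA setUid.
have cA : closed A by rewrite clA; apply: closedU; exact: closed_closure.
have bA : bounded_set A.
  rewrite clA; have [M [Mr MA]] := bounded_closure bOm.
  have [M' [Mr' MA']] := bounded_closure bOm'.
  exists (Num.max M M'); split; first by rewrite max_real.
  by move=> N; rewrite gt_max => /andP[MN MN'] x [/MA|/MA']; apply.
have oA : open A.
  rewrite openE => y [[Oy|Oy]|Sy].
  - by apply: filterS (open_nbhs_nbhs (conj oOm Oy)) => w; left; left.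
  - by apply: filterS (open_nbhs_nbhs (conj oOm' Oy)) => w; left; right.
  (* Near [y] the set [Om] is the negative side. As [Om'] is disjoint from it but has [y] on its
     boundary, it contains a point of the positive side and hence the whole of it. *)
  have [U [phi [Uy le ts OmU]]] := domain_side dOm sS cS Sy.
  have [oU _ SU _ _] := le.
  have [p [Omp Up]] : exists p, Om' p /\ U p.
    have [cy _] : (closure Om' `\` Om') y by rewrite -boundary_open // bb.
    by have [p [? ?]] := cy U (open_nbhs_nbhs (conj oU Uy)); exists p.
  have pp : 0 < phi p.
    have [pp|//|pp] := ltgtP (phi p) 0; exfalso.
      by apply: dj; exists p; split=> //; apply/OmU.
    have : boundary Om p by apply/SU.
    by rewrite -bb boundary_open // => -[].
  apply: filterS (open_nbhs_nbhs (conj oU Uy)) => v Uv.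
  have [pv|pv|pv] := ltgtP (phi v) 0.
  - by left; left; apply/OmU.
  - by left; right; apply: (side_subset oOm' bb le ts Up Omp Uv); rewrite pmulr_rgt0.
  - by right; apply/SU.
have [z Oz] := Om0; have : A z by left; left.
by rewrite (bounded_clopen bA oA cA).
Qed.

End Sides.

(** The library norm is the sup norm, for which [T] need not be a contraction; the iterate [T^m] is
    one as soon as [q^m] compensates for the factor 3 between the two norms. If [T^m] fixes [p] it
    also fixes [T p], and these coincide because [q^m < 1]. *)
Lemma contraction_fixed (R : realType) (T : 'cV[R]_3 -> 'cV[R]_3) (q : R) :
  0 <= q -> q < 1 -> (forall x y, enorm (T x - T y) <= q * enorm (x - y)) ->
  exists p, T p = p.
Proof.
move=> q0 q1 Tq; pose X : completeNormedModType R := HB.pack 'cV[R]_3.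
have Tm m x y : enorm (iter m T x - iter m T y) <= q ^+ m * enorm (x - y).
  elim: m => [|m IH] /=; first by rewrite expr0 mul1r.
  by rewrite (le_trans (Tq _ _)) // exprS -mulrA ler_wpM2l.
have [m qm] : exists m, q ^+ m * 3 < 2^-1.
  have h : `|q| < 1 by rewrite ger0_norm.
  have := cvg_expr h; move/cvgrPdist_lt => /(_ (1 / 6) _)[|K _ /(_ K (leqnn _))] /=.
    by rewrite divr_gt0.
  by rewrite sub0r normrN ger0_norm ?exprn_ge0 // => ?; exists K; lra.
have fS : set_fun [set: X] [set: X] (iter m T) by [].
have ctr : is_contraction (mkfun fS : {fun [set: X] >-> [set: X]}).
  have h0 : (0 : R) <= 2^-1 by rewrite invr_ge0.
  exists (NngNum h0); split=> /=; first by rewrite invf_lt1 // ltr1n.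
  move=> [x y] _ /=; rewrite (le_trans (norm_le_enorm _)) // (le_trans (Tm _ _ _)) //.
  rewrite (@le_trans _ _ (q ^+ m * (3 * `|x - y|))) //.
    by rewrite ler_wpM2l ?exprn_ge0 // enorm_le_norm.
  by rewrite mulrA ler_wpM2r // ltW.
have [|p _ pE] := banach_fixed_point ctr closedT; first by exists (0 : 'cV[R]_3).
exists p; apply/eqP; rewrite -subr_eq0 -enorm_eq0.
have := Tm m (T p) p; rewrite -iterSr iterS -[iter m T p]/(mkfun fS p) -pE => H.
have q3 : q ^+ m < 1.
  by rewrite (@le_lt_trans _ _ (q ^+ m * 3)) //; [have := exprn_ge0 m q0|]; lra.
have := enorm_ge0 (T p - p); move: H q3; set a := enorm _; set b := q ^+ m.
rewrite eq_le => H b1 a0; rewrite a0 andbT; nra.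
Qed.

(** * Derivatives along curves *)

Section Curves.
Variable R : realType.
Local Notation E := 'cV[R]_3.

Lemma is_derive0P (W : normedModType R) (f : R -> W) (l : W) :
  is_derive (0 : R) 1 f l <-> h^-1 *: (f h - f 0) @[h --> (0 : R)^'] --> l.
Proof.
have -> : (fun h => h^-1 *: (f h - f 0)) =
    (fun h => h^-1 *: ((f \o shift (0 : R)) (h *: 1) - f 0)).
  by apply/funext => h /=; rewrite addr0 [h *: 1]mulr1.
split=> [[df <-] //|fl]; apply: DeriveDef; first exact: cvgP fl.
exact: cvg_lim fl.
Qed.

Lemma is_derive_affine (y v : E) (t : R) :
  is_derive t 1 (fun t : R => y + t *: v) v.
Proof.
have d : is_diff t (cst y + ( *:%R ^~ v) : R -> E) (0 + ( *:%R ^~ v)).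
  by apply: is_diffD.
apply: DeriveDef; first exact/derivable1_diffP.
by rewrite deriveE // diff_val /= add0r scale1r.
Qed.

Lemma near0_punctured (P : R -> Prop) :
  (\forall t \near (0 : R), P t) -> \forall t \near (0 : R)^', P t.
Proof. exact: cvg_within. Qed.

Lemma is_derive_unique (W : normedModType R) (f : R -> W) l l' :
  is_derive (0 : R) 1 f l -> is_derive (0 : R) 1 f l' -> l = l'.
Proof. by move=> [_ <-] [_ <-]. Qed.

Lemma exists_orthogonal_unit (g : E) : exists2 v, enorm v = 1 & dot g v = 0.
Proof.
pose e i : E := delta_mx i 0.
suff [u u0 gu] : exists2 u, u != 0 & dot g u = 0.
  exists ((enorm u)^-1 *: u); last by rewrite dotZr gu mulr0.
  by rewrite enormZ ger0_norm ?invr_ge0 ?enorm_ge0 // mulVf // enorm_eq0.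
have [g0|g0] := eqVneq (g 0 0) 0.
  exists (e 0); last by rewrite dot_delta.
  by rewrite -dot_eq0 dot_delta mxE !eqxx oner_eq0.
exists (g 0 0 *: e 1 - g 1 0 *: e 0); last first.
  by rewrite dotBr !dotZr !dot_delta mulrC subrr.
apply: contraNneq g0 => /(congr1 (fun u => dot u (e 1))).
rewrite dotBl !dotZl dot0l !dot_delta !mxE !eqxx mulr1 mulr0 subr0.
by move=> ->.
Qed.

Lemma differentiable_dot (w z : E) : differentiable (dot w) z.
Proof.
rewrite (_ : dot w = \sum_(i < 3) (w i 0 \*o (fun z : E => z i 0))).
  apply: differentiable_sum => i.
  by apply: (differentiableZ (f := fun z : E => z i 0)); exact: differentiable_coord.
by apply/funext => v; rewrite fct_sumE.
Qed.

Lemma derive_dot (w z v : E) : 'D_v (dot w) z = dot w v.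
Proof.
have dot_lin : linear (dot w) by move=> a u v'; rewrite dotDr dotZr.
pose dotL : {linear E -> R} := HB.pack (dot w) (GRing.isLinear.Build _ _ _ _ _ dot_lin).
rewrite deriveE; last exact: differentiable_dot.
rewrite (@diff_lin _ _ _ dotL) // => u.
exact/differentiable_continuous/differentiable_dot.
Qed.

Lemma is_derive_entry (c : R -> E) v i : is_derive (0 : R) 1 c v ->
  is_derive (0 : R) 1 (fun t => c t i 0) (v i 0).
Proof.
move=> [/derivable1_diffP dc <-]; apply: DeriveDef.
  exact/derivable1_diffP/differentiable_entry.
by rewrite derive_entry //; exact/derivable1_diffP.
Qed.

Lemma is_derive_dot (a b : R -> E) a' b' : is_derive (0 : R) 1 a a' ->
  is_derive (0 : R) 1 b b' ->
  is_derive (0 : R) 1 (fun t => dot (a t) (b t)) (dot a' (b 0) + dot (a 0) b').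
Proof.
move=> da db.
rewrite (_ : (fun t => _) = \sum_(i < 3) (fun t => a t i 0) * (fun t => b t i 0)); last first.
  by apply/funext => t; rewrite fct_sumE.
apply: is_derive_eq.
  by apply: is_derive_sum => i; apply: is_deriveM; exact: is_derive_entry.
rewrite /dot -big_split /=; apply: eq_bigr => i _.
by rewrite /GRing.scale /=; ring.
Qed.

Lemma lipschitz_continuous (G : E -> E) (L : R) : 0 < L ->
  (forall y y', enorm (G y - G y') <= L * enorm (y - y')) -> continuous G.
Proof.
move=> L0 GL y; apply/(@cvgrPdist_lt _ _ _ (nbhs y)) => e e0.
have d0 : 0 < e / (L * 3) by rewrite divr_gt0 ?mulr_gt0.
apply: filterS (nbhsx_ballx y _ d0) => y'; rewrite -ball_normE /= => Hy.
rewrite (le_lt_trans (norm_le_enorm _)) // (le_lt_trans (GL _ _)) //.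
rewrite (@le_lt_trans _ _ (L * (3 * `|y - y'|))) //.
  by rewrite ler_pM2l // enorm_le_norm.
by rewrite mulrA mulrC -ltr_pdivlMr ?mulr_gt0.
Qed.

Lemma closure_homeo (F G : E -> E) (A : set E) : continuous F -> continuous G ->
  cancel F G -> cancel G F -> closure (G @^-1` A) = G @^-1` closure A.
Proof.
move=> cF cG FK GK; rewrite eqEsubset; split.
  have -> : G @^-1` closure A = closure (G @^-1` closure A).
    apply: (closure_id _).1; apply: closed_comp; last exact: closed_closure.
    by move=> x _; exact: cG.
  by apply: closure_subset => x Ax; exact: (subset_closure (A := A) Ax).
move=> y cy W Wy; have FW : nbhs (G y) (F @^-1` W) by apply: cF; rewrite GK.
have [z [Az Wz]] := cy _ FW.
by exists (F z); rewrite /= FK.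
Qed.

Lemma trmx_invmx_mul_neq0 (M : 'M[R]_3) (g : E) : M \in unitmx -> g != 0 ->
  (invmx M)^T *m g != 0.
Proof.
move=> uM; apply: contra => /eqP Mg0; apply/eqP.
have : M^T *m ((invmx M)^T *m g) = g.
  by rewrite mulmxA -trmx_mul mulVmx // trmx1 mul1mx.
by rewrite Mg0 mulmx0 => <-.
Qed.

Lemma normalize_unit (u : E) : u != 0 -> enorm ((enorm u)^-1 *: u) = 1.
Proof.
move=> u0; rewrite enormZ ger0_norm ?invr_ge0 ?enorm_ge0 // mulVf //.
by rewrite enorm_eq0.
Qed.

Lemma jac0 (z : E) : jac (0 : E -> E) z = 0.
Proof.
apply/matrixP => i j; rewrite mxE [RHS]mxE.
have -> : (fun w : E => (0 : E -> E) w i 0) = cst 0 by apply/funext => w; rewrite mxE.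
exact: derive_cst.
Qed.

End Curves.

Lemma exists_scale_lt (R : realType) (e d : R) : 0 < e -> d < e ->
  exists2 c, 1 < c & c * d < e.
Proof.
move=> e0 de; have [d0|d0] := leP d 0; first by exists 2; [rewrite ltr1n|lra].
have e1 : 1 < e / d by rewrite ltr_pdivlMr ?mul1r.
exists ((e / d + 1) / 2); first lra.
by rewrite mulrAC mulrDl mul1r divfK ?gt_eqF //; lra.
Qed.

(** * Smooth functions on a surface and their Gateaux calculus *)

Section SmoothOnSurface.
Variables (R : realType) (S : set 'cV[R]_3).
Local Notation E := 'cV[R]_3.
Implicit Types (u : S -> R) (y : S).

Lemma smooth_fun_cst (a : R) : smooth_fun (fun _ : S => a).
Proof.
move=> y; exists (fun=> a), setT; split=> //; first exact: openT.
exact/smooth_on_cst/openT.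
Qed.

Lemma smooth_fun_restrict (w : E -> R) : smooth_on setT w ->
  smooth_fun (fun y : S => w (val y)).
Proof. by move=> sw y; exists w, setT; split=> //; exact: openT. Qed.

Lemma local_extensionD u1 u2 y v1 v2 : local_extension u1 y v1 ->
  local_extension u2 y v2 ->
  local_extension (fun z => u1 z + u2 z) y (fun x => v1 x + v2 x).
Proof.
move=> [U1 [oU1 Uy1 s1 e1]] [U2 [oU2 Uy2 s2 e2]]; exists (U1 `&` U2).
have oU := openI oU1 oU2; split=> // [|z [Z1 Z2]]; last by rewrite e1 // e2.
apply: smooth_closure_on => //; apply: SmoothAdd; apply: SmoothBase.
  exact: smooth_on_sub s1.
exact: smooth_on_sub s2.
Qed.

Lemma local_extensionM u1 u2 y v1 v2 : local_extension u1 y v1 ->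
  local_extension u2 y v2 ->
  local_extension (fun z => u1 z * u2 z) y (fun x => v1 x * v2 x).
Proof.
move=> [U1 [oU1 Uy1 s1 e1]] [U2 [oU2 Uy2 s2 e2]]; exists (U1 `&` U2).
have oU := openI oU1 oU2; split=> // [|z [Z1 Z2]]; last by rewrite e1 // e2.
apply: smooth_closure_on => //; apply: SmoothMul; apply: SmoothBase.
  exact: smooth_on_sub s1.
exact: smooth_on_sub s2.
Qed.

(** [v] is continuous and agrees with [u] at [y], so positivity at this single point persists on a
    smaller neighbourhood in R^3. *)
Lemma local_extension_pos u y v : 0 < u y -> local_extension u y v ->
  exists U : set E, [/\ open U, U (val y), smooth_on U v,
     forall x, U x -> 0 < v x & forall z : S, U (val z) -> v (val z) = u z].
Proof.
move=> u0 [U [oU Uy sv ve]]; exists (U `&` v @^-1` [set a : R | 0 < a]); split.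
- apply: open_preimI => //.
  by move=> x Ux; exact/differentiable_continuous/(smooth_on_diff sv).
- by split=> //=; rewrite ve.
- by apply: smooth_on_sub sv; exact: subIsetl.
- by move=> x [].
- by move=> z [Uz _]; exact: ve.
Qed.

Lemma local_extensionV u y v : 0 < u y -> local_extension u y v ->
  local_extension (fun z => (u z)^-1) y (fun x => (v x)^-1).
Proof.
move=> u0 /(local_extension_pos u0)[U [oU Uy sv v0 ve]]; exists U; split=> //.
  apply: smooth_closure_on => //; apply: SmoothInv; first exact: SmoothBase.
  by move=> x /v0; exact: lt0r_neq0.
by move=> z Uz; rewrite ve.
Qed.

Lemma local_extension_sqrt u y v : 0 < u y -> local_extension u y v ->
  local_extension (fun z => Num.sqrt (u z)) y (fun x => Num.sqrt (v x)).
Proof.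
move=> u0 /(local_extension_pos u0)[U [oU Uy sv v0 ve]]; exists U; split=> //.
  by apply: smooth_closure_on => //; apply: SmoothSqrt => //; exact: SmoothBase.
by move=> z Uz; rewrite ve.
Qed.

Lemma smooth_funD u1 u2 : smooth_fun u1 -> smooth_fun u2 ->
  smooth_fun (fun z => u1 z + u2 z).
Proof.
move=> s1 s2 y; have [[v1 e1] [v2 e2]] := (s1 y, s2 y).
by exists (fun x => v1 x + v2 x); exact: local_extensionD.
Qed.

Lemma smooth_funM u1 u2 : smooth_fun u1 -> smooth_fun u2 ->
  smooth_fun (fun z => u1 z * u2 z).
Proof.
move=> s1 s2 y; have [[v1 e1] [v2 e2]] := (s1 y, s2 y).
by exists (fun x => v1 x * v2 x); exact: local_extensionM.
Qed.

Lemma smooth_funV u : smooth_fun u -> (forall y, 0 < u y) ->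
  smooth_fun (fun z => (u z)^-1).
Proof.
move=> s u0 y; have [v e] := s y.
by exists (fun x => (v x)^-1); exact: local_extensionV.
Qed.

Lemma smooth_fun_sqrt u : smooth_fun u -> (forall y, 0 < u y) ->
  smooth_fun (fun z => Num.sqrt (u z)).
Proof.
move=> s u0 y; have [v e] := s y.
by exists (fun x => Num.sqrt (v x)); exact: local_extension_sqrt.
Qed.

Lemma smooth_fun_cV (u : S -> E) :
  smooth_fun u <-> forall i, smooth_fun (fun z => u z i 0).
Proof.
split=> [su i y|su y].
  have [v [U [oU Uy sv ve]]] := su y; exists (fun x => v x i 0), U; split=> //.
    exact: smooth_on_entry.
  by move=> z Uz; rewrite ve.
have [v ve] := choice (fun i => su i y).
have [U Ue] := choice ve.
exists (fun x => \col_i v i x), [set x | forall i, U i x].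
have oU : open [set x | forall i, U i x].
  rewrite openE => x Ux.
  have HU i : nbhs x (U i).
    by have [oUi _ _ _] := Ue i; exact: open_nbhs_nbhs.
  exact: (filter_forall _ HU).
split=> //.
- by move=> i; have [] := Ue i.
- apply: smooth_on_cV => // i; have [oUi _ svi _] := Ue i.
  apply: (@smooth_on_eq _ _ _ (v i)) => //.
    by move=> x _; rewrite mxE.
  by apply: smooth_on_sub svi => x; apply.
- move=> z Uz; apply/matrixP => i j; rewrite ord1 mxE.
  by have [_ _ _] := Ue i; apply.
Qed.

Lemma smooth_fun_bounded u : compact S -> smooth_fun u ->
  exists M, forall y, `|u y| <= M.
Proof.
move=> /compact_near_coveringP cS su.
pose P (M : R) (x : E) := forall y, val y = x -> `|u y| <= M.
have [|M [Mr MP]] := cS R (+oo%R) P _.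
  move=> x Sx; pose y : S := exist _ x (mem_set Sx).
  have [v [U [oU Uy sv ve]]] := su y.
  have cv : {for x, continuous v} by exact/differentiable_continuous/(smooth_on_diff sv).
  have c1 : \forall x' \near x, `|v x - v x'| < 1.
    by move/cvgrPdist_lt : cv => /(_ 1 ltr01).
  have c2 : \forall M \near +oo%R, `|v x| + 1 <= M.
    by exact: nbhs_pinfty_ge.
  exists ([set x' | U x' /\ `|v x - v x'| < 1], [set M | `|v x| + 1 <= M]).
    split=> //=; apply: filterI c1; exact: open_nbhs_nbhs.
  move=> [x' M] [/= [Ux' vx'] HM] z zx'; rewrite -ve zx' //.
  rewrite (le_trans _ HM) // -[v x'](subKr (v x)).
  by rewrite (le_trans (ler_normB _ _)) // lerD2l ltW.
exists (M + 1) => y; apply: (MP (M + 1) _ (val y)) => //; first by rewrite ltrDl.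
exact: set_valP.
Qed.

Lemma smooth_fun_lower u : compact S -> smooth_fun u -> (forall y, 0 < u y) ->
  exists2 d, 0 < d & forall y, d <= u y.
Proof.
move=> cS su u0; have [M uM] := smooth_fun_bounded cS (smooth_funV su u0).
have M1 : 0 < `|M| + 1 by rewrite ltr_wpDl.
exists (`|M| + 1)^-1 => [|y]; first by rewrite invr_gt0.
rewrite -[u y]invrK lef_pV2 ?posrE ?invr_gt0 //.
rewrite (le_trans (ler_norm _)) // (le_trans (uM y)) //.
by rewrite (le_trans (ler_norm _)) // lerDl.
Qed.

(** [outer_normal] is a choice and [tangent_vector] is defined through curves. This records that the
    chosen vector is a unit vector and that curves realize every direction orthogonal to it, which
    makes [tgrad] independent of the extension. *)
Definition regular_normal y := enorm (outer_normal y) = 1 /\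
  forall v, dot (outer_normal y) v = 0 -> tangent_vector S (val y) v.

(** The tangential part of the [i]-th basis vector. Differentiating an extension along it gives the
    [i]-th component of [tgrad], which turns the rules of calculus for [tgrad] into those for
    directional derivatives. *)
Definition tangent_dir y (i : 'I_3) : E :=
  delta_mx i 0 - outer_normal y i 0 *: outer_normal y.

Lemma local_extension_diff u y v : local_extension u y v ->
  differentiable v (val y).
Proof. by case=> U [oU Uy sv _]; exact: smooth_on_diff sv Uy. Qed.

(** Both extensions coincide with [u] along a curve of [S] with velocity [w]. *)
Lemma local_extension_tangent u y v v' w : local_extension u y v ->
  local_extension u y v' -> tangent_vector S (val y) w ->
  'D_w v (val y) = 'D_w v' (val y).
Proof.
move=> lv lv' [c [c0 cS cD]].
have dv : differentiable v (c 0) by rewrite c0; exact: local_extension_diff lv.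
have dv' : differentiable v' (c 0) by rewrite c0; exact: local_extension_diff lv'.
have D := is_derive_comp_curve cD dv; have D' := is_derive_comp_curve cD dv'.
rewrite c0 in D D'; apply: (is_derive_unique _ D').
apply: near_eq_is_derive D.
have [U [oU Uy _ ve]] := lv; have [U' [oU' Uy' _ ve']] := lv'.
have cc : {for 0, continuous c}.
  by apply/differentiable_continuous/derivable1_diffP; case: cD.
have NU : \forall t \near (0 : R), U (c t).
  by apply: cc; rewrite c0; exact: open_nbhs_nbhs.
have NU' : \forall t \near (0 : R), U' (c t).
  by apply: cc; rewrite c0; exact: open_nbhs_nbhs.
apply: filterS3 NU NU' cS => t Ut Ut' St.
have := ve (exist _ (c t) (mem_set St)) Ut.
by have := ve' (exist _ (c t) (mem_set St)) Ut' => /= -> ->.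
Qed.

(** The gradients of two extensions have the same products with tangent vectors, so they differ by a
    multiple of the normal, which the projection removes. *)
Lemma tgrad_extension u y v : regular_normal y -> local_extension u y v ->
  tgrad u y = gradient v (val y) -
    dot (gradient v (val y)) (outer_normal y) *: outer_normal y.
Proof.
move=> [n1 nT] lv; rewrite /tgrad; set v0 := xget _ _.
have lv0 : local_extension u y v0.
  by apply: (@xgetPex _ _ [set v | local_extension u y v]); exists v.
have dv := local_extension_diff lv; have dv0 := local_extension_diff lv0.
set n := outer_normal y in n1 nT *.
have dE : gradient v0 (val y) - gradient v (val y) =
    dot (gradient v0 (val y) - gradient v (val y)) n *: n.
  apply: orth_proj => // w nw; rewrite dotBl -!derive_gradient //.
  by rewrite (local_extension_tangent lv0 lv) ?subrr //; exact: nT.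
set g0 := gradient v0 _ in dE *; set g := gradient v _ in dE *.
have -> : g0 = g + dot (g0 - g) n *: n by rewrite -dE addrC subrK.
set a := dot (g0 - g) n.
by rewrite dotDl dotZl enorm1_dot // mulr1 scalerDl opprD addrACA subrr addr0.
Qed.

Lemma tgrad_dot u y v w : regular_normal y -> local_extension u y v ->
  dot (tgrad u y) w =
  'D_(w - dot (outer_normal y) w *: outer_normal y) v (val y).
Proof.
move=> ry lv; rewrite (tgrad_extension ry lv) derive_gradient; last first.
  exact: local_extension_diff lv.
by rewrite dotBl dotBr dotZl dotZr mulrC.
Qed.

Lemma tgradE u y v i : regular_normal y -> local_extension u y v ->
  tgrad u y i 0 = 'D_(tangent_dir y i) v (val y).
Proof. by move=> ry lv; rewrite -dot_delta (tgrad_dot _ ry lv) dot_delta. Qed.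

End SmoothOnSurface.

(** * Tangential derivatives of functions on a compact surface *)

Section TangentialCalculus.
Variables (R : realType) (S : set 'cV[R]_3).
Local Notation E := 'cV[R]_3.
Hypothesis S_compact : compact S.
Hypothesis S_regular : forall y : S, regular_normal y.
Hypothesis S_normal_smooth : forall i, smooth_fun (fun y : S => outer_normal y i 0).
Implicit Types (u : S -> R) (y : S).

Definition tD (i : 'I_3) u : S -> R := fun y => tgrad u y i 0.

Lemma tDE i u y v : local_extension u y v ->
  tD i u y = 'D_(tangent_dir y i) v (val y).
Proof. by move=> lv; exact: tgradE. Qed.

Lemma tD_cst i (a : R) : tD i (fun=> a) = fun=> 0.
Proof.
apply/funext => y; rewrite (@tDE _ _ _ (fun=> a)) ?derive_cst //.
exists setT; split=> //; first exact: openT.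
exact/smooth_on_cst/openT.
Qed.

Lemma tDD i u1 u2 : smooth_fun u1 -> smooth_fun u2 ->
  tD i (fun z => u1 z + u2 z) = fun y => tD i u1 y + tD i u2 y.
Proof.
move=> s1 s2; apply/funext => y; have [[v1 e1] [v2 e2]] := (s1 y, s2 y).
rewrite (tDE i (local_extensionD e1 e2)) (tDE i e1) (tDE i e2).
rewrite (deriveD (f := v1) (g := v2)) //; apply: diff_derivable.
  exact: local_extension_diff e1.
exact: local_extension_diff e2.
Qed.

Lemma tDM i u1 u2 : smooth_fun u1 -> smooth_fun u2 ->
  tD i (fun z => u1 z * u2 z) = fun y => u1 y * tD i u2 y + u2 y * tD i u1 y.
Proof.
move=> s1 s2; apply/funext => y; have [[v1 e1] [v2 e2]] := (s1 y, s2 y).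
rewrite (tDE i (local_extensionM e1 e2)) (tDE i e1) (tDE i e2).
rewrite (deriveM (f := v1) (g := v2)); last 2 first.
- exact/diff_derivable/(local_extension_diff e1).
- exact/diff_derivable/(local_extension_diff e2).
have [U [_ Uy _ ve1]] := e1; have [U' [_ Uy' _ ve2]] := e2.
by rewrite ve1 // ve2.
Qed.

Lemma tDV i u : smooth_fun u -> (forall y, 0 < u y) ->
  tD i (fun z => (u z)^-1) = fun y => -1 * ((u y)^-1 * (u y)^-1 * tD i u y).
Proof.
move=> s u0; apply/funext => y; have [v e] := s y.
rewrite (tDE i (local_extensionV (u0 y) e)) (tDE i e).
have [U [_ Uy _ ve]] := e; have vy := ve y Uy.
have v0 : v (val y) != 0 by rewrite vy lt0r_neq0.
rewrite (deriveV (f := v)) //; last exact/diff_derivable/(local_extension_diff e).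
by rewrite vy -[_ *: _]/(_ * _) -exprVn expr2; ring.
Qed.

(** The denominator is written as a sum so that the convergence of sums and inverses applies to it
    as it stands. *)
Lemma tD_sqrt i u : smooth_fun u -> (forall y, 0 < u y) ->
  tD i (fun z => Num.sqrt (u z)) =
  fun y => tD i u y * (Num.sqrt (u y) + Num.sqrt (u y))^-1.
Proof.
move=> s u0; apply/funext => y; have [v e] := s y.
rewrite (tDE i (local_extension_sqrt (u0 y) e)) (tDE i e).
have [U [_ Uy _ ve]] := e; have vy := ve y Uy.
have v0 : 0 < v (val y) by rewrite vy.
have [ds sE] := is_derive1_sqrt v0.
have ds' : differentiable Num.sqrt (v (val y)) by apply/derivable1_diffP.
rewrite (derive_comp (f := v)) //; last exact: local_extension_diff e.
rewrite -vy -mulr2n -mulr_natl -sE; set d := 'D__ v _.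
rewrite -[RHS]/(d *: 'D_1 Num.sqrt (v (val y))).
by rewrite !deriveE // -linearZ /= [_ *: 1]mulr1.
Qed.

Lemma smooth_tangent_dir i l : smooth_fun (fun y => tangent_dir y i l 0).
Proof.
rewrite (_ : (fun y => _) = fun y : S => (delta_mx i 0 : E) l 0 +
    -1 * (outer_normal y i 0 * outer_normal y l 0)); last first.
  by apply/funext => y; rewrite /tangent_dir -[LHS]dot_delta dotBl dotZl !dot_delta mulN1r.
apply: smooth_funD; first exact: smooth_fun_cst.
apply: smooth_funM; first exact: smooth_fun_cst.
exact: smooth_funM.
Qed.

Lemma tD_restrict i (w : E -> R) : smooth_on setT w ->
  tD i (fun y => w (val y)) =
  fun y => \sum_l tangent_dir y i l 0 * 'D_(delta_mx l 0) w (val y).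
Proof.
move=> sw; apply/funext => y; rewrite (@tDE _ _ _ w).
  by rewrite derive_sum_delta //; exact: smooth_on_diff sw _.
by exists setT; split=> //; exact: openT.
Qed.

Lemma local_extension_sum y (I : Type) (s : seq I) (u : I -> S -> R) v :
  (forall i, local_extension (u i) y (v i)) ->
  local_extension (fun z => \sum_(i <- s) u i z) y (fun x => \sum_(i <- s) v i x).
Proof.
move=> uv; rewrite (_ : (fun z => _) = \sum_(i <- s) u i); last first.
  by apply/funext => z; rewrite fct_sumE.
rewrite (_ : (fun x => _) = \sum_(i <- s) v i); last first.
  by apply/funext => z; rewrite fct_sumE.
elim/big_ind2 : _ => //; last first.
  by move=> f g f' g' ef ef'; exact: local_extensionD.
exists setT; split=> //; first exact: openT.
exact/smooth_on_cst/openT.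
Qed.

(** The tangential derivative is a sum of products of components of [tangent_dir] and ambient
    derivatives of an extension; extending the former off [S] as well yields a local extension of
    the sum. *)
Lemma smooth_tD i u : smooth_fun u -> smooth_fun (tD i u).
Proof.
move=> su y; have [v [U [oU Uy sv ve]]] := su y.
pose d l x := 'D_(delta_mx l 0) v x.
have ed l : local_extension (fun z : S => d l (val z)) y (d l).
  by exists U; split=> //; exact: smooth_on_derive.
have [t et] := choice (fun l => smooth_tangent_dir i l y).
have [W [oW Wy sW We]] := local_extension_sum (index_enum 'I_3)
  (fun l => local_extensionM (et l) (ed l)).
exists (fun x => \sum_l t l x * d l x), (W `&` U); split=> //.
- exact: openI.
- by apply: smooth_on_sub sW; exact: subIsetl.
- move=> z [Wz Uz]; rewrite We //= (@tDE _ _ _ v); last by exists U.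
  by rewrite derive_sum_delta //; exact: smooth_on_diff sv _.
Qed.

(** * Convergence together with tangential derivatives *)

Section Convergence.
Variables (T : Type) (F : set_system T).
Context {FF : Filter F}.

(** Convergence along [F] in C^k of the surface. The recursion lets the Leibniz and chain rules be
    used one derivative at a time, by induction on [k]. Smoothness of [f t] is included because
    these rules are available only for smooth functions. *)
Fixpoint sconv (k : nat) (f : T -> S -> R) (l : S -> R) : Prop :=
  [/\ smooth_fun l, \forall t \near F, smooth_fun (f t),
     forall e, 0 < e -> \forall t \near F, forall y, `|f t y - l y| < e
   & if k is k'.+1 then forall i, sconv k' (fun t => tD i (f t)) (tD i l) else True].

Lemma sconv_smooth k f l : sconv k f l -> smooth_fun l.
Proof. by case: k => [|k] []. Qed.

Lemma sconv_unif k f l e : sconv k f l -> 0 < e ->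
  \forall t \near F, forall y, `|f t y - l y| < e.
Proof. by case: k => [|k] [_ _ H _]; exact: H. Qed.

Lemma sconvW k f l : sconv k.+1 f l -> sconv k f l.
Proof.
elim: k f l => [|k IH] f l [sl sf fl Dfl]; split=> // i.
by apply: IH; exact: Dfl.
Qed.

Lemma sconv_near_eq k f g l : (\forall t \near F, f t = g t) ->
  sconv k f l -> sconv k g l.
Proof.
elim: k f g l => [|k IH] f g l fg [sl sf fl Dfl].
  split; [exact: sl| | |exact: I].
    by apply: filterS2 fg sf => t ->.
  by move=> e e0; apply: filterS2 fg (fl e e0) => t ->.
split; first exact: sl.
- by apply: filterS2 fg sf => t ->.
- by move=> e e0; apply: filterS2 fg (fl e e0) => t ->.
- by move=> i; apply: IH (Dfl i); apply: filterS fg => t ->.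
Qed.

Lemma sconv_cst k u : smooth_fun u -> sconv k (fun=> u) u.
Proof.
elim: k u => [|k IH] u su; split=> //; try exact: nearW.
- by move=> e e0; apply: nearW => t y; rewrite subrr normr0.
- by move=> e e0; apply: nearW => t y; rewrite subrr normr0.
- by move=> i; apply: IH; exact: smooth_tD.
Qed.

Lemma sconvD k f g l m : sconv k f l -> sconv k g m ->
  sconv k (fun t y => f t y + g t y) (fun y => l y + m y).
Proof.
have C0 j f1 g1 l1 m1 : sconv j f1 l1 -> sconv j g1 m1 ->
    forall e, 0 < e -> \forall t \near F,
    forall y, `|f1 t y + g1 t y - (l1 y + m1 y)| < e.
  move=> cf cg e e0; have e2 : 0 < e / 2 by rewrite divr_gt0.
  apply: filterS2 (sconv_unif cf e2) (sconv_unif cg e2) => t Hf Hg y.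
  rewrite opprD addrACA (le_lt_trans (ler_normD _ _)) // [e]splitr ltrD //.
elim: k f g l m => [|k IH] f g l m cf cg.
  have [sl sf _ _] := cf; have [sm sg _ _] := cg.
  split; [exact: smooth_funD| |exact: C0 cf cg|exact: I].
  by apply: filterS2 sf sg => t; exact: smooth_funD.
have [sl sf _ Df] := cf; have [sm sg _ Dg] := cg; split.
- exact: smooth_funD.
- by apply: filterS2 sf sg => t; exact: smooth_funD.
- exact: C0 cf cg.
- move=> i; rewrite tDD //; apply: sconv_near_eq (IH _ _ _ _ (Df i) (Dg i)).
  by apply: filterS2 sf sg => t sft sgt; rewrite tDD.
Qed.

Lemma sconvM k f g l m : sconv k f l -> sconv k g m ->
  sconv k (fun t y => f t y * g t y) (fun y => l y * m y).
Proof.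
have C0 j f1 g1 l1 m1 : sconv j f1 l1 -> sconv j g1 m1 ->
    forall e, 0 < e -> \forall t \near F,
    forall y, `|f1 t y * g1 t y - (l1 y * m1 y)| < e.
  move=> cf cg e e0.
  have [A lA] := smooth_fun_bounded S_compact (sconv_smooth cf).
  have [B mB] := smooth_fun_bounded S_compact (sconv_smooth cg).
  (* In [f g - l m = (f - l) (g - m) + l (g - m) + m (f - l)], both errors are below [d <= 1], so
     the total is below [d (|A| + |B| + 2)]. *)
  pose d := Num.min 1 (e / (`|A| + `|B| + 2)).
  have AB : 0 < `|A| + `|B| + 2 by rewrite ltr_wpDl // addr_ge0.
  have d0 : 0 < d by rewrite lt_min ltr01 divr_gt0.
  apply: filterS2 (sconv_unif cf d0) (sconv_unif cg d0) => t Hf Hg y.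
  have -> : f1 t y * g1 t y - l1 y * m1 y = (f1 t y - l1 y) * (g1 t y - m1 y) +
     (l1 y * (g1 t y - m1 y) + m1 y * (f1 t y - l1 y)) by ring.
  have a1 := Hf y; have b1 := Hg y; have lAy := le_trans (lA y) (ler_norm A).
  have mBy := le_trans (mB y) (ler_norm B).
  rewrite (le_lt_trans (ler_normD _ _)) // normrM.
  rewrite (le_lt_trans (lerD (lexx _) (ler_normD _ _))) // !normrM.
  have dd : d <= 1 by rewrite ge_min lexx.
  have de : d * (`|A| + `|B| + 2) <= e.
    by rewrite -ler_pdivlMr // ge_min lexx orbT.
  move: a1 b1 lAy mBy de; set a := `|f1 t y - l1 y|; set b := `|g1 t y - m1 y|.
  set A' := `|A|; set B' := `|B| => a1 b1 lAy mBy de.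
  have a0 : 0 <= a by exact: normr_ge0.
  have b0 : 0 <= b by exact: normr_ge0.
  apply: lt_le_trans de.
  rewrite (_ : d * (A' + B' + 2) = 2 * d + (A' * d + B' * d)); last by ring.
  rewrite ltr_leD //.
    rewrite (@le_lt_trans _ _ (1 * d)) //; last by rewrite ltr_pM2r // ltr1n.
    by rewrite ler_pM // ?(ltW b1) // (le_trans (ltW a1)).
  by rewrite lerD // ler_pM // ltW.
elim: k f g l m => [|k IH] f g l m cf cg.
  have [sl sf _ _] := cf; have [sm sg _ _] := cg.
  split; [exact: smooth_funM| |exact: C0 cf cg|exact: I].
  by apply: filterS2 sf sg => t; exact: smooth_funM.
have [sl sf _ Df] := cf; have [sm sg _ Dg] := cg; split.
- exact: smooth_funM.
- by apply: filterS2 sf sg => t; exact: smooth_funM.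
- exact: C0 cf cg.
- move=> i; rewrite tDM //; apply: sconv_near_eq
    (sconvD (IH _ _ _ _ (sconvW cf) (Dg i)) (IH _ _ _ _ (sconvW cg) (Df i))).
  by apply: filterS2 sf sg => t sft sgt; rewrite tDM.
Qed.

Lemma sconvZ k a f l : sconv k f l -> sconv k (fun t y => a * f t y) (fun y => a * l y).
Proof. exact/sconvM/sconv_cst/smooth_fun_cst. Qed.

Lemma sconv_sum k (I : Type) (s : seq I) (f : I -> T -> S -> R) l :
  (forall i, sconv k (f i) (l i)) ->
  sconv k (fun t y => \sum_(i <- s) f i t y) (fun y => \sum_(i <- s) l i y).
Proof.
move=> fl; elim: s => [|i s IH].
  rewrite (_ : (fun y => _) = fun=> 0); last by apply/funext => y; rewrite big_nil.
  rewrite (_ : (fun t y => _) = fun=> fun=> 0); first exact/sconv_cst/smooth_fun_cst.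
  by apply/funext => t; apply/funext => y; rewrite big_nil.
rewrite (_ : (fun y => _) = fun y => l i y + \sum_(j <- s) l j y); last first.
  by apply/funext => y; rewrite big_cons.
rewrite (_ : (fun t y => _) = fun t y => f i t y + \sum_(j <- s) f j t y).
  exact: sconvD.
by apply/funext => t; apply/funext => y; rewrite big_cons.
Qed.

(** Inverses and roots require a bound away from 0 that is uniform in [t]: half of the positive
    lower bound that compactness gives for [l]. *)
Lemma sconv_lower k f l : sconv k f l -> (forall y, 0 < l y) ->
  exists2 d, 0 < d & (forall y, d <= l y) /\
    \forall t \near F, forall y, d <= f t y.
Proof.
move=> cf l0; have [d d0 dl] := smooth_fun_lower S_compact (sconv_smooth cf) l0.
have d2 : 0 < d / 2 by rewrite divr_gt0.
exists (d / 2) => //; split=> [y|]; first by rewrite (le_trans _ (dl y)) //; lra.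
apply: filterS (sconv_unif cf d2) => t H y.
by have := H y; rewrite ltr_norml => /andP[]; have := dl y; lra.
Qed.

Lemma sconv_near_pos k f l : sconv k f l -> (forall y, 0 < l y) ->
  \forall t \near F, forall y, 0 < f t y.
Proof.
move=> cf l0; have [d d0 [_ dl]] := sconv_lower cf l0.
by apply: filterS dl => t H y; exact: lt_le_trans (H y).
Qed.

Lemma sconvV k f l : sconv k f l -> (forall y, 0 < l y) ->
  sconv k (fun t y => (f t y)^-1) (fun y => (l y)^-1).
Proof.
move=> + l0; have C0 j f1 : sconv j f1 l -> forall e, 0 < e ->
    \forall t \near F, forall y, `|(f1 t y)^-1 - (l y)^-1| < e.
  move=> cf e e0; have [d d0 [dl df]] := sconv_lower cf l0.
  have ed : 0 < e * (d * d) by rewrite !mulr_gt0.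
  apply: filterS2 (sconv_unif cf ed) df => t H fd y.
  have ly := l0 y; have fy := lt_le_trans d0 (fd y).
  have -> : (f1 t y)^-1 - (l y)^-1 = (l y - f1 t y) / (f1 t y * l y).
    by field; rewrite !lt0r_neq0.
  rewrite normrM normfV distrC [`|f1 t y * l y|]gtr0_norm ?mulr_gt0 //.
  rewrite ltr_pdivrMr ?mulr_gt0 // (lt_le_trans (H y)) // ler_pM2l //.
  by rewrite ler_pM // ltW.
elim: k f => [|k IH] f cf; have P := sconv_near_pos cf l0.
  have [sl sf _ _] := cf; split; [exact: smooth_funV| |exact: C0 cf|exact: I].
  by apply: filterS2 sf P => t; exact: smooth_funV.
have [sl sf _ Df] := cf; split.
- exact: smooth_funV.
- by apply: filterS2 sf P => t; exact: smooth_funV.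
- exact: C0 cf.
- move=> i; rewrite tDV //; have cV := IH _ (sconvW cf).
  apply: sconv_near_eq (sconvZ (-1) (sconvM (sconvM cV cV) (Df i))).
  by apply: filterS2 sf P => t sft pft; rewrite tDV.
Qed.

Lemma sconv_sqrt k f l : sconv k f l -> (forall y, 0 < l y) ->
  sconv k (fun t y => Num.sqrt (f t y)) (fun y => Num.sqrt (l y)).
Proof.
move=> + l0; have C0 j f1 : sconv j f1 l -> forall e, 0 < e ->
    \forall t \near F, forall y, `|Num.sqrt (f1 t y) - Num.sqrt (l y)| < e.
  move=> cf e e0; have [d d0 [dl df]] := sconv_lower cf l0.
  have ed : 0 < e * Num.sqrt d by rewrite mulr_gt0 ?sqrtr_gt0.
  apply: filterS2 (sconv_unif cf ed) df => t H fd y.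
  have ly := l0 y; have fy := lt_le_trans d0 (fd y).
  have sl0 : 0 < Num.sqrt (l y) by rewrite sqrtr_gt0.
  have sf0 : 0 < Num.sqrt (f1 t y) by rewrite sqrtr_gt0.
  have sq : (Num.sqrt (f1 t y) - Num.sqrt (l y)) * (Num.sqrt (f1 t y) + Num.sqrt (l y)) =
      f1 t y - l y by rewrite -subr_sqr !sqr_sqrtr ?ltW.
  have := addr_gt0 sf0 sl0 => sfl; rewrite -(ltr_pM2r sfl).
  have -> : `|Num.sqrt (f1 t y) - Num.sqrt (l y)| * (Num.sqrt (f1 t y) + Num.sqrt (l y)) =
      `|f1 t y - l y| by rewrite -sq normrM (gtr0_norm sfl).
  rewrite (lt_le_trans (H y)) // ler_pM2l // ler_wpDl ?sqrtr_ge0 //.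
  by rewrite ler_wsqrtr.
have s0 y : 0 < Num.sqrt (l y) + Num.sqrt (l y) by rewrite addr_gt0 ?sqrtr_gt0.
elim: k f => [|k IH] f cf; have P := sconv_near_pos cf l0.
  have [sl sf _ _] := cf; split; [exact: smooth_fun_sqrt| |exact: C0 cf|exact: I].
  by apply: filterS2 sf P => t; exact: smooth_fun_sqrt.
have [sl sf _ Df] := cf; split.
- exact: smooth_fun_sqrt.
- by apply: filterS2 sf P => t; exact: smooth_fun_sqrt.
- exact: C0 cf.
- move=> i; rewrite tD_sqrt //; have cs := IH _ (sconvW cf).
  apply: sconv_near_eq (sconvM (Df i) (sconvV (sconvD cs cs) s0)).
  by apply: filterS2 sf P => t sft pft; rewrite tD_sqrt.
Qed.

(** A tangential derivative of a restriction is a combination of restricted coordinate derivatives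
    whose coefficients depend on the surface alone, so [k] derivatives on the surface cost [k]
    derivatives in space. *)
Lemma sconv_restrict k (w : T -> E -> R) (w0 : E -> R) :
  smooth_on setT w0 -> (\forall t \near F, smooth_on setT (w t)) ->
  (forall s : seq 'I_3, (size s <= k)%N -> forall e, 0 < e ->
    \forall t \near F, forall x,
    `|iterD [seq delta_mx i 0 | i <- s] (w t) x -
      iterD [seq delta_mx i 0 | i <- s] w0 x| < e) ->
  sconv k (fun t y => w t (val y)) (fun y => w0 (val y)).
Proof.
elim: k w w0 => [|k IH] w w0 sw0 sw ww0.
  split=> //; first exact: smooth_fun_restrict.
    by apply: filterS sw => t; exact: smooth_fun_restrict.
  by move=> e e0; apply: filterS (ww0 [::] isT e e0) => t + y; apply.
split=> //; first exact: smooth_fun_restrict.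
- by apply: filterS sw => t; exact: smooth_fun_restrict.
- by move=> e e0; apply: filterS (ww0 [::] isT e e0) => t + y; apply.
move=> i; rewrite tD_restrict //.
apply: (sconv_near_eq (f := fun t y => \sum_l tangent_dir y i l 0 *
    'D_(delta_mx l 0) (w t) (val y))).
  by apply: filterS sw => t swt; rewrite tD_restrict.
apply: sconv_sum => l; apply: sconvM; first exact/sconv_cst/smooth_tangent_dir.
apply: (IH (fun t x => 'D_(delta_mx l 0) (w t) x)
  (fun x => 'D_(delta_mx l 0) w0 x)).
- exact: smooth_on_derive.
- by apply: filterS sw => t; exact: smooth_on_derive.
move=> s sk e e0; have := ww0 (rcons s l); rewrite size_rcons => /(_ sk e e0).
by apply: filterS => t + x => /(_ x); rewrite map_rcons -cats1 !iterD_catl.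
Qed.

End Convergence.

(** * Gateaux calculus of the algebra of maps of [r] *)

Section GateauxCalculus.
Variable U : set (Cb R).
Local Notation Cb := (Cb R).
Hypothesis U_mem : forall r, U r -> gs_mem r.
Hypothesis U_open : forall r, U r -> exists K e, 0 < e /\
  forall s, gs_mem s -> gs_norm K s < e -> U (r + s).
Implicit Types (r xi eta : Cb).

Lemma foldr_tderiv (u : S -> E) s y i :
  foldr (@tderiv R S) u s y i 0 = foldr tD (fun z => u z i 0) s y.
Proof.
elim: s y => [|j s IH] y //=.
rewrite /tderiv [LHS]mxE [LHS]mxE [LHS]mxE /tD; congr (tgrad _ y j 0).
by apply/funext => z; rewrite IH.
Qed.

Section Words.
Variables (T : Type) (F : set_system T).
Context {FF : Filter F}.

(** One estimate for all words at once. [sconv] peels off the derivative that is applied first,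
    which is the last letter of the word; hence the case analysis from the right. *)
Lemma sconv_words k (f : T -> S -> R) l e : sconv F k f l -> 0 < e ->
  \forall t \near F, forall s, (size s <= k)%N -> forall y,
    `|foldr tD (f t) s y - foldr tD l s y| < e.
Proof.
elim: k f l => [|k IH] f l cf e0.
  by apply: filterS (sconv_unif cf e0) => t H [].
have := sconv_unif cf e0; case: cf => _ _ _ Df.
have H i : F [set t | forall s, (size s <= k)%N -> forall y,
   `|foldr tD (tD i (f t)) s y - foldr tD (tD i l) s y| < e].
  exact: IH (Df i) e0.
apply: filterS2 (filter_forall _ H) => t Ht H0.
by case/lastP=> [//|s i]; rewrite size_rcons -cats1 !foldr_cat => /Ht; apply.
Qed.

Lemma sconv_Csurf k (f : T -> Csurf S) (l : Csurf S) e :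
  (forall i, sconv F k (fun t y => f t y i 0) (fun y => l y i 0)) -> 0 < e ->
  \forall t \near F, 0 <= gs_norm k (f t - l) < e.
Proof.
(* The bound [e / 6] on coordinates becomes [3 * (e / 6) = e / 2] for the Euclidean norm, which
   leaves room for a strict inequality after taking the supremum. *)
move=> fl e0; have e6 : 0 < e / 6 by rewrite divr_gt0.
have H i : F [set t | forall s, (size s <= k)%N -> forall y,
   `|foldr tD (fun z => f t z i 0 - l z i 0) s y| < e / 6].
  have cl : sconv F k (fun t z => f t z i 0 + -1 * l z i 0)
      (fun z => l z i 0 + -1 * l z i 0).
    apply: sconvD (fl i) _; apply: sconvZ; apply: sconv_cst; exact: sconv_smooth (fl i).
  apply: filterS (sconv_words cl e6) => t Ht s sk y; have := Ht s sk y.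
  rewrite (_ : (fun z => l z i 0 + _) = fun=> 0); last first.
    by apply/funext => z; rewrite mulN1r subrr.
  have -> : foldr tD (fun=> 0) s y = 0.
    by elim: s y {sk} => [|j s IH] y //=; rewrite (funext IH) tD_cst.
  rewrite subr0 (_ : (fun z => _ + _) = fun z => f t z i 0 - l z i 0) //.
  by apply/funext => z; rewrite mulN1r.
apply: filterS (filter_forall _ H) => t Ht.
have bd a : csurf_values k (f t - l : S -> E) a -> 0 <= a <= e / 2.
  move=> [s [y [sk ->]]]; rewrite enorm_ge0 /=.
  rewrite (_ : e / 2 = 3 * (e / 6)); last by field.
  apply: enorm_le_coord => i; rewrite foldr_tderiv ltW //.
  rewrite (_ : (fun z => _) = fun z => f t z i 0 - l z i 0); first exact: Ht.
  by apply/funext => z; rewrite -[(f t - l) z]/(f t z - l z) !mxE.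
have e2 : e / 2 < e by lra.
rewrite -[gs_norm k _]/(sup (csurf_values k (f t - l : S -> E))).
(* If the surface is empty, there are no values, and [sup] is 0 by convention. *)
have [->|/set0P[a Va]] := eqVneq (csurf_values k (f t - l : S -> E)) set0.
  by rewrite sup0 lexx.
have /andP[a0 _] := bd a Va.
have ub : has_ubound (csurf_values k (f t - l : S -> E)).
  by exists (e / 2) => b /bd /andP[].
rewrite (le_trans a0 (ub_le_sup ub Va)) /= (le_lt_trans _ e2) //.
by apply: ge_sup; [exists a|move=> b /bd /andP[]].
Qed.

End Words.

(** [sup] is meaningful only for bounded sets of values; at order 0 the bound comes from
    compactness. *)
Lemma Csurf_norm_ge (u : Csurf S) y : smooth_fun (u : S -> E) ->
  enorm (u y) <= gs_norm 0 u.
Proof.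
move=> /smooth_fun_cV su; apply: ub_le_sup; last by exists [::], y.
have M i : {M | forall y, `|u y i 0| <= M}.
  exact/cid/(smooth_fun_bounded S_compact (su i)).
exists (3 * (\sum_i `|sval (M i)|)) => _ [s [z [s0 ->]]].
case: s s0 => // _ /=; apply: enorm_le_coord => i.
rewrite (le_trans (svalP (M i) z)) // (le_trans (ler_norm _)) //.
by rewrite (bigD1 i) //= lerDl sumr_ge0.
Qed.

Section CbConvergence.
Variables (T : Type) (F : set_system T).
Context {FF : Filter F}.

Definition Cb_cvg (rho : T -> Cb) r := (\forall t \near F, gs_mem (rho t)) /\
  forall k e, 0 < e -> \forall t \near F, gs_norm k (rho t - r) < e.

(** The entries of [jac] are first derivatives, so order [k] on the surface is controlled by the
    seminorm of order [k + 1]. *)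
Lemma sconv_jac k rho r i j : gs_mem r -> Cb_cvg rho r ->
  sconv F k (fun t y => jac (rho t) (val y) i j) (fun y => jac r (val y) i j).
Proof.
move=> rm [rhom rhor].
have je (s : Cb) x : jac s x i j = 'D_(delta_mx j 0) (fun z => s z i 0) x by rewrite mxE.
rewrite (_ : (fun y => _) =
  fun y : S => 'D_(delta_mx j 0) (fun z => r z i 0) (val y)); last first.
  by apply/funext => y; rewrite je.
rewrite (_ : (fun t y => _) = fun t (y : S) =>
  'D_(delta_mx j 0) (fun z => rho t z i 0) (val y)); last first.
  by apply/funext => t; apply/funext => y; rewrite je.
have sm (s : Cb) : gs_mem s -> smooth_on setT (fun x => 'D_(delta_mx j 0) (fun z => s z i 0) x).
  move=> ms; apply: smooth_on_derive; apply: smooth_on_entry; first exact: openT.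
  exact: Cb_smooth.
apply: (sconv_restrict (w := fun t x => 'D_(delta_mx j 0) (fun z => rho t z i 0) x)
  (w0 := fun x => 'D_(delta_mx j 0) (fun z => r z i 0) x)).
- exact: sm.
- by apply: filterS rhom => t; exact: sm.
move=> s sk e e0; apply: filterS2 rhom (rhor k.+1 e e0) => t mt ht x.
set ws := [seq delta_mx _ 0 | _ <- s].
have ie (q : Cb) : gs_mem q -> iterD ws (fun x => 'D_(delta_mx j 0) (fun z => q z i 0) x) x =
    iterD (rcons ws (delta_mx j 0)) (q : E -> E) x i 0.
  move=> mq; rewrite -cats1 (@iterD_entry _ setT) //; last 2 first.
  - exact: openT.
  - exact: Cb_smooth.
  by rewrite iterD_catl.
rewrite !ie // (le_lt_trans _ ht) //.
have -> (a b : E) : a i 0 - b i 0 = (-1 *: b + a) i 0.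
  by rewrite scaleN1r addrC mxE [(- b) _ _]mxE.
rewrite (le_trans (coord_le_enorm _ _)) //.
rewrite -iterD_linear; [|exact: Cb_smooth|exact: Cb_smooth].
rewrite (_ : (fun x => _) = (rho t - r : Cb) :> (E -> E)); last first.
  by apply/funext => z; rewrite scaleN1r addrC.
apply: le_Cb_norm; first exact: Cb_memB.
  by rewrite size_rcons size_map.
move=> v; rewrite mem_rcons inE => /predU1P[->|/mapP[l _ ->]].
  by rewrite dot_enorm1 // dot_delta mxE !eqxx.
by rewrite dot_enorm1 // dot_delta mxE !eqxx.
Qed.

End CbConvergence.

Lemma Cb_cvg_line r xi : U r -> gs_mem xi ->
  Cb_cvg (0 : R)^' (fun h => r + h *: xi : Cb) r /\
  \forall h \near (0 : R)^', U (r + h *: xi : Cb).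
Proof.
move=> Ur mx.
have N k e : 0 < e -> \forall h \near (0 : R)^', gs_norm k (h *: xi : Cb) < e.
  move=> e0; have n0 := Cb_norm_ge0 k mx.
  have d0 : 0 < e / (gs_norm k xi + 1) by rewrite divr_gt0 // ltr_wpDl.
  have : \forall h \near (0 : R)^', `|h| < e / (gs_norm k xi + 1).
    by exact: dnbhs0_lt.
  apply: filterS => h hd; rewrite (le_lt_trans (Cb_normZ _ _ mx)) //.
  rewrite (@le_lt_trans _ _ (`|h| * (gs_norm k xi + 1))) //.
    by rewrite ler_wpM2l // lerDl.
  by rewrite -ltr_pdivlMr // ltr_wpDl.
split; last first.
  have [K [e [e0 He]]] := U_open Ur.
  by apply: filterS (N K e e0) => h hn; apply: He => //; exact: Cb_memZ.
split; first by apply: nearW => h; apply: Cb_memD; [exact: U_mem|exact: Cb_memZ].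
by move=> k e e0; apply: filterS (N k e e0) => h; rewrite addrAC subrr add0r.
Qed.

(** The positivity conditions are restricted to [U], because the quantities to be inverted may
    vanish for other deformations. *)
Inductive jet_algebra : (Cb -> S -> R) -> Prop :=
| JetCst u of smooth_fun u : jet_algebra (fun _ => u)
| JetJac i j : jet_algebra (fun r y => jac r (val y) i j)
| JetAdd f g of jet_algebra f & jet_algebra g :
    jet_algebra (fun r y => f r y + g r y)
| JetMul f g of jet_algebra f & jet_algebra g :
    jet_algebra (fun r y => f r y * g r y)
| JetInv f of jet_algebra f & (forall r y, U r -> 0 < f r y) :
    jet_algebra (fun r y => (f r y)^-1)
| JetSqrt f of jet_algebra f & (forall r y, U r -> 0 < f r y) :
    jet_algebra (fun r y => Num.sqrt (f r y)).

Lemma jet_continuous T (F : set_system T) {FF : Filter F} f rho r : jet_algebra f ->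
  U r -> (\forall t \near F, U (rho t)) -> Cb_cvg F rho r ->
  forall k, sconv F k (fun t => f (rho t)) (f r).
Proof.
move=> jf Ur Urho cr k; elim: jf => {f}.
- by move=> u su; exact: sconv_cst.
- by move=> i j; apply: sconv_jac => //; exact: U_mem.
- by move=> f g _ cf _ cg; exact: sconvD.
- by move=> f g _ cf _ cg; exact: sconvM.
- by move=> f _ cf f0; apply: sconvV => // y; exact: f0.
- by move=> f _ cf f0; apply: sconv_sqrt => // y; exact: f0.
Qed.

Lemma jet_smooth f r : jet_algebra f -> U r -> smooth_fun (f r).
Proof.
move=> jf Ur; suff c : sconv (nbhs (0 : R)) 0 (fun=> f r) (f r) by exact: sconv_smooth c.
apply: (jet_continuous (rho := fun=> r) jf) => //; first exact: nearW.
split; first by apply: nearW => _; exact: U_mem.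
by move=> k e e0; apply: nearW => _; rewrite subrr Cb_norm0.
Qed.

(** The direction comes first, so that [df xi] is a map of [r] that can be differentiated again. The
    last clause is joint continuity in the direction and the base point; it is stated along
    arbitrary filters so that the calculus of [sconv] applies to it. *)
Definition jet_derivative f (df : Cb -> Cb -> S -> R) :=
  [/\ forall xi, gs_mem xi -> jet_algebra (df xi),
      forall a xi eta r y, gs_mem xi -> gs_mem eta -> U r ->
        df (a *: xi + eta) r y = a * df xi r y + df eta r y,
      forall r xi k, U r -> gs_mem xi ->
        sconv (0 : R)^' k (fun h y => h^-1 * (f (r + h *: xi : Cb) y - f r y)) (df xi r)
    & forall T (F : set_system T) (FF : Filter F) rho zeta r xi,
        U r -> (\forall t \near F, U (rho t)) -> Cb_cvg F rho r ->
        gs_mem xi -> Cb_cvg F zeta xi ->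
        forall k, sconv F k (fun t => df (zeta t) (rho t)) (df xi r)].

(** The difference quotient of a product, inverse or square root is an exact algebraic expression in
    the quotients and values of its arguments: for the inverse it is minus the quotient of [f]
    divided by [f(r + h xi) f(r)], for the root the quotient of [f] divided by the sum of the two
    roots. The limits then follow from [sconvM], [sconvV] and [jet_continuous]. *)
Lemma jet_differentiable f : jet_algebra f -> exists df, jet_derivative f df.
Proof.
have nz : \forall h \near (0 : R)^', h != 0 by exact: nbhs_dnbhs_neq.
elim=> {f}.
- move=> u su; exists (fun _ _ _ => 0); split.
  + by move=> xi _; apply: JetCst; exact: smooth_fun_cst.
  + by move=> *; rewrite mulr0 addr0.
  + move=> r xi k Ur mx; apply: sconv_near_eq (sconv_cst k (smooth_fun_cst 0)).
    by apply: nearW => h; apply/funext => y; rewrite subrr mulr0.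
  + by move=> *; apply: sconv_cst; exact: smooth_fun_cst.
(* [jac] is linear in [r]: its difference quotient does not depend on [h], and its derivative does
   not depend on [r]. *)
- move=> i j; exists (fun xi _ y => jac xi (val y) i j).
  have sj (s : Cb) : gs_mem s -> smooth_fun (fun y : S => jac s (val y) i j).
    move=> ms; suff : sconv (nbhs (0 : R)) 0 (fun _ (y : S) => jac s (val y) i j)
        (fun y => jac s (val y) i j) by exact: sconv_smooth.
    suff c : Cb_cvg (nbhs (0 : R)) (fun=> s) s by exact: sconv_jac ms c.
    split; first exact: nearW.
    by move=> k e e0; apply: nearW => _; rewrite subrr Cb_norm0.
  have jlin a (s t : Cb) x : gs_mem s -> gs_mem t ->
      jac (a *: s + t : Cb) x i j = a * jac s x i j + jac t x i j.
    move=> ms mt; rewrite !mxE.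
    have ds := differentiable_entry i 0 (Cb_diff [::] x ms).
    have dt := differentiable_entry i 0 (Cb_diff [::] x mt).
    have dds := diff_derivable (v := delta_mx j 0) ds.
    have ddt := diff_derivable (v := delta_mx j 0) dt.
    rewrite (_ : (fun z => _) = a \*: (fun z : E => s z i 0) + (fun z => t z i 0)); last first.
      by apply/funext => z; rewrite -[(a *: s + t : Cb) z]/(a *: s z + t z) !mxE.
    by rewrite (deriveD (derivableZ dds) ddt) (deriveZ _ dds).
  split.
  + by move=> xi mx; apply: JetCst; exact: sj.
  + by move=> a xi eta r y mx me Ur; rewrite jlin.
  + move=> r xi k Ur mx; apply: sconv_near_eq (sconv_cst k (sj xi mx)).
    apply: filterS nz => h h0; apply/funext => y.
    have -> : (r + h *: xi : Cb) = h *: xi + r by exact: addrC.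
    have E1 := jlin h xi r (val y) mx (U_mem Ur).
    by rewrite E1 addrK (mulKf h0).
  + by move=> *; exact: sconv_jac.
- move=> f g jf [df [Df1 Df2 Df3 Df4]] jg [dg [Dg1 Dg2 Dg3 Dg4]].
  exists (fun xi r y => df xi r y + dg xi r y); split.
  + by move=> xi mx; apply: JetAdd; auto.
  + by move=> *; rewrite Df2 // Dg2 //; ring.
  + move=> r xi k Ur mx; apply: sconv_near_eq (sconvD (Df3 r xi k Ur mx) (Dg3 r xi k Ur mx)).
    by apply: nearW => h; apply/funext => y; ring.
  + by move=> T F FF rho zeta r xi *; apply: sconvD; [exact: Df4|exact: Dg4].
- move=> f g jf [df [Df1 Df2 Df3 Df4]] jg [dg [Dg1 Dg2 Dg3 Dg4]].
  exists (fun xi r y => df xi r y * g r y + f r y * dg xi r y); split.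
  + move=> xi mx; apply: JetAdd; apply: JetMul => //; auto.
  + by move=> *; rewrite Df2 // Dg2 //; ring.
  + move=> r xi k Ur mx; have [cl Ul] := Cb_cvg_line Ur mx.
    have cg : sconv (0 : R)^' k (fun h => g (r + h *: xi)) (g r).
      exact: jet_continuous jg Ur Ul cl k.
    have cf : sconv (0 : R)^' k (fun=> f r) (f r) by exact/sconv_cst/jet_smooth.
    apply: sconv_near_eq (sconvD (sconvM (Df3 r xi k Ur mx) cg)
      (sconvM cf (Dg3 r xi k Ur mx))).
    by apply: nearW => h; apply/funext => y; ring.
  + move=> T F FF rho zeta r xi Ur Urho cr mx cz k.
    have cg : sconv F k (fun t => g (rho t)) (g r) by exact: jet_continuous jg Ur Urho cr k.
    have cf : sconv F k (fun t => f (rho t)) (f r) by exact: jet_continuous jf Ur Urho cr k.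
    apply: sconvD; first exact: sconvM (Df4 T F FF rho zeta r xi Ur Urho cr mx cz k) cg.
    exact: sconvM cf (Dg4 T F FF rho zeta r xi Ur Urho cr mx cz k).
- move=> f jf [df [Df1 Df2 Df3 Df4]] f0.
  exists (fun xi r y => -1 * (df xi r y * ((f r y)^-1 * (f r y)^-1))); split.
  + move=> xi mx; apply: JetMul; first by apply: JetCst; exact: smooth_fun_cst.
    by apply: JetMul; [exact: Df1|apply: JetMul; exact: JetInv].
  + by move=> *; rewrite Df2 //; ring.
  + move=> r xi k Ur mx; have [cl Ul] := Cb_cvg_line Ur mx.
    have cf : sconv (0 : R)^' k (fun h y => (f (r + h *: xi : Cb) y)^-1) (fun y => (f r y)^-1).
      exact: jet_continuous (JetInv jf f0) Ur Ul cl k.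
    have cf' : sconv (0 : R)^' k (fun=> fun y => (f r y)^-1) (fun y => (f r y)^-1).
      by apply: sconv_cst; exact: jet_smooth (JetInv jf f0) Ur.
    apply: sconv_near_eq (sconvZ (-1) (sconvM (Df3 r xi k Ur mx) (sconvM cf cf'))).
    apply: filterS2 nz Ul => h h0 Uh; apply/funext => y; field.
    by rewrite h0 !lt0r_neq0 //; apply: f0.
  + move=> T F FF rho zeta r xi Ur Urho cr mx cz k.
    have cf : sconv F k (fun t y => (f (rho t) y)^-1) (fun y => (f r y)^-1).
      exact: jet_continuous (JetInv jf f0) Ur Urho cr k.
    by apply: sconvZ; apply: sconvM (sconvM cf cf); exact: Df4.
- move=> f jf [df [Df1 Df2 Df3 Df4]] f0.
  have js := JetSqrt jf f0.
  have s0 r y : U r -> 0 < Num.sqrt (f r y) + Num.sqrt (f r y).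
    by move=> Ur; rewrite addr_gt0 // sqrtr_gt0 f0.
  exists (fun xi r y => df xi r y * (Num.sqrt (f r y) + Num.sqrt (f r y))^-1); split.
  + move=> xi mx; apply: JetMul; first exact: Df1.
    by apply: (JetInv (JetAdd js js)).
  + by move=> *; rewrite Df2 //; ring.
  + move=> r xi k Ur mx; have [cl Ul] := Cb_cvg_line Ur mx.
    have cf : sconv (0 : R)^' k (fun h y => Num.sqrt (f (r + h *: xi : Cb) y))
        (fun y => Num.sqrt (f r y)) by exact: jet_continuous js Ur Ul cl k.
    have cf' : sconv (0 : R)^' k (fun=> fun y => Num.sqrt (f r y)) (fun y => Num.sqrt (f r y)).
      by apply: sconv_cst; exact: jet_smooth js Ur.
    apply: sconv_near_eq (sconvM (Df3 r xi k Ur mx) (sconvV (sconvD cf cf') (s0 r ^~ Ur))).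
    apply: filterS Ul => h Uh; apply/funext => y.
    have a0 : 0 < f r y by exact: f0.
    have b0 : 0 < f (r + h *: xi : Cb) y by exact: f0.
    have p0 : 0 < Num.sqrt (f (r + h *: xi : Cb) y) + Num.sqrt (f r y).
      by rewrite addr_gt0 // sqrtr_gt0.
    rewrite -mulrA; congr (_ * _); apply: (mulIf (lt0r_neq0 p0)).
    by rewrite mulfVK ?lt0r_neq0 // -subr_sqr !sqr_sqrtr // ltW.
  + move=> T F FF rho zeta r xi Ur Urho cr mx cz k.
    have cf : sconv F k (fun t y => Num.sqrt (f (rho t) y)) (fun y => Num.sqrt (f r y)).
      exact: jet_continuous js Ur Urho cr k.
    apply: sconvM (sconvV (sconvD cf cf) (s0 r ^~ Ur)); exact: Df4.
Qed.

Lemma Csurf_mem_lin a (u v : Csurf S) : smooth_fun (u : S -> E) ->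
  smooth_fun (v : S -> E) -> smooth_fun (a *: u + v : S -> E).
Proof.
move=> /smooth_fun_cV su /smooth_fun_cV sv; apply/smooth_fun_cV => i.
rewrite (_ : (fun z => _) = fun z => a * u z i 0 + v z i 0).
  by apply: smooth_funD => //; apply: smooth_funM => //; exact: smooth_fun_cst.
by apply/funext => z; rewrite -[(a *: u + v) z]/(a *: u z + v z) !mxE.
Qed.

(** Evaluation at [y] is bounded by the seminorm of order 0. This gives uniqueness of Gateaux
    derivatives, and later allows identities for the normal to be differentiated at one point of the
    surface. *)
Lemma is_gderiv_pointwise (f : Cb -> Csurf S) r xi (l : Csurf S) y :
  U r -> gs_mem xi -> (forall r, U r -> gs_mem (f r)) -> is_gderiv f r xi l ->
  is_derive (0 : R) 1 (fun h => f (r + h *: xi : Cb) y : E) (l y).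
Proof.
move=> Ur mx fm [ml dl]; apply/is_derive0P/cvgrPdist_lt => e e0.
have [_ Ul] := Cb_cvg_line Ur mx; rewrite scale0r addr0.
have := dl 0%N; move/cvgrPdist_lt => /(_ _ e0); apply: filterS2 Ul => h Uh.
rewrite sub0r normrN => /(le_lt_trans (ler_norm _)).
set q : Csurf S := h^-1 *: (f (r + h *: xi) - f r) => Hh.
have sq : smooth_fun (q : S -> E).
  have -> : q = h^-1 *: (-1 *: f r + f (r + h *: xi : Cb)) + 0.
    by rewrite /q addr0 scaleN1r [in RHS]addrC.
  apply: Csurf_mem_lin; first by apply: Csurf_mem_lin; exact: fm.
  apply/smooth_fun_cV => i; rewrite (_ : (fun z => _) = fun=> 0).
    exact: smooth_fun_cst.
  by apply/funext => z; rewrite mxE.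
have sB : smooth_fun (q - l : S -> E).
  have -> : q - l = -1 *: l + q by rewrite scaleN1r addrC.
  exact: Csurf_mem_lin.
rewrite -normrN opprB (le_lt_trans (norm_le_enorm _)) //.
exact: le_lt_trans (Csurf_norm_ge y sB) Hh.
Qed.

Lemma is_gderiv_unique (f : Cb -> Csurf S) r xi (l l' : Csurf S) : U r -> gs_mem xi ->
  (forall r, U r -> gs_mem (f r)) -> is_gderiv f r xi l -> is_gderiv f r xi l' -> l = l'.
Proof.
move=> Ur mx fm dl dl'; apply/funext => y.
exact: is_derive_unique (is_gderiv_pointwise y Ur mx fm dl)
  (is_gderiv_pointwise y Ur mx fm dl').
Qed.

(** Agreement is asked on [U] only: outside the ball the deformed set may have no normal, and the
    value of [Nmap] is then a default. *)
Definition jet_map (f : Cb -> Csurf S) := exists F : 'I_3 -> Cb -> S -> R,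
  (forall i, jet_algebra (F i)) /\
  forall r y i, U r -> f r y i 0 = F i r y.

(** Neighbourhoods of [z0] relative to [U] times the space of directions. They turn [gs_continuous]
    into a convergence along a filter, the form of the last clause of [jet_derivative]. *)
Definition joint_filter (z0 : Cb * Cb) : set_system (Cb * Cb) :=
  [set P | exists (j : nat) (d : R), 0 < d /\
     forall z : Cb * Cb, U z.1 -> gs_mem z.2 ->
     gs_norm j (z.1 - z0.1) + gs_norm j (z.2 - z0.2) < d -> P z].

Lemma joint_filterP z0 : U z0.1 -> gs_mem z0.2 -> Filter (joint_filter z0).
Proof.
move=> U0 m0; split=> [|P Q [j [d [d0 HP]]] [j' [d' [d0' HQ]]]|P Q PQ [j [d [d0 HP]]]].
- by exists 0%N, 1.
- exists (maxn j j'), (Num.min d d'); split; first by rewrite lt_min d0.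
  move=> z Uz mz; rewrite lt_min => /andP[Hd Hd'].
  have m1 : gs_mem (z.1 - z0.1) by apply: Cb_memB; exact: U_mem.
  have m2 : gs_mem (z.2 - z0.2) by exact: Cb_memB.
  split; [apply: HP => //; apply: le_lt_trans Hd | apply: HQ => //; apply: le_lt_trans Hd'];
    by rewrite lerD // Cb_norm_mono // ?leq_maxl ?leq_maxr.
- by exists j, d; split=> // z Uz mz Hz; apply/PQ/HP.
Qed.

Lemma jet_map_derivative f : jet_map f -> exists df : Cb -> Cb -> Csurf S,
  [/\ forall xi, gs_mem xi -> jet_map (df xi),
      forall r xi, U r -> gs_mem xi -> is_gderiv f r xi (df xi r),
      forall r xi, U r -> gs_mem xi -> gderiv f r xi = df xi r
    & gateaux_C1 U f].
Proof.
move=> [F [jF fF]].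
have [dF DF] := choice (fun i => jet_differentiable (jF i)).
pose df (xi r : Cb) : Csurf S := fun y => \col_i dF i xi r y.
have fm r : U r -> gs_mem (f r).
  move=> Ur; apply/smooth_fun_cV => i.
  rewrite (_ : (fun z => _) = F i r); first exact: jet_smooth.
  by apply/funext => z; rewrite fF.
have dfm r xi : U r -> gs_mem xi -> gs_mem (df xi r).
  move=> Ur mx; apply/smooth_fun_cV => i; have [D1 _ _ _] := DF i.
  rewrite (_ : (fun z => _) = dF i xi r); first by apply: jet_smooth => //; exact: D1.
  by apply/funext => z; rewrite mxE.
have isd r xi : U r -> gs_mem xi -> is_gderiv f r xi (df xi r).
  move=> Ur mx; split=> [|k]; first exact: dfm.
  apply/cvgrPdist_lt => e e0; have [_ Ul] := Cb_cvg_line Ur mx.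
  have Hs i : sconv (0 : R)^' k
      (fun h y => (h^-1 *: (f (r + h *: xi : Cb) - f r) : Csurf S) y i 0)
      (fun y => df xi r y i 0).
    have [_ _ D3 _] := DF i.
    rewrite (_ : (fun y => _) = dF i xi r); last by apply/funext => y; rewrite mxE.
    apply: sconv_near_eq (D3 r xi k Ur mx); apply: filterS Ul => h Uh.
    apply/funext => y; rewrite -!fF //.
    rewrite -[(h^-1 *: (f (r + h *: xi : Cb) - f r)) y]
      /(h^-1 *: (f (r + h *: xi : Cb) y - f r y)).
    by rewrite mxE [(_ - _ : E) _ _]mxE [(- _ : E) _ _]mxE.
  apply: filterS (sconv_Csurf Hs e0) => h /andP[h0 he].
  by rewrite sub0r normrN ger0_norm.
have gE r xi : U r -> gs_mem xi -> gderiv f r xi = df xi r.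
  move=> Ur mx; apply: xget_unique; first exact: isd.
  by move=> l dl; apply: is_gderiv_unique dl (isd r xi Ur mx).
have joint z0 : U z0.1 -> gs_mem z0.2 -> forall k (e : R), 0 < e ->
    exists (j : nat) (d : R), 0 < d /\ forall z : Cb * Cb, U z.1 -> gs_mem z.2 ->
    gs_norm j (z.1 - z0.1) + gs_norm j (z.2 - z0.2) < d ->
    gs_norm k (gderiv f z.1 z.2 - gderiv f z0.1 z0.2) < e.
  move=> U0 m0 k e e0; have FF := joint_filterP U0 m0.
  have m1 := U_mem U0.
  have c1 : Cb_cvg (joint_filter z0) (fun z => z.1) z0.1.
    split; first by exists 0%N, 1; split=> // z Uz _ _; exact: U_mem.
    move=> j d d0; exists j, d; split=> // z Uz mz; apply: le_lt_trans.
    by rewrite lerDl; apply: Cb_norm_ge0; exact: Cb_memB.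
  have c2 : Cb_cvg (joint_filter z0) (fun z => z.2) z0.2.
    split; first by exists 0%N, 1.
    move=> j d d0; exists j, d; split=> // z Uz mz; apply: le_lt_trans.
    by rewrite lerDr; apply: Cb_norm_ge0; apply: Cb_memB => //; exact: U_mem.
  have Uz : \forall z \near joint_filter z0, U z.1 by exists 0%N, 1.
  have Hs i : sconv (joint_filter z0) k (fun z y => df z.2 z.1 y i 0)
      (fun y => df z0.2 z0.1 y i 0).
    have [_ _ _ D4] := DF i.
    rewrite (_ : (fun y => _) = dF i z0.2 z0.1); last by apply/funext => y; rewrite mxE.
    rewrite (_ : (fun z y => _) = fun z : Cb * Cb => dF i z.2 z.1); last first.
      by apply/funext => z; apply/funext => y; rewrite mxE.
    exact: (D4 _ _ FF (fun z => z.1) (fun z => z.2)).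
  have [j [d [d0 H]]] := sconv_Csurf (f := fun z : Cb * Cb => df z.2 z.1) Hs e0.
  exists j, d; split=> // z Uz1 mz Hz; rewrite !gE //.
  by have /andP[] := H z Uz1 mz Hz.
exists df; split=> //.
  move=> xi mx; exists (fun i => dF i xi); split.
    by move=> i; have [D1 _ _ _] := DF i; exact: D1.
  by move=> r y i _; rewrite mxE.
split=> //.
  move=> r Ur; split.
  - by move=> xi mx; exists (df xi r); exact: isd.
  - move=> a xi eta mx me; rewrite !gE //; last exact: Cb_mem_lin.
    apply/funext => y; apply/matrixP => i j.
    rewrite -[(a *: df xi r + df eta r) y]/(a *: df xi r y + df eta r y) !mxE.
    by have [_ D2 _ _] := DF i; rewrite D2.
  - move=> xi mx k e e0; have [j [d [d0 H]]] := joint (r, xi) Ur mx k e e0.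
    exists j, d; split=> // eta me He; apply: (H (r, eta)) => //.
    rewrite -[ltLHS]/(gs_norm j (r - r : Cb) + gs_norm j (eta - xi)).
    by rewrite subrr Cb_norm0 add0r.
move=> [r xi] [/= Ur mx] k e e0; have [j [d [d0 H]]] := joint (r, xi) Ur mx k e e0.
by exists j, d; split=> // -[r' xi'] [Ur' mx'] Hz; exact: (H (r', xi')).
Qed.

Lemma jet_map_gderiv f xi : jet_map f -> gs_mem xi ->
  jet_map (fun r => gderiv f r xi).
Proof.
move=> /jet_map_derivative[df [jd _ dE _]] mx; have [F [jF FE]] := jd xi mx.
by exists F; split=> // r y i Ur; rewrite dE // FE.
Qed.

Lemma jet_map_smooth f : jet_map f -> gateaux_smooth U f.
Proof.
have it (s : seq Cb) g : jet_map g -> (forall xi, xi \in s -> gs_mem xi) ->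
    jet_map (gderiv_iter g s).
  elim: s g => [|xi s IH] g jg ms //=; apply: IH.
    by apply: jet_map_gderiv => //; apply: ms; rewrite inE eqxx.
  by move=> eta es; apply: ms; rewrite inE es orbT.
have C1 g : jet_map g -> gateaux_C1 U g by move=> /jet_map_derivative[df []].
move=> jf; elim=> [|m IH] /=; first exact: C1.
by split=> // s _ ms; apply: C1; exact: it.
Qed.

Lemma jet_sum (I : Type) (s : seq I) (f : I -> Cb -> S -> R) :
  (forall i, jet_algebra (f i)) -> jet_algebra (fun r y => \sum_(i <- s) f i r y).
Proof.
move=> jf; elim: s => [|i s IH].
  rewrite (_ : (fun r y => _) = fun _ => fun=> 0); first exact/JetCst/smooth_fun_cst.
  by apply/funext => r; apply/funext => y; rewrite big_nil.
rewrite (_ : (fun r y => _) = fun r y => f i r y + \sum_(j <- s) f j r y).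
  exact: JetAdd.
by apply/funext => r; apply/funext => y; rewrite big_cons.
Qed.

Lemma jet_prod (I : Type) (s : seq I) (f : I -> Cb -> S -> R) :
  (forall i, jet_algebra (f i)) -> jet_algebra (fun r y => \prod_(i <- s) f i r y).
Proof.
move=> jf; elim: s => [|i s IH].
  rewrite (_ : (fun r y => _) = fun _ => fun=> 1); first exact/JetCst/smooth_fun_cst.
  by apply/funext => r; apply/funext => y; rewrite big_nil.
rewrite (_ : (fun r y => _) = fun r y => f i r y * \prod_(j <- s) f j r y).
  exact: JetMul.
by apply/funext => r; apply/funext => y; rewrite big_cons.
Qed.

Lemma jet_det n (A : Cb -> S -> 'M[R]_n) :
  (forall i j, jet_algebra (fun r y => A r y i j)) ->
  jet_algebra (fun r y => \det (A r y)).
Proof.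
move=> jA; apply: jet_sum => s; apply: JetMul; first exact/JetCst/smooth_fun_cst.
by apply: jet_prod => i; exact: jA.
Qed.

Lemma jet_adj n (A : Cb -> S -> 'M[R]_n) i j :
  (forall i j, jet_algebra (fun r y => A r y i j)) ->
  jet_algebra (fun r y => (\adj (A r y)) i j).
Proof.
move=> jA; rewrite (_ : (fun r y => _) = fun r y => cofactor (A r y) j i).
  apply: JetMul; first exact/JetCst/smooth_fun_cst.
  apply: jet_det => k l.
  rewrite (_ : (fun r y => _) = fun r y => A r y (lift j k) (lift i l)); first exact: jA.
  by apply/funext => r; apply/funext => y; rewrite !mxE.
by apply/funext => r; apply/funext => y; rewrite mxE.
Qed.

End GateauxCalculus.

End TangentialCalculus.

(** * The normal of a deformed surface *)

Section Deformation.
Variables (R : realType) (Om : set 'cV[R]_3) (eps : R).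
Local Notation E := 'cV[R]_3.
Local Notation Cb := (Cb R).
Hypothesis (Om_domain : bounded_domain Om).
Hypothesis (Gamma_surface : smooth_closed_surface (boundary Om)).
Hypothesis (Gamma_simply_connected : simply_connected (boundary Om)).
Hypothesis (eps_gt0 : 0 < eps).
Hypothesis (eps_small : admissible (boundary Om) eps).
Local Notation Gam := (boundary Om).
Implicit Types r : Cb.

Lemma Gamma_connected : connected Gam.
Proof.
case: Gamma_simply_connected => H _; apply: connected_of_paths => x y Gx Gy.
by have [g gP] := H x y Gx Gy; exists g.
Qed.

Lemma Gamma_nonempty : exists y, Gam y.
Proof.
have [oOm _ [x Omx] bOm] := Om_domain; apply: contrapT => nG.
have cl : closed Om.
  rewrite (_ : Om = closure Om); first exact: closed_closure.
  rewrite closure_boundary // (_ : boundary Om = set0) ?setU0 //.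
  by rewrite -subset0 => y Gy; apply: nG; exists y.
by have := bounded_clopen bOm oOm cl; move: Omx => /[swap] ->.
Qed.

Lemma B_infty_derive_lt1 r x v : B_infty eps r -> enorm v = 1 ->
  enorm ('D_v (r : E -> E) x) < 1.
Proof.
move=> Br v1; rewrite ltNge; apply/negP => w1; set w := 'D_v _ _ in w1.
have rm := Br.1.
have [y0 Gy0] := Gamma_nonempty.
have [U [phi [Uy0 [oU sp SU g0 tv] _]]] := surface_local_equation Gamma_surface.2 Gy0.
have [v0 v01 gv0] := exists_orthogonal_unit (gradient phi y0).
have [c [c0 cG cD]] := tv y0 v0 Uy0 Gy0 gv0.
(* The negated claim gives [|w| >= 1], hence [|a| <= 1], as needed to stay in the ball. *)
pose a := (enorm w)^-1.
have w0 : 0 < enorm w by rewrite (lt_le_trans ltr01).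
have aw1 : enorm (a *: w) = 1.
  by rewrite enormZ ger0_norm ?invr_ge0 ?enorm_ge0 // mulVf // gt_eqF.
(* [Q] takes [v0] to [v] and [P] takes [a w] to [- v0], so the copy has derivative [- v0] in the
   direction [v0] at [y0]. *)
pose Q := reflection (v0 - v); pose P := reflection (a *: w - (- v0)).
pose r' : Cb := Cb_isometry r P Q a y0 x.
have Br' : B_infty eps r'.
  apply: B_infty_isometry => //; try by move=> u; exact: reflection_enorm.
  by rewrite ger0_norm ?invr_ge0 ?enorm_ge0 // invf_le1.
have Dr' : 'D_v0 (r' : E -> E) y0 = - v0.
  have [] := iterD_isometry P Q a y0 x [:: v0] y0 rm.
  rewrite /= => -> _; rewrite subrr mulmx0 add0r reflection_sub // -/w scalemxAr.
  by rewrite reflection_sub // enormN.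
have [_ [_ _ [h [hK sh]]]] := eps_small Br'.
pose F z := z + r' z.
have Fy0 : deformed Gam r' (F y0) by exists y0.
have [H [W [oW Wy sH HE]]] := sh (exist _ (F y0) (mem_set Fy0)).
have dF z : differentiable F z.
  by apply: (differentiableD (f := id)) => //; exact: (Cb_diff [::] _ Br'.1).
(* The image of the curve [c] has velocity 0, and the smooth inverse [H] would then give [c]
   velocity 0 instead of [v0]. *)
have cF : is_derive (0 : R) 1 (fun t => F (c t)) 0.
  have := is_derive_comp_curve cD (dF (c 0)).
  rewrite c0 (deriveD (f := id) (g := r' : E -> E)) //.
    by rewrite derive_id Dr' subrr.
  exact/diff_derivable/(Cb_diff [::] _ Br'.1).
have Wc : \forall t \near (0 : R), W (F (c t)).
  have : {for 0, continuous (fun t => F (c t))}.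
    by apply/differentiable_continuous/derivable1_diffP; case: cF.
  by apply; rewrite c0; exact: open_nbhs_nbhs.
have HFc : \forall t \near (0 : R), H (F (c t)) = c t.
  apply: filterS2 Wc cG => t Wt Gt; rewrite -[RHS](hK _ Gt).
  have Ft : deformed Gam r' (F (c t)) by exists (c t).
  by have := HE (exist _ (F (c t)) (mem_set Ft)) Wt.
have dH : differentiable H (F (c 0)).
  by apply: smooth_on_diff sH _; rewrite c0.
have := is_derive_comp_curve cF dH; rewrite derive0 => D0.
have := is_derive_unique (near_eq_is_derive HFc D0) cD.
move=> v00; move: v01; rewrite -v00 enorm0 => /eqP.
by rewrite eq_sym oner_eq0.
Qed.

(** As the inequality defining the ball is strict, [c r] is still in it for some [c > 1]; the bound
    1 for the derivatives of [c r] is the uniform bound [1 / c] for those of [r]. *)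
Lemma B_infty_derive_le r : B_infty eps r -> exists2 q : R, 0 <= q < 1 &
  forall x v, enorm ('D_v (r : E -> E) x) <= q * enorm v.
Proof.
move=> [rm dr].
have [c c1 cd] := exists_scale_lt eps_gt0 dr.
have c0 : 0 < c by apply: lt_trans c1.
have Bcr : B_infty eps (c *: r : Cb).
  split; first exact: Cb_memZ.
  by apply: le_lt_trans (d_infty_scale rm (ltW c1)) _.
exists c^-1; first by rewrite invr_ge0 ltW //= invf_lt1.
move=> x v; have dr' := Cb_diff [::] x rm.
have [->|v0] := eqVneq v 0; first by rewrite derive0 !enorm0 mulr0.
pose u := (enorm v)^-1 *: v.
have n0 : enorm v != 0 by rewrite enorm_eq0.
have u1 : enorm u = 1.
  by rewrite enormZ ger0_norm ?invr_ge0 ?enorm_ge0 // mulVf.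
have := B_infty_derive_lt1 x Bcr u1.
rewrite (deriveZ (f := r : E -> E)); last exact: diff_derivable dr'.
rewrite enormZ gtr0_norm // deriveE // linearZ enormZ ger0_norm ?invr_ge0 ?enorm_ge0 //.
rewrite -deriveE // mulrCA ltr_pdivrMl ?enorm_gt0 // mulr1.
by rewrite -ltr_pdivlMl // => /ltW.
Qed.

(** The mean value theorem is scalar, so it is applied to the product of [r] along the segment with
    the fixed vector [w = r x - r y], followed by the Cauchy-Schwarz inequality. *)
Lemma B_infty_contraction r : B_infty eps r -> exists2 q : R, 0 <= q < 1 &
  forall x y, enorm (r x - r y) <= q * enorm (x - y).
Proof.
move=> Br; have [q q01 Dr] := B_infty_derive_le Br; exists q => // x y.
set w := r x - r y.
have [->|w0] := eqVneq w 0.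
  by rewrite enorm0 mulr_ge0 ?enorm_ge0 //; case/andP: q01.
pose f t := dot w (r (y + t *: (x - y))).
pose df t := dot w ('D_(x - y) (r : E -> E) (y + t *: (x - y))).
have dr z : differentiable (r : E -> E) z by exact: (Cb_diff [::] _ Br.1).
have Df (t : R) : is_derive t 1 f (df t).
  have D1 := is_derive_affine y (x - y) t.
  have D2 := is_derive_comp_curve D1 (dr _).
  have := is_derive_comp_curve D2 (differentiable_dot w _).
  by rewrite derive_dot.
have cf : {within `[0, 1], continuous f}.
  apply: continuous_subspaceT => t.
  by apply/differentiable_continuous/derivable1_diffP; case: (Df t).
have [c _] := MVT_segment ler01 (fun t _ => Df t) cf.
rewrite subr0 mulr1 /f scale1r scale0r addr0 (addrC y) subrK -dotBr -/w => wE.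
have : enorm w ^+ 2 <= enorm w * (q * enorm (x - y)).
  rewrite sqr_enorm wE (le_trans (dot_le _ _)) // ler_wpM2l ?enorm_ge0 //.
by rewrite expr2 ler_pM2l // enorm_gt0.
Qed.

(** Solving [x + r x = y] amounts to finding the fixed point of the contraction [x |-> y - r x]. The
    reverse triangle inequality gives injectivity and the Lipschitz constant [1 / (1 - q)]. *)
Lemma deform_inverse r : B_infty eps r -> exists (G : E -> E) (L : R),
  [/\ 0 < L, cancel (fun x : E => x + r x) G, cancel G (fun x : E => x + r x)
    & forall y y', enorm (G y - G y') <= L * enorm (y - y')].
Proof.
move=> Br; have [q /andP[q0 q1] rq] := B_infty_contraction Br.
have G_ex y : exists x, x + r x = y.
  have [|p pE] := @contraction_fixed R (fun x => y - r x) q q0 q1.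
    move=> x x'; rewrite opprB addrC addrA subrK (le_trans (rq _ _)) //.
    by rewrite enormC.
  by exists p; rewrite -{1}pE subrK.
have [G GE] := choice G_ex.
have L x x' : enorm (x - x') <= (1 - q)^-1 * enorm (x + r x - (x' + r x')).
  rewrite -ler_pdivrMl ?invr_gt0 ?subr_gt0 // invrK.
  have -> : x + r x - (x' + r x') = (x - x') + (r x - r x') by rewrite opprD addrACA.
  have H := enormD ((x - x') + (r x - r x')) (- (r x - r x')).
  move: H; rewrite addrK enormN; have := rq x x'; lra.
exists G, (1 - q)^-1; split=> [|x|y|y y'] //.
- by rewrite invr_gt0 subr_gt0.
- apply/eqP; rewrite -subr_eq0 -enorm_eq0 eq_le enorm_ge0 andbT.
  by rewrite (le_trans (L _ _)) // GE subrr enorm0 mulr0.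
- by rewrite -{2}(GE y) -{2}(GE y') L.
Qed.

Lemma deform_diff r x : B_infty eps r ->
  differentiable (fun z : E => z + r z) x /\
  forall v, 'D_v (fun z : E => z + r z) x = (1%:M + jac r x) *m v.
Proof.
move=> [rm _]; have dr := Cb_diff [::] x rm.
split=> [|v]; first exact: (differentiableD (f := id)).
rewrite (deriveD (f := id) (g := r : E -> E)) //; last exact: diff_derivable dr.
by rewrite derive_id mulmxDl mul1mx derive_jac.
Qed.

Lemma deform_image r G (A : set E) : cancel (fun x : E => x + r x) G ->
  cancel G (fun x : E => x + r x) -> (fun x : E => x + r x) @` A = G @^-1` A.
Proof.
move=> FK GK; rewrite eqEsubset; split=> [_ [x Ax <-]|y Ay]; first by rewrite /= FK.
by exists (G y); rewrite ?GK.
Qed.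

Lemma deformed_domain r : B_infty eps r ->
  bounded_domain ((fun x : E => x + r x) @` Om) /\
  boundary ((fun x : E => x + r x) @` Om) = deformed Gam r.
Proof.
move=> Br; have [G [L [L0 FK GK GL]]] := deform_inverse Br.
have [oOm cOm [x0 Ox0] bOm] := Om_domain.
have cG := lipschitz_continuous L0 GL.
have cF : continuous (fun x : E => x + r x).
  by move=> x; exact/differentiable_continuous/(deform_diff x Br).1.
have oF : open ((fun x : E => x + r x) @` Om).
  by rewrite (deform_image _ FK GK); apply: open_comp => // y _; exact: cG.
split.
  split=> //.
  - by apply: connected_continuous_connected cOm _; exact: continuous_subspaceT.
  - by exists (x0 + r x0), x0.
  - have [M [Mr MOm]] := bOm; exists (M + gs_norm 0 r); split.
      by rewrite num_real.
    move=> N MN _ [x Ox <-]; rewrite /= (le_trans (ler_normD _ _)) //.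
    have -> : N = (N - gs_norm 0 r) + gs_norm 0 r by rewrite subrK.
    rewrite lerD //; first by apply: MOm => //; rewrite ltrBrDr.
    by rewrite (le_trans (norm_le_enorm _)) // (le_Cb_norm (vs := [::]) _ Br.1).
rewrite boundary_open // (deform_image _ FK GK) (closure_homeo _ cF cG) //.
rewrite /deformed (deform_image _ FK GK) boundary_open //.
Qed.

Lemma enclosed_deformed r : B_infty eps r ->
  enclosed_domain (deformed Gam r) = (fun x : E => x + r x) @` Om.
Proof.
move=> Br; have [dF bF] := deformed_domain Br.
have [dD bD] : bounded_domain (enclosed_domain (deformed Gam r)) /\
    boundary (enclosed_domain (deformed Gam r)) = deformed Gam r.
  by rewrite /enclosed_domain; case: xgetP => [//|/(_ _ (conj dF bF))].
apply: bounded_domain_unique => //; rewrite ?bD ?bF //.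
  by case: (eps_small Br) => -[].
apply: connected_continuous_connected; first exact: Gamma_connected.
apply: continuous_subspaceT => x.
exact/differentiable_continuous/(deform_diff x Br).1.
Qed.

(** A unit vector [v] in the kernel would satisfy [D_v r = - v], of norm 1. *)
Lemma deform_unitmx r x : B_infty eps r -> 1%:M + jac r x \in unitmx.
Proof.
move=> Br; rewrite -unitmx_tr -row_free_unit -kermx_eq0; apply/negPn/negP.
move=> /rowV0Pn[u] /sub_kermxP uP u0.
have dr := Cb_diff [::] x Br.1.
pose v := (enorm u^T)^-1 *: u^T.
have n0 : enorm u^T != 0 by rewrite enorm_eq0 -trmx0 (inj_eq trmx_inj).
have v1 : enorm v = 1.
  by rewrite enormZ ger0_norm ?invr_ge0 ?enorm_ge0 // mulVf.
have := B_infty_derive_lt1 x Br v1.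
rewrite derive_jac // (_ : jac r x *m v = - v) ?enormN ?v1 ?ltxx //.
apply/eqP; rewrite -addr_eq0 addrC -{1}(mul1mx v) -mulmxDl /v -scalemxAr.
by rewrite -[1%:M + _]trmxK -trmx_mul uP trmx0 scaler0.
Qed.

(* G o c is o(t)-close to the line x + t M w, because I + r maps this line to a *)
(* curve tangent to c and G is Lipschitz; no inverse function theorem is used.  *)
Lemma deform_inverse_curve r x (G : E -> E) L (c : R -> E) w : B_infty eps r ->
  0 < L -> cancel (fun x : E => x + r x) G ->
  (forall y y', enorm (G y - G y') <= L * enorm (y - y')) ->
  c 0 = x + r x -> is_derive (0 : R) 1 c w ->
  is_derive (0 : R) 1 (fun t => G (c t)) (invmx (1%:M + jac r x) *m w).
Proof.
move=> Br L0 FK GL c0 cw; set P := 1%:M + jac r x; set u := invmx P *m w.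
have [dF DF] := deform_diff x Br.
pose l t := x + t *: u + r (x + t *: u).
have Fl : is_derive (0 : R) 1 l w.
  have -> : w = 'D_u (fun z : E => z + r z) x by rewrite DF mulKVmx // deform_unitmx.
  exact: (is_derive_line (f := fun z => z + r z)).
have l0 : l 0 = x + r x by rewrite /l scale0r addr0.
apply/is_derive0P/cvgrPdist_lt => e e0.
have diff0 : is_derive (0 : R) 1 (c - l) 0.
  by rewrite -(subrr w); exact: is_deriveB.
have e1 : 0 < e / (L * 3) by rewrite divr_gt0 // mulr_gt0.
have /is_derive0P/cvgrPdist_lt/(_ _ e1) := diff0.
have nz : \forall h \near (0 : R)^', h != 0 by exact: nbhs_dnbhs_neq.
apply: filterS2 nz => h h0; rewrite /= sub0r normrN.
rewrite -[(c - _) h]/(c h - l h) -[(c - _) 0]/(c 0 - l 0) c0 l0 subrr subr0.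
rewrite normrZ FK => H.
have -> : u - h^-1 *: (G (c h) - x) = - (h^-1 *: (G (c h) - (x + h *: u))).
  by rewrite opprD addrA [in RHS]scalerBr scalerA mulVf // scale1r opprB.
rewrite normrN normrZ -(FK (x + h *: u)) -/(l h).
rewrite (@le_lt_trans _ _ (`|h^-1| * (L * (3 * `|c h - l h|)))) //.
  rewrite ler_wpM2l // (le_trans (norm_le_enorm _)) // (le_trans (GL _ _)) //.
  by rewrite ler_pM2l // enorm_le_norm.
rewrite (_ : _ * _ = `|h^-1| * `|c h - l h| * (L * 3)); last by ring.
by rewrite -ltr_pdivlMr ?mulr_gt0.
Qed.

(** The normalized gradient of [phi] composed with the inverse of [I + r], taken at the point
    [x + r x]. *)
Definition unit_normal (r : Cb) (phi : E -> R) (x : E) : E :=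
  let u := (invmx (1%:M + jac r x))^T *m gradient phi x in (enorm u)^-1 *: u.

(** * The outer normal at a point, from a local equation *)

Section AtPoint.
Variables (U : set E) (phi : E -> R) (x : E).
Hypotheses (Uphi : local_equation Gam U phi) (Ux : U x) (Gx : Gam x).
Hypothesis (OmU : forall z, U z -> (Om z <-> phi z < 0)).

Let oU : open U. Proof. by case: Uphi. Qed.

Let dphi : differentiable phi x.
Proof. by case: Uphi => _ sp _ _ _; exact: smooth_on_diff sp Ux. Qed.

Let phix : phi x = 0. Proof. by case: Uphi => _ _ SU _ _; apply/SU. Qed.

(** [phi] has positive slope along [c], so it is positive just after time 0 and negative just
    before. *)
Lemma inner_side (c : R -> E) w : c 0 = x -> is_derive (0 : R) 1 c w ->
  0 < dot (gradient phi x) w ->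
  (\forall t \near (0 : R)^'+, ~ closure Om (c t)) /\
  (\forall t \near (0 : R)^'+, Om (c (- t))).
Proof.
move=> c0 cw gw; have dp : differentiable phi (c 0) by rewrite c0.
have D := is_derive_comp_curve cw dp; rewrite c0 derive_gradient // in D.
have f0 : phi (c 0) = 0 by rewrite c0.
have N1 := slope_sign D f0 gw.
have N2 : \forall t \near (0 : R), U (c t).
  have : {for 0, continuous c}.
    by apply/differentiable_continuous/derivable1_diffP; case: cw.
  by apply; rewrite c0; exact: open_nbhs_nbhs.
have [e /= e0 He] := filterI N1 (near0_punctured N2).
have N3 : \forall t \near (0 : R)^'+, 0 < t /\ t < e.
  by near=> t; split; near: t; [exact: nbhs_right_gt|exact: nbhs_right_lt].
split; apply: filterS N3 => t [t0 te].
  have [|| pt Ut] := He t; rewrite ?gt_eqF //= ?sub0r ?normrN ?gtr0_norm //.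
  rewrite pmulr_rgt0 ?invr_gt0 // in pt.
  rewrite closure_boundary; last by case: Om_domain.
  case=> [/(OmU Ut)|]; first by apply/negP; rewrite -leNgt ltW.
  by case: Uphi => _ _ SU _ _ /SU p0; rewrite p0 // ltxx in pt.
have [|| pt Ut] := He (- t); rewrite ?oppr_eq0 ?gt_eqF //= ?sub0r ?opprK ?gtr0_norm //.
apply/OmU => //; rewrite invrN mulNr -mulrN pmulr_rgt0 ?invr_gt0 // in pt.
by rewrite -oppr_gt0.
Unshelve. all: by end_near. Qed.

Lemma deformed_tangent r v : B_infty eps r -> dot (gradient phi x) v = 0 ->
  tangent_vector (deformed Gam r) (x + r x) ((1%:M + jac r x) *m v).
Proof.
move=> Br gv; have [_ _ _ _ /(_ x v Ux Gx gv)[c [c0 cG cD]]] := Uphi.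
have [dF DF] := deform_diff (c 0) Br.
exists (fun t => c t + r (c t)); split.
- by rewrite c0.
- by apply: filterS cG => t Gt; exists (c t).
- by rewrite -c0 -DF; exact: is_derive_comp_curve cD dF.
Qed.

(** Curves are pulled back by the inverse [G]. A curve of the deformed surface becomes a curve of
    Gamma, where [phi] vanishes, and differentiating gives orthogonality; the straight line along
    the normal becomes a curve on which [phi] has slope [dot u m > 0], which settles the sides. *)
Lemma unit_normalP r : B_infty eps r ->
  is_outer_unit_normal (deformed Gam r) (x + r x) (unit_normal r phi x).
Proof.
move=> Br; have [G [L [L0 FK GK GL]]] := deform_inverse Br.
set m := unit_normal r phi x.
set M := invmx (1%:M + jac r x); set g := gradient phi x; set u := M^T *m g.
have u0 : u != 0.
  apply: trmx_invmx_mul_neq0; first exact: deform_unitmx.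
  by case: Uphi => _ _ _ + _; apply.
have mE : m = (enorm u)^-1 *: u by [].
have un : 0 < enorm u by rewrite enorm_gt0.
have gM w : dot g (M *m w) = dot u w by rewrite dot_mulmxr.
have closF : closure ((fun x : E => x + r x) @` Om) =
    [set y | closure Om (G y)].
  rewrite (deform_image _ FK GK) (closure_homeo _ _ (lipschitz_continuous L0 GL) FK GK) //.
  by move=> z; exact/differentiable_continuous/(deform_diff z Br).1.
split.
- exact: normalize_unit.
- move=> v [c [c0 cS cD]].
  have D1 := deform_inverse_curve Br L0 FK GL c0 cD.
  have dp : differentiable phi (G (c 0)) by rewrite c0 FK.
  have D2 := is_derive_comp_curve D1 dp.
  rewrite c0 FK derive_gradient // gM in D2.
  have NU : \forall t \near (0 : R), U (G (c t)).
    have : {for 0, continuous (fun t => G (c t))}.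
      by apply/differentiable_continuous/derivable1_diffP; case: D1.
    by apply; rewrite c0 FK; exact: open_nbhs_nbhs.
  have N0 : \forall t \near (0 : R), phi (G (c t)) = 0.
    apply: filterS2 NU cS => t + [z Gz zE]; rewrite -zE FK => Uz.
    by case: Uphi => _ _ SU _ _; apply/SU.
  have D3 : is_derive (0 : R) 1 (fun t => phi (G (c t))) 0.
    have D0 : is_derive (0 : R) 1 (cst (0 : R)) 0 by exact: is_derive_cst.
    by apply: near_eq_is_derive D0; apply: filterS N0 => t ->.
  by rewrite mE dotZl (is_derive_unique D2 D3) mulr0.
- have cD := is_derive_affine (x + r x) m 0.
  have c0 : x + r x + 0 *: m = x + r x by rewrite scale0r addr0.
  have D1 := deform_inverse_curve Br L0 FK GL c0 cD.
  have gw : 0 < dot g (M *m m).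
    by rewrite gM mE dotZr mulr_gt0 ?invr_gt0 // lt_def dot_ge0 dot_eq0 u0.
  have Gc0 : G (x + r x + 0 *: m) = x by rewrite c0 FK.
  have [N1 N2] := inner_side Gc0 D1 gw.
  apply: filterS2 N1 N2 => t nO Ot; rewrite (enclosed_deformed Br) closF; split=> //.
  by rewrite (deform_image _ FK GK) /= -scaleNr.
Qed.

(** Tangency determines the normal up to a factor of absolute value 1. The factor -1 is excluded
    because the points on one side would be both inside the domain and outside its closure. *)
Lemma unit_normal_unique r n : B_infty eps r ->
  is_outer_unit_normal (deformed Gam r) (x + r x) n -> n = unit_normal r phi x.
Proof.
move=> Br [n1 nT nS]; have [m1 _ mS] := unit_normalP Br.
set m := unit_normal r phi x in m1 mS *.
set P := 1%:M + jac r x; set g := gradient phi x.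
have uP : P \in unitmx by exact: deform_unitmx.
have g0 : g != 0 by case: Uphi => _ _ _ + _; apply.
pose gh := (enorm g)^-1 *: g; have gh1 : enorm gh = 1 by exact: normalize_unit.
have PT : P^T *m n = dot (P^T *m n) gh *: gh.
  apply: orth_proj => // v; rewrite dotZl => /eqP.
  rewrite mulf_eq0 invr_eq0 enorm_eq0 (negPf g0) /= => /eqP gv.
  by rewrite -dot_mulmxr; apply: nT; exact: deformed_tangent.
set u := (invmx P)^T *m g; have u0 : u != 0 by exact: trmx_invmx_mul_neq0.
pose a := dot (P^T *m n) gh * (enorm g)^-1 * enorm u.
have nm : n = a *: m.
  rewrite -[n]mul1mx -trmx1 -(mulmxV uP) trmx_mul -mulmxA PT -scalemxAr /gh -scalemxAr.
  rewrite /m /unit_normal -/P -/g -/u !scalerA /a mulfK // enorm_eq0 //.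
have a1 : `|a| = 1 by rewrite -n1 nm enormZ m1 mulr1.
have [a0|a0] := leP 0 a; first by rewrite nm -(ger0_norm a0) a1 scale1r.
have nN : n = - m by rewrite nm -[a]opprK scaleNr -(ltr0_norm a0) a1 scale1r.
exfalso; have : \forall t \near (0 : R)^'+, False.
  apply: filterS2 nS mS => t [nO _] [_ mO]; apply: mO; apply: subset_closure.
  by move: nO; rewrite nN scalerN opprK.
by move=> /filter_ex[].
Qed.

Lemma NmapE r (z : Gam) : val z = x -> B_infty eps r ->
  Nmap (S := Gam) r z = unit_normal r phi x.
Proof.
move=> zx Br; rewrite /Nmap /tau /outer_normal /= zx.
case: xgetP => [n _ nn|/(_ _ (unit_normalP Br))//].
exact: unit_normal_unique.
Qed.

(** Gamma is its own deformation by [r = 0], for which the matrix [1 + jac r] is the identity. *)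
Lemma outer_normalE (z : Gam) : val z = x ->
  outer_normal z = (enorm (gradient phi x))^-1 *: gradient phi x.
Proof.
move=> zx; have B0 : B_infty eps (0 : Cb) by exact: B_infty0.
have d0 : deformed Gam (0 : Cb) = Gam.
  rewrite eqEsubset; split=> [_ [w Gw <-]|w Gw]; first by rewrite addr0.
  by exists w => //; rewrite addr0.
have u0 : unit_normal 0 phi x = (enorm (gradient phi x))^-1 *: gradient phi x.
  by rewrite /unit_normal jac0 addr0 invmx1 trmx1 mul1mx.
have := unit_normalP B0; have := @unit_normal_unique 0 ^~ B0.
rewrite d0 -[(0 : Cb) x]/(0 : E) addr0 u0 => uniq nP.
rewrite /outer_normal zx; case: xgetP => [n _ nn|/(_ _ nP)//].
exact: uniq.
Qed.

End AtPoint.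

Lemma Gamma_local_equation (y : Gam) : exists U phi, [/\ U (val y),
  local_equation Gam U phi & forall x, U x -> (Om x <-> phi x < 0)].
Proof.
have [U [phi [Uy le _ OmU]]] :=
  domain_side Om_domain Gamma_surface.2 Gamma_connected (set_valP y).
by exists U, phi.
Qed.

Lemma Gamma_regular (y : Gam) : regular_normal y.
Proof.
have [U [phi [Uy le OmU]]] := Gamma_local_equation y.
have nE := outer_normalE le Uy (set_valP y) OmU (erefl (val y)).
have [_ _ _ /(_ _ Uy) g0 tv] := le.
split; first by rewrite nE; exact: normalize_unit.
move=> v; rewrite nE dotZl => /eqP; rewrite mulf_eq0 invr_eq0 enorm_eq0 (negPf g0) /=.
by move=> /eqP; apply: tv => //; exact: set_valP.
Qed.

Lemma Gamma_normal_smooth i : smooth_fun (fun y : Gam => outer_normal y i 0).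
Proof.
move=> y; have [U [phi [Uy le OmU]]] := Gamma_local_equation y.
have [oU sp SU g0 tv] := le.
pose q x := \sum_j 'D_(delta_mx j 0) phi x * 'D_(delta_mx j 0) phi x.
have qE x : q x = dot (gradient phi x) (gradient phi x).
  by apply: eq_bigr => j _; rewrite mxE.
have q0 x : U x -> 0 < q x.
  by move=> Ux; rewrite qE lt_def dot_ge0 andbT dot_eq0 g0.
exists (fun x => (Num.sqrt (q x))^-1 * 'D_(delta_mx i 0) phi x), U; split=> //.
  apply: smooth_closure_on => //; apply: SmoothMul; last first.
    exact/SmoothBase/smooth_on_derive.
  apply: SmoothInv => [|x Ux]; last by rewrite gt_eqF // sqrtr_gt0 q0.
  apply: SmoothSqrt => //; apply: smooth_closure_sum => // j.
  by apply: SmoothMul; exact/SmoothBase/smooth_on_derive.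
move=> z Uz; have nE := outer_normalE le Uz (set_valP z) OmU (erefl (val z)).
by rewrite nE mxE [gradient phi _ i 0]mxE qE.
Qed.

(** For invertible [P] this is [(det P)^2] times the transposed inverse of [P] applied to the normal
    of Gamma. One determinant turns the inverse into the adjugate, which is polynomial; the other
    makes the factor positive whatever the sign of [det P], so that normalizing yields the outer
    normal. Using [outer_normal] in place of a gradient makes the formula global on Gamma. *)
Definition cofactor_normal (r : Cb) (y : Gam) : E :=
  let P := 1%:M + jac r (val y) in \det P *: ((\adj P)^T *m outer_normal y).

Lemma cofactor_normalE r (y : Gam) : B_infty eps r -> exists2 u : E, u != 0 &
  Nmap (S := Gam) r y = (enorm u)^-1 *: u /\
  exists2 a, 0 < a & cofactor_normal r y = a *: u.
Proof.
move=> Br; have [U [phi [Uy le OmU]]] := Gamma_local_equation y.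
have [_ _ _ /(_ _ Uy) g0 tv] := le.
have uP := deform_unitmx (val y) Br.
exists ((invmx (1%:M + jac r (val y)))^T *m gradient phi (val y)).
  exact: trmx_invmx_mul_neq0.
split; first exact: (NmapE le Uy (set_valP y) OmU).
have nE := outer_normalE le Uy (set_valP y) OmU (erefl (val y)).
set P := 1%:M + jac r (val y) in uP *.
exists (\det P ^+ 2 * (enorm (gradient phi (val y)))^-1).
  rewrite mulr_gt0 ?invr_gt0 ?enorm_gt0 // lt_def sqr_ge0 andbT sqrf_eq0.
  by move: uP; rewrite unitmxE unitfE.
rewrite /cofactor_normal -/P nE -scalemxAr scalerA /invmx uP linearZ -scalemxAl.
rewrite scalerA; congr (_ *: _); rewrite expr2.
have d0 : \det P != 0 by move: uP; rewrite unitmxE unitfE.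
by field; rewrite d0 enorm_eq0 g0.
Qed.

Lemma Nmap_jet : jet_map (B_infty eps) (@Nmap R Gam).
Proof.
pose c (i : 'I_3) (r : Cb) (y : Gam) := cofactor_normal r y i 0.
pose q (r : Cb) (y : Gam) := \sum_i c i r y * c i r y.
have c0 r y : B_infty eps r -> 0 < q r y.
  move=> Br; have [u u0 [_ [a a0 ca]]] := cofactor_normalE y Br.
  rewrite -[q r y]/(dot (cofactor_normal r y) (cofactor_normal r y)).
  by rewrite lt_def dot_ge0 andbT dot_eq0 ca scaler_eq0 gt_eqF.
have jP i j : jet_algebra (B_infty eps)
    (fun (r : Cb) (y : Gam) => (1%:M + jac r (val y)) i j).
  rewrite (_ : (fun r y => _) = fun r (y : Gam) => (1%:M : 'M[R]_3) i j + jac r (val y) i j).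
    by apply: JetAdd; [exact/JetCst/smooth_fun_cst|exact: JetJac].
  by apply/funext => r; apply/funext => y; rewrite mxE.
have jc i : jet_algebra (B_infty eps) (c i).
  rewrite (_ : c i = fun r y => \det (1%:M + jac r (val y)) *
     \sum_j (\adj (1%:M + jac r (val y))) j i * outer_normal y j 0).
    apply: JetMul; first exact: jet_det.
    apply: jet_sum => j; apply: JetMul; first exact: jet_adj.
    by apply: JetCst; exact: Gamma_normal_smooth.
  apply/funext => r; apply/funext => y; rewrite /c /cofactor_normal mxE; congr (_ * _).
  by rewrite mxE; apply: eq_bigr => j _; rewrite mxE.
have jq : jet_algebra (B_infty eps) q by apply: jet_sum => i; exact: JetMul.
exists (fun i r y => (Num.sqrt (q r y))^-1 * c i r y); split.
  move=> i; apply: JetMul => //; apply: (JetInv (JetSqrt jq c0)) => r y Br.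
  by rewrite sqrtr_gt0 c0.
move=> r y i Br; have [u u0 [-> [a a0 ca]]] := cofactor_normalE y Br.
rewrite -[Num.sqrt (q r y)]/(enorm (cofactor_normal r y)) /c ca enormZ gtr0_norm //.
by rewrite !mxE; field; rewrite enorm_eq0 u0 gt_eqF.
Qed.

(** * The formula for the first derivative *)

Section Derivative.
Variables (r xi : Cb) (x : Gam).
Hypotheses (Br : B_infty eps r) (xi_mem : gs_mem xi).
Let N h : E := Nmap (S := Gam) (r + h *: xi : Cb) x.
Let P := 1%:M + jac r (val x).

Lemma near_line_mem : \forall h \near (0 : R), B_infty eps (r + h *: xi : Cb).
Proof.
have [_ Bl] := Cb_cvg_line (U := B_infty eps) (fun r H => H.1) (@B_infty_open R eps) Br xi_mem.
have {}Bl : nbhs (0 : R) (fun h => h != 0 -> B_infty eps (r + h *: xi : Cb)) by [].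
apply: filterS Bl => h H; have [->|/H//] := eqVneq h 0.
by rewrite scale0r addr0.
Qed.

Lemma Nmap_normal r' : B_infty eps r' ->
  enorm (Nmap (S := Gam) r' x) = 1 /\
  forall v, dot (outer_normal x) v = 0 ->
    dot (Nmap (S := Gam) r' x) ((1%:M + jac r' (val x)) *m v) = 0.
Proof.
move=> Br'; have [U [phi [Ux le OmU]]] := Gamma_local_equation x.
have Gx := set_valP x.
have [n1 nT _] := unit_normalP le Ux Gx OmU Br'.
rewrite (NmapE le Ux Gx OmU (erefl (val x)) Br'); split=> // v nv.
have [_ _ _ /(_ _ Ux) g0 _] := le.
have gv : dot (gradient phi (val x)) v = 0.
  move: nv; rewrite (outer_normalE le Ux Gx OmU (erefl (val x))) dotZl => /eqP.
  by rewrite mulf_eq0 invr_eq0 enorm_eq0 (negPf g0) /= => /eqP.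
exact/nT/(deformed_tangent le Ux Gx Br' gv).
Qed.

(** The vectors orthogonal to all [P v] with [v] tangent to Gamma form a line, and this line
    contains the normal; orthogonality to the normal leaves only 0. *)
Lemma Nmap_unique_direction u : (forall v, dot (outer_normal x) v = 0 ->
    dot u (P *m v) = 0) -> dot u (Nmap (S := Gam) r x) = 0 -> u = 0.
Proof.
move=> uP uN; have uPm := deform_unitmx (val x) Br; rewrite -/P in uPm.
have [n1 nT] := Gamma_regular x; set n := outer_normal x in n1 uP *.
have PT w : (forall v, dot n v = 0 -> dot w (P *m v) = 0) ->
    w = dot (P^T *m w) n *: ((invmx P)^T *m n).
  move=> wP; rewrite scalemxAr -[LHS]mul1mx -trmx1 -(mulmxV uPm) trmx_mul -mulmxA.
  congr (_ *m _); apply: orth_proj => // v nv.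
  by rewrite -dot_mulmxr wP.
have [N1 NP] := Nmap_normal Br.
have NE := PT _ NP; set b := dot _ n in NE; set m := (invmx P)^T *m n in NE PT.
rewrite (PT _ uP) in uN *; set a := dot _ n in uN *.
have b0 : b != 0.
  apply/eqP => b0; move: N1; rewrite NE b0 scale0r enorm0 => /eqP.
  by rewrite eq_sym oner_eq0.
have m0 : m != 0.
  apply/eqP => m0; move: N1; rewrite NE m0 scaler0 enorm0 => /eqP.
  by rewrite eq_sym oner_eq0.
move: uN; rewrite NE dotZl dotZr => /eqP; rewrite !mulf_eq0 (negPf b0) /=.
by rewrite dot_eq0 (negPf m0) orbF => /eqP ->; rewrite scale0r.
Qed.

(** The two conclusions are the derivatives at [h = 0] of the identities [|N h|^2 = 1] and
    [N h . (P v + h D_v xi) = 0], valid for all small [h]. *)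
Lemma Nmap_curve_derivative w : is_derive (0 : R) 1 N w ->
  dot w (Nmap (S := Gam) r x) = 0 /\
  forall v, dot (outer_normal x) v = 0 ->
    dot w (P *m v) = - dot (Nmap (S := Gam) r x) ('D_v (xi : E -> E) (val x)).
Proof.
move=> dN; have N0 : N 0 = Nmap (S := Gam) r x by rewrite /N scale0r addr0.
have cst0 (a : R) : is_derive (0 : R) 1 (fun _ : R => a) 0 by exact: is_derive_cst.
split=> [|v nv].
  have H : \forall h \near (0 : R), 1 = dot (N h) (N h).
    apply: filterS near_line_mem => h /Nmap_normal[/enorm1_dot n1 _].
    by rewrite /N n1.
  have := is_derive_unique (is_derive_dot dN dN) (near_eq_is_derive H (cst0 1)).
  by rewrite N0 (dotC _ w) -mulr2n => /eqP; rewrite mulrn_eq0 /= => /eqP.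
have H : \forall h \near (0 : R), 0 = dot (N h) (P *m v + h *: 'D_v (xi : E -> E) (val x)).
  apply: filterS near_line_mem => h Bh; have [_ /(_ v nv)] := Nmap_normal Bh.
  have <- // : (1%:M + jac (r + h *: xi : Cb) (val x)) *m v =
     P *m v + h *: 'D_v (xi : E -> E) (val x).
  have dr : differentiable (r : E -> E) (val x) := Cb_diff [::] (val x) Br.1.
  have dxi : differentiable (xi : E -> E) (val x) := Cb_diff [::] (val x) xi_mem.
  have drh : differentiable ((r + h *: xi : Cb) : E -> E) (val x) :=
    Cb_diff [::] (val x) Bh.1.
  have D1 := diff_derivable (v := v) dr; have D2 := diff_derivable (v := v) dxi.
  rewrite /P !mulmxDl -addrA; congr (_ + _).
  rewrite -(derive_jac v drh) -(derive_jac v dr).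
  exact: etrans (deriveD D1 (derivableZ D2)) (congr1 _ (deriveZ _ D2)).
have := is_derive_unique (is_derive_dot dN (is_derive_affine _ _ 0))
  (near_eq_is_derive H (cst0 0)).
by rewrite N0 scale0r addr0 => /eqP; rewrite addr_eq0 => /eqP.
Qed.

Lemma deformed_regular : regular_normal (deform r x).
Proof.
have [U [phi [Ux le OmU]]] := Gamma_local_equation x.
have nE : outer_normal (deform r x) = unit_normal r phi (val x).
  exact: (NmapE le Ux (set_valP x) OmU (erefl (val x)) Br).
have [m1 _ _] := unit_normalP le Ux (set_valP x) OmU Br.
have uP := deform_unitmx (val x) Br.
have [_ _ _ /(_ _ Ux) g0 _] := le; have u0 := trmx_invmx_mul_neq0 uP g0.
split; first by rewrite nE.
move=> w; rewrite nE dotZl => /eqP; rewrite mulf_eq0 invr_eq0 enorm_eq0 (negPf u0) /=.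
move=> /eqP; rewrite -dot_mulmxr => gMw.
by have := deformed_tangent le Ux (set_valP x) Br gMw; rewrite mulKVmx.
Qed.

(** [undeform] is defined by choice on the deformed surface only, so it cannot be differentiated as
    it stands. The smooth inverse provided by admissibility extends locally to [H], and [xi]
    composed with [H] extends the function inside [tau_inv]. The second part serves to eliminate [H]
    along curves of Gamma. *)
Lemma undeform_extension : exists H : E -> E,
  (forall i, local_extension (fun z : deformed Gam r => xi (val (undeform z)) i 0)
     (deform r x) (fun z => xi (H z) i 0)) /\
  forall c v, c 0 = val x -> (\forall t \near (0 : R), Gam (c t)) ->
    is_derive (0 : R) 1 c v ->
    \forall t \near (0 : R), H (c t + r (c t)) = c t.
Proof.
have [_ [_ _ [h [hK sh]]]] := eps_small Br.
have [H [W [oW Wy sH HE]]] := sh (deform r x).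
have uE (z : deformed Gam r) : h (val z) = val (undeform z).
  rewrite -[in LHS](projT2 (cid (undeform_subproof z))) hK //; exact: set_valP.
exists H; split=> [i|c v c0 cG cD].
  exists W; split=> // [|z Wz]; last by rewrite HE // uE.
  apply: smooth_closure_on => //.
  apply: (SmoothComp (V := setT) (g := fun z => xi z i 0)) => //; first exact: openT.
    by apply: smooth_on_entry; [exact: openT|exact: Cb_smooth].
  by move=> j; apply: SmoothBase; exact: smooth_on_entry.
have [dF _] := deform_diff (c 0) Br.
have Wc : \forall t \near (0 : R), W (c t + r (c t)).
  have [dc _] := is_derive_comp_curve cD dF.
  have cc : {for 0, continuous (fun t => c t + r (c t))}.
    exact/differentiable_continuous/derivable1_diffP.
  by apply: cc; rewrite c0; exact: open_nbhs_nbhs.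
apply: filterS2 Wc cG => t Wt Gt; rewrite -[RHS](hK _ Gt).
have Ft : deformed Gam r (c t + r (c t)) by exists (c t).
exact: (HE (exist _ (c t + r (c t)) (mem_set Ft)) Wt).
Qed.

(** These are the two conditions of [Nmap_curve_derivative]. The columns of the matrix are
    tangential gradients, hence orthogonal to the normal. Against [P v], which is tangent to the
    deformed surface, they give the derivative of [xi] composed with [H], and along the image of a
    curve of Gamma with velocity [v] this is [D_v xi]. *)
Lemma tgradv_undeform :
  let w := - (tau (tgradv (tau_inv (r := r) (fun z : Gam => xi (val z)))) x
    *m Nmap (S := Gam) r x) in
  dot w (Nmap (S := Gam) r x) = 0 /\
  forall v, dot (outer_normal x) v = 0 ->
    dot w (P *m v) = - dot (Nmap (S := Gam) r x) ('D_v (xi : E -> E) (val x)).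
Proof.
have [H [Hext Hc]] := undeform_extension; have ry := deformed_regular.
set N0 := Nmap (S := Gam) r x; set A := tau _ x; move=> w.
pose u i (z : deformed Gam r) := xi (val (undeform z)) i 0.
have wE z : dot w z = - \sum_i N0 i 0 * dot (tgrad (u i) (deform r x)) z.
  rewrite /w dotNl; congr (- _); rewrite /dot.
  under eq_bigr do rewrite mxE mulr_suml.
  rewrite exchange_big; apply: eq_bigr => i _; rewrite mulr_sumr.
  by apply: eq_bigr => j _; rewrite [A j i]mxE mulrCA mulrA.
have nE : outer_normal (deform r x) = N0 by [].
have [N1 NP] := Nmap_normal Br; rewrite -/N0 -/P in N1 NP.
split=> [|v nv].
  rewrite wE big1 ?oppr0 // => i _; rewrite (tgrad_dot _ ry (Hext i)) nE.
  by rewrite enorm1_dot // scale1r subrr derive0 mulr0.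
rewrite wE; congr (- _); apply: eq_bigr => i _; congr (_ * _).
rewrite (tgrad_dot _ ry (Hext i)) nE NP // scale0r subr0.
have [U [phi [Ux le OmU]]] := Gamma_local_equation x; have Gx := set_valP x.
have gv : dot (gradient phi (val x)) v = 0.
  move: nv; rewrite (outer_normalE le Ux Gx OmU (erefl (val x))) dotZl => /eqP.
  have [_ _ _ /(_ _ Ux) g0 _] := le.
  by rewrite mulf_eq0 invr_eq0 enorm_eq0 (negPf g0) /= => /eqP.
have [_ _ _ _ /(_ _ v Ux Gx gv)[c [c0 cG cD]]] := le.
have [dF DF] := deform_diff (c 0) Br.
have D1 := is_derive_comp_curve cD dF; rewrite DF c0 -/P in D1.
have dv : differentiable (fun z => xi (H z) i 0) (c 0 + r (c 0)).
  by rewrite c0; exact: (local_extension_diff (Hext i)).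
have D2 := is_derive_comp_curve D1 dv; rewrite c0 in D2.
have dxi : differentiable (xi : E -> E) (c 0) := Cb_diff [::] (c 0) xi_mem.
have D3 := is_derive_entry i (is_derive_comp_curve cD dxi); rewrite c0 in D3.
apply: is_derive_unique D3; apply: near_eq_is_derive D2.
by apply: filterS (Hc c v c0 cG cD) => t ->.
Qed.

End Derivative.

Lemma Nmap_smooth : gateaux_smooth (B_infty eps) (@Nmap R Gam).
Proof.
apply: (jet_map_smooth (U := B_infty eps) Gamma_surface.1 Gamma_regular Gamma_normal_smooth
  (fun r H => H.1) (@B_infty_open R eps) Nmap_jet).
Qed.

Lemma Nmap_gderiv r xi : B_infty eps r -> gs_mem xi ->
  gderiv (@Nmap R Gam) r xi = fun x : Gam =>
    - (tau (tgradv (tau_inv (r := r) (fun z : Gam => xi (val z)))) x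
         *m @Nmap R Gam r x).
Proof.
move=> Br mx.
have [df [_ isd dE [fm _ _]]] := jet_map_derivative (U := B_infty eps)
  Gamma_surface.1 Gamma_regular Gamma_normal_smooth (fun r H => H.1) (@B_infty_open R eps) Nmap_jet.
apply/funext => x; rewrite dE //; apply/eqP; rewrite -subr_eq0; apply/eqP.
have D := is_gderiv_pointwise (U := B_infty eps) Gamma_surface.1
  (fun r H => H.1) (@B_infty_open R eps) x Br mx fm (isd r xi Br mx).
have [w0 wP] := Nmap_curve_derivative Br mx D.
have [w0' wP'] := tgradv_undeform x Br mx.
apply: (Nmap_unique_direction Br (x := x)) => [v nv|].
  by rewrite dotBl wP ?wP' // subrr.
by rewrite dotBl w0 w0' subrr.
Qed.

End Deformation.

Theorem lemma4p2 (R : realType) (Om : set 'cV[R]_3) (eps : R)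
  (Om_domain : bounded_domain Om)
  (Gamma_surface : smooth_closed_surface (boundary Om))
  (Gamma_simply_connected : simply_connected (boundary Om))
  (eps_gt0 : 0 < eps)
  (eps_small : admissible (boundary Om) eps) :
  gateaux_smooth (@B_infty R eps) (@Nmap R (boundary Om)) /\
  forall r0 xi : Cb R, B_infty eps r0 -> gs_mem xi ->
    gderiv (@Nmap R (boundary Om)) r0 xi =
    fun x : boundary Om =>
      - (tau (tgradv (tau_inv (r := r0) (fun z : boundary Om => xi (val z)))) x
           *m @Nmap R (boundary Om) r0 x).
Proof.
split.
  exact: Nmap_smooth Om_domain Gamma_surface Gamma_simply_connected eps_gt0 eps_small.
exact: Nmap_gderiv Om_domain Gamma_surface Gamma_simply_connected eps_gt0 eps_small.
Qed.
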